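(* Let $m>1$ and assume that $W$ is not $H$-stable, so that there exists a transition point $\beta_c>0$ of $\mathcal F_\beta^m$. Let $$\beta_\sharp^m:=-\frac{m\,\rho_\infty^{m-3/2}}{\displaystyle\min_{k\in\mathbb N^d,\,k\ne0}\frac{\hat W(k)}{\Theta(k)}}.$$ Then: (a) If $\rho_\infty$ is the unique minimiser of $\mathcal F^m_{\beta_\sharp^m}$, then $\beta_c=\beta_\sharp^m$ is a continuous transition point. (b) If $\rho_\infty$ is not a minimiser of $\mathcal F^m_{\beta_\sharp^m}$, then $\beta_c<\beta_\sharp^m$ is a discontinuous transition point.
   Context: $\Omega=\mathbb T^d$ is the torus of side length $L>0$, $\rho_\infty:=L^{-d}=|\Omega|^{-1}$; $\mathcal P(\Omega)$ is the set of Borel probability measures on $\Omega$, identified with their densities when these exist. $W\in C^2(\Omega)$ is even along every coordinate and has mean zero. For $m>1$, $$\mathcal F_\beta^m(\rho)=\frac{\beta^{-1}}{m-1}\int_\Omega\rho^m\,dx-\frac{\beta^{-1}}{m-1}+\frac12\iint_{\Omega\times\Omega}W(x-y)\rho(x)\rho(y)\,dx\,dy$$ whenever these quantities are finite, and $+\infty$ otherwise; ''minimiser'' means minimiser over $\mathcal P(\Omega)$. Fourier conventions ($\mathbb N\ni0$): for $k\in\mathbb Z^d$, $e_k(x)=N_k\prod_{i=1}^d e_{k_i}(x_i)$ with $e_{k_i}(x_i)=\cos(2\pi k_ix_i/L)$ if $k_i>0$, $1$ if $k_i=0$, $\sin(2\pi k_ix_i/L)$ if $k_i<0$; $N_k=L^{-d/2}\Theta(k)$,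 $\Theta(k)=\prod_{i=1}^d(2-\delta_{k_i,0})^{1/2}$; $\hat W(k)=\langle W,e_k\rangle_{L^2(\Omega)}$. $W$ is $H$-stable if $\hat W(k)\ge0$ for all $k\in\mathbb Z^d\setminus\{0\}$. Transition point: $\beta_c>0$ is a transition point of $\mathcal F_\beta^m$ if (1) for $\beta<\beta_c$, $\rho_\infty$ is the unique minimiser of $\mathcal F_\beta^m$; (2) at $\beta=\beta_c$, $\rho_\infty$ is a minimiser; (3) for every $\beta>\beta_c$ there exists a minimiser $\rho_\beta\neq\rho_\infty$ of $\mathcal F_\beta^m$. It is continuous if $\rho_\infty$ is the unique minimiser of $\mathcal F_{\beta_c}^m$ and, for any family $\{\rho_\beta\}_{\beta>\beta_c}$ of minimisers, $\limsup_{\beta\to\beta_c^+}\|\rho_\beta-\rho_\infty\|_{L^\infty(\Omega)}=0$; it is discontinuous if it is not continuous. *)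

(* Defs.v *)
From HB Require Import structures.
From mathcomp Require Import all_boot all_order all_algebra.
From mathcomp Require Import all_classical all_reals all_analysis.

Set Implicit Arguments.
Unset Strict Implicit.
Unset Printing Implicit Defensive.
Import Order.TTheory GRing.Theory Num.Theory.
Import numFieldNormedType.Exports.

Local Open Scope classical_set_scope.
Local Open Scope ring_scope.

(* The torus of side length L is represented by its fundamental cell [0, L[^d
   in R^d: functions on the torus are L-periodic functions on R^d, and Borel
   measures on the torus are Borel measures on R^d carried by the cell.
   Points that are integrated over are d-tuples, because these carry the
   product (= Borel) sigma-algebra in the library; W is defined on 'rV[R]_d,
   which carries the normed-space structure used for derivatives. *)
Notation pt R d := (d.-tuple (measurableTypeR R)).

Definition vec (R : realType) (d : nat) (x : pt R d) : 'rV[R]_d :=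
  \row_i (tnth x i : R).

Definition cell (R : realType) (L : R) (d : nat) : set (pt R d) :=
  [set x | forall i, 0 <= (tnth x i : R) < L].

Section torus_volume.
Local Open Scope ereal_scope.
Context (R : realType) (L : R).

Let mside : @measurable _ (measurableTypeR R) `[0%R, L[%classic.
Proof. exact: measurable_itv. Qed.

Let side_lty : @lebesgue_measure R `[0%R, L[%classic < +oo.
Proof. by rewrite lebesgue_measure_itv/=; case: ifP => _; rewrite ?ltry. Qed.

Definition side_measure : {finite_measure set (measurableTypeR R) -> \bar R} :=
  mfrestr mside side_lty.

Definition cons_pt n (z : measurableTypeR R * pt R n) : pt R n.+1 :=
  [the n.+1.-tuple (measurableTypeR R) of z.1 :: z.2].

Lemma measurable_cons_pt n : measurable_fun [set: _] (@cons_pt n).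
Proof. exact: measurable_cons. Qed.

HB.instance Definition _ n :=
  isMeasurableFun.Build _ _ _ _ (@cons_pt n) (@measurable_cons_pt n).

Section volume_step.
Context n (mu : {finite_measure set (pt R n) -> \bar R}).

Definition volume_step : set (pt R n.+1) -> \bar R :=
  pushforward (side_measure \x mu) (@cons_pt n).

Let volume_step0 : volume_step set0 = 0.
Proof. exact: measure0. Qed.

Let volume_step_ge0 A : 0 <= volume_step A.
Proof. exact: measure_ge0. Qed.

Let volume_step_sigma_additive : semi_sigma_additive volume_step.
Proof. exact: measure_semi_sigma_additive. Qed.

HB.instance Definition _ := isMeasure.Build _ _ _ volume_step
  volume_step0 volume_step_ge0 volume_step_sigma_additive.

Let volume_step_fin : fin_num_fun volume_step.
Proof.
apply: lty_fin_num_fun; change ((side_measure \x mu) setT < +oo).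
by rewrite -setXTT product_measure1E// ltey_eq fin_numM ?fin_num_measure.
Qed.

HB.instance Definition _ :=
  Measure_isFinite.Build _ _ _ volume_step volume_step_fin.

End volume_step.

(* Lebesgue measure on the cell [0, L[^d *)
Fixpoint volume (d : nat) : {finite_measure set (pt R d) -> \bar R} :=
  match d with
  | 0 => \d_ ([tuple] : pt R 0)
  | n.+1 => volume_step (volume n)
  end.

End torus_volume.

Section model.
Context (R : realType) (d : nat) (L : R).
Implicit Types (W : 'rV[R]_d -> R) (k : 'rV[int]_d) (beta m : R).
Implicit Types (mu nu : probability (pt R d) R).

Local Notation vol := (volume L d).

Definition torus_periodic W :=
  forall i : 'I_d, periodic W (L *: delta_mx 0 i : 'rV[R]_d).

Definition even_coordinates W := forall (i : 'I_d) (x : 'rV[R]_d),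
  W (\row_j (if j == i then - x 0 j else x 0 j)) = W x.

Definition mean_zero W := \int[vol]_x W (vec x) = 0.

Definition rho_inf : R := L ^- d.

(* rho_inf as an element of P(Omega): the normalised volume; the Dirac mass is
   only the default value of mnormalize when the volume is 0, i.e. L <= 0. *)
Definition uniform : probability (pt R d) R :=
  mnormalize vol (\d_ (nseq_tuple d 0 : pt R d)).

Definition on_torus mu := mu (cell L (d := d)) = 1%E.

Definition density mu : pt R d -> \bar R := Radon_Nikodym_SigmaFinite.f mu vol.

Section free_energy.
Local Open Scope ereal_scope.

Definition power_integral m mu := \int[vol]_x (density mu x `^ m).

Definition interaction W mu :=
  \int[vol \x vol]_z
    ((W (vec z.1 - vec z.2)%R)%:E * density mu z.1 * density mu z.2).

Definition free_energy W m beta mu : \bar R :=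
  if `[< mu `<< vol /\ power_integral m mu \is a fin_num
         /\ interaction W mu \is a fin_num >]
  then (beta^-1 / (m - 1))%:E * power_integral m mu - (beta^-1 / (m - 1))%:E
       + (2^-1)%:E * interaction W mu
  else +oo.

End free_energy.

Definition minimiser W m beta mu : Prop := on_torus mu /\
  forall nu, on_torus nu ->
    (free_energy W m beta mu <= free_energy W m beta nu)%E.

(* Measures of the library are set functions with arbitrary values on
   non-measurable sets, so they are compared on measurable sets only. *)
Definition same_measure mu nu :=
  forall A : set (pt R d), measurable A -> mu A = nu A.

Definition unique_minimiser W m beta mu : Prop := minimiser W m beta mu /\
  forall nu, minimiser W m beta nu -> same_measure nu mu.

Definition transition_point W m (betac : R) := [/\ 0 < betac,
  forall beta, 0 < beta -> beta < betac -> unique_minimiser W m beta uniform,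
  minimiser W m betac uniform &
  forall beta, betac < beta ->
    exists2 mu, minimiser W m beta mu & ~ same_measure mu uniform].

Definition dist_to_uniform mu : \bar R :=
  Lnorm vol +oo%E (fun x => density mu x - rho_inf%:E)%E.

Definition continuous_transition_point W m (betac : R) := [/\
  transition_point W m betac,
  unique_minimiser W m betac uniform &
  forall rho : R -> probability (pt R d) R,
    (forall beta, betac < beta -> minimiser W m beta (rho beta)) ->
    limf_esup (fun beta => dist_to_uniform (rho beta)) (betac^'+) = 0%E].

Definition discontinuous_transition_point W m (betac : R) :=
  transition_point W m betac /\ ~ continuous_transition_point W m betac.

Definition Theta k : R := \prod_(i < d) Num.sqrt (2 - (k 0 i == 0)%:R).

Definition fourier1 (n : int) (t : R) : R :=
  if 0 < n then cos (2 * pi * n%:~R * t / L)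
  else if n == 0 then 1
  else sin (2 * pi * n%:~R * t / L).

Definition fourier k (x : 'rV[R]_d) : R :=
  L `^ (- (d%:R / 2)) * Theta k * \prod_(i < d) fourier1 (k 0 i) (x 0 i).

Definition fourier_coef W k : R := \int[vol]_x (W (vec x) * fourier k (vec x)).

Definition H_stable W := forall k, k != 0 -> 0 <= fourier_coef W k.

(* The infimum is a minimum when W is even and not H-stable: the coefficients
   outside N^d vanish, so some value is negative, and the values tend to 0. *)
Definition min_coef W : R :=
  inf [set fourier_coef W k / Theta k | k in
        [set k : 'rV[int]_d | (forall i, 0 <= k 0 i) /\ k != 0]].

Definition beta_sharp W m : R :=
  - (m * rho_inf `^ (m - 3 / 2) / min_coef W).

End model.

Section C2.
Context (R : realType) (d : nat).
Implicit Types (f : 'rV[R]_d -> R).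

Definition partial (i : 'I_d) f : 'rV[R]_d -> R := 'D_(delta_mx 0 i) f.

Definition C1 f := continuous f /\ forall i,
  (forall x, derivable f x (delta_mx 0 i)) /\ continuous (partial i f).

Definition C2 f := C1 f /\ forall i, C1 (partial i f).

End C2.

(* Main.v *)
Require Import Defs.
From HB Require Import structures.
From mathcomp Require Import all_boot all_order all_algebra.
From mathcomp Require Import all_classical all_reals all_analysis.
From mathcomp Require Import measurable_realfun ess_sup_inf.
From mathcomp Require Import ring lra.

(** Multiplied by the inverse temperature [b] and shifted, the free energy of a
    density [f] is its excess: an entropy, strictly convex in [f] and minimal at
    the constant density [rho], plus [b / 2] times the quadratic interaction. It is
    affine in [b]. The free energy is finite only at measures with a density in
    [L^m], so that the problem is one about densities ([minimiserP]).

    Compactness. A function that is even in every coordinate and periodic is a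
    continuous function of the cosines of its coordinates, hence a uniform limit of
    cosine polynomials ([trig_approximation]); so the kernel [W (x - y)] is a
    uniform limit of kernels of finite rank. Along almost minimising densities
    finitely many moments converge, the interaction becomes continuous, and the
    uniform convexity of the entropy forces convergence in L1
    ([almost_minimisers_compact]). This gives minimisers, and cluster points of
    minimisers for converging parameters.

    From L1 to uniform closeness. A minimiser that is close to [rho] in L1 is
    uniformly close to it, because moving mass from where it is high to where it is
    low would otherwise lower the energy ([minimiser_uniform]).

    Local stability. For a bounded perturbation [h] of mean zero the excess is
    [m / 2 * rho ^ (m - 2) * |h|^2 + b / 2 * E h] up to [o(|h|^2)], and the infimum
    of [E h / |h|^2] is the infimum [lambda] of the Fourier multipliers of [W], by
    Bessel's inequality and by testing with single modes. Hence [rho] is a strict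
    local minimiser for [b] below [- m rho ^ (m - 2) / lambda], which is
    [beta_sharp], and it is unstable above.

    Conclusion. The supremum of the parameters at which [rho] is minimal is a
    transition point; it is positive, since for small [b] minimisers are close to
    [rho], and it is at most [beta_sharp]. If [rho] is the unique minimiser at
    [beta_sharp], no nonuniform minimiser exists there, so that the transition point
    is [beta_sharp], and compactness with the L1-to-uniform step makes minimisers
    above it converge uniformly to [rho]. If [rho] is no minimiser at [beta_sharp],
    the transition point lies strictly below, where [rho] is still isolated from
    other minimisers, and the nonuniform minimisers above the transition point
    cannot converge to it. *)

Set Implicit Arguments.
Unset Strict Implicit.
Unset Printing Implicit Defensive.
Import Order.TTheory GRing.Theory Num.Theory.
Import numFieldNormedType.Exports.
Local Open Scope classical_set_scope.
Local Open Scope ring_scope.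

(** * Convexity of powers *)

Section powers.
Variables (R : realType) (m : R).
Hypothesis m1 : 1 < m.
Let m0 : 0 < m. Proof. exact: lt_trans m1. Qed.

(** Young's inequality for the pair [t, 1] with conjugate exponents [m] and
    [m / (m - 1)]. *)
Lemma bernoulli_powR (t : R) : 0 <= t -> 1 + m * (t - 1) <= t `^ m.
Proof.
move=> t0; pose q := m / (m - 1).
have m10 : 0 < m - 1 by rewrite subr_gt0.
have q0 : 0 < q by rewrite divr_gt0.
have := @conjugate_powR R t 1 m q t0 ler01 m0 q0.
rewrite powR1 mulr1 => H.
have {}H : t <= t `^ m / m + q^-1.
  rewrite -[q^-1]mul1r; apply: H; rewrite /q invf_div; field.
  by rewrite gt_eqF.
have -> : 1 + m * (t - 1) = m * (t - q^-1).
  by rewrite /q; field; rewrite !gt_eqF.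
by rewrite mulrC -ler_pdivlMr// lerBlDr.
Qed.

(** Convexity of the power function, from the tangent at [1] by homogeneity. *)
Lemma tangent_powR (x y : R) : 0 <= x -> 0 <= y ->
  x `^ m + m * x `^ (m - 1) * (y - x) <= y `^ m.
Proof.
move=> x0 y0; have m10 : 0 < m - 1 by rewrite subr_gt0.
have [->|xn0] := eqVneq x 0.
  by rewrite !powR0 ?gt_eqF// mulr0 mul0r addr0 powR_ge0.
have xp : 0 < x by rewrite lt_neqAle eq_sym xn0.
have := bernoulli_powR (divr_ge0 y0 x0).
rewrite -(ler_pM2r (powR_gt0 m xp)) -powRM ?divr_ge0// divfK// => H.
apply: le_trans H; rewrite -(mulr_powRB1 x0 m0) le_eqVlt; apply/orP; left.
by apply/eqP; field.
Qed.

Lemma powR_lipschitz (B x y : R) : 0 <= x <= B -> 0 <= y <= B ->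
  `|x `^ m - y `^ m| <= m * B `^ (m - 1) * `|x - y|.
Proof.
have m10 : 0 <= m - 1 by rewrite subr_ge0 ltW.
wlog xy : x y / y <= x.
  move=> H hx hy; have [|/ltW] := leP y x; first by move=> xy; exact: H.
  by move=> yx; rewrite distrC [`|x - y|]distrC; exact: H.
move=> /andP[x0 xB] /andP[y0 yB].
have xym : y `^ m <= x `^ m by apply: ge0_ler_powR; rewrite ?nnegrE// ltW.
rewrite !ger0_norm ?subr_ge0//; have := tangent_powR x0 y0.
have : x `^ (m - 1) <= B `^ (m - 1).
  by apply: ge0_ler_powR; rewrite ?nnegrE// (le_trans x0).
move=> /(ler_wpM2l (ltW m0)); have : 0 <= x - y by rewrite subr_ge0.
move=> /ler_wpM2r h /h; lra.
Qed.

Lemma powR_cvg (u : nat -> R) (l : R) : (forall n, 0 <= u n) -> 0 <= l ->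
  u @ \oo --> l -> u n `^ m @[n --> \oo] --> l `^ m.
Proof.
move=> u0 l0 ul; apply/cvgrPdist_le => e e0.
have K0 : 0 < m * (l + 1) `^ (m - 1) by rewrite mulr_gt0// powR_gt0// ltr_wpDl.
have r0 : 0 < Num.min 1 (e / (m * (l + 1) `^ (m - 1))).
  by rewrite lt_min ltr01 divr_gt0.
move/cvgrPdist_le : ul => /(_ _ r0); apply: filterS => n.
rewrite le_min => /andP[u1 ue].
apply: le_trans (powR_lipschitz (B := l + 1) _ _) _; last first.
- by rewrite mulrC -ler_pdivlMr.
- by rewrite u0/=; move: u1; rewrite ler_distlC => /andP[].
- by rewrite l0/= lerDl.
Qed.

Lemma strict_bernoulli_powR (e : R) : 0 < e -> 1 + m * e < (1 + e) `^ m.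
Proof.
move=> e0; have m10 : 0 < m - 1 by rewrite subr_gt0.
have h1 : 0 <= 1 + e / 2 by lra.
have h2 : 0 <= 1 + e by lra.
have := tangent_powR h1 h2; apply: lt_le_trans.
have := bernoulli_powR h1.
have -> : 1 + e - (1 + e / 2) = e / 2 by field.
have : 1 < (1 + e / 2) `^ (m - 1).
  rewrite -[X in X < _](congr1 (fun f => f (m - 1)) (@powR1 R)).
  by apply: gt0_ltr_powR => //; rewrite ?nnegrE; lra.
move=> + B; rewrite addrAC subrr add0r in B.
set z := _ `^ (m - 1) => z1.
have : m * (e / 2) < m * z * (e / 2).
  by rewrite ltr_pM2r ?divr_gt0// ltr_pMr.
lra.
Qed.

(** The defect of midpoint convexity of the power function. *)
Definition gap (a b : R) := a `^ m + b `^ m - 2 * ((a + b) / 2) `^ m.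

Lemma gapC a b : gap a b = gap b a.
Proof. by rewrite /gap [a + b]addrC [a `^ m + _]addrC. Qed.

Lemma gap_ge0 a b : 0 <= a -> 0 <= b -> 0 <= gap a b.
Proof.
move=> a0 b0; have c0 : 0 <= (a + b) / 2 by lra.
have := tangent_powR c0 a0; have := tangent_powR c0 b0; rewrite /gap.
set c := (a + b) / 2; set k := m * _ => H1 H2.
have : k * (a - c) + k * (b - c) = 0 by rewrite /c; field.
lra.
Qed.

(** The tangent inequality at [b], applied to the midpoint of [a] and [b]. *)
Lemma gap_le_bregman a b : 0 <= a -> 0 <= b ->
  gap a b <= a `^ m - b `^ m - m * b `^ (m - 1) * (a - b).
Proof.
move=> a0 b0; have c0 : 0 <= (a + b) / 2 by lra.
have := tangent_powR b0 c0; rewrite /gap.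
have -> : (a + b) / 2 - b = (a - b) / 2 by field.
set k := m * _ => H.
have : k * ((a - b) / 2) *2 = k * (a - b) by field.
lra.
Qed.

(** Uniform convexity in a form that integrates. Pairs whose distance is below
    [e] times their size, or whose size is below [e], are absorbed in the first
    term. The others are [c (1 + s)] and [c (1 - s)] with [e <= s <= 1] and [c]
    bounded below, and their gap is [c ^ m] times a quantity bounded below. *)
Lemma dist_le_gap (e : R) : 0 < e ->
  exists2 K, 0 <= K & forall a b, 0 <= a -> 0 <= b ->
    `|a - b| <= e * (1 + a + b) + K * gap a b.
Proof.
move=> e0; wlog e1 : e e0 / e < 1.
  move=> H; have [//|e1] := ltP e 1; first exact: H.
  have [||K K0 HK] := H (1 / 2); [lra|lra|exists K => //].
  move=> a b a0 b0; apply: le_trans (HK _ _ a0 b0) _.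
  by rewrite lerD2r ler_wpM2r//; lra.
pose kap := (1 + e) `^ m + (1 - e) `^ m - 2.
have kap0 : 0 < kap.
  have := strict_bernoulli_powR e0.
  have /bernoulli_powR : 0 <= 1 - e by lra.
  rewrite /kap; lra.
have kapP s : e <= s <= 1 -> kap <= (1 + s) `^ m + (1 - s) `^ m - 2.
  move=> /andP[es s1].
  have p1 : 0 <= 1 + e by lra.
  have p2 : 0 <= 1 - e by lra.
  have p3 : 0 <= 1 + s by lra.
  have p4 : 0 <= 1 - s by lra.
  have := tangent_powR p1 p3; have := tangent_powR p2 p4.
  have m10 : 0 <= m - 1 by rewrite subr_ge0 ltW.
  have : (1 - e) `^ (m - 1) <= (1 + e) `^ (m - 1).
    by apply: ge0_ler_powR => //; rewrite ?nnegrE //; lra.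
  rewrite -(ler_pM2l m0) -subr_ge0 => H1.
  have /(mulr_ge0 H1) : 0 <= s - e by lra.
  rewrite /kap.
  have -> : 1 + s - (1 + e) = s - e by ring.
  have -> : 1 - s - (1 - e) = - (s - e) by ring.
  rewrite mulrBl; lra.
pose K := 2 * (((e / 2) `^ (m - 1))^-1 / kap).
have ep : 0 < (e / 2) `^ (m - 1) by rewrite powR_gt0 ?divr_gt0.
have K0 : 0 <= K by rewrite mulr_ge0// divr_ge0// ?invr_ge0 ltW.
exists K => // a b.
wlog ab : a b / b <= a.
  move=> H a0 b0; have [|/ltW] := leP b a; first by move/H; apply.
  by move/H => /(_ b0 a0); rewrite gapC distrC [1 + b + a]addrAC.
move=> a0 b0; rewrite ger0_norm ?subr_ge0//.
have g0 := gap_ge0 a0 b0.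
have Kg : 0 <= K * gap a b by rewrite mulr_ge0.
have [small|big] := leP (a - b) (e * (a + b)); first by lra.
pose c := (a + b) / 2.
have [csmall|cbig] := leP (2 * c) e.
  have : 0 <= e * (a + b) by rewrite mulr_ge0 ?addr_ge0// ltW.
  by move: csmall; rewrite /c; lra.
have c0 : 0 < c by lra.
pose s := (a - b) / (a + b).
have ab0 : 0 < a + b by move: c0; rewrite /c; lra.
have sE : a = c * (1 + s) by rewrite /s /c; field; rewrite gt_eqF.
have sE' : b = c * (1 - s) by rewrite /s /c; field; rewrite gt_eqF.
have es : e <= s <= 1.
  by rewrite /s ler_pdivlMr// ler_pdivrMr// ltW//=; lra.
have gE : gap a b = c `^ m * ((1 + s) `^ m + (1 - s) `^ m - 2).
  rewrite /gap -/c {1}sE {1}sE' !powRM; [ring|lra..].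
have cm : (e / 2) `^ (m - 1) * c <= c `^ m.
  rewrite -(mulr_powRB1 (ltW c0) m0) mulrC ler_pM2l//.
  by apply: ge0_ler_powR; rewrite ?nnegrE ?subr_ge0 1?ltW//; lra.
have : (e / 2) `^ (m - 1) * c * kap <= gap a b.
  rewrite gE; apply: ler_pM => //; last exact: kapP.
    by rewrite mulr_ge0 ?ltW.
  exact: ltW.
move=> /(ler_wpM2l K0).
have -> : K * ((e / 2) `^ (m - 1) * c * kap) = 2 * c.
  by rewrite /K; field; rewrite !gt_eqF.
have : 0 <= e * (1 + a + b) by rewrite mulr_ge0 ?addr_ge0// ltW.
rewrite /c; lra.
Qed.

Lemma powR_MVT (p t : R) : 0 < t -> exists2 z, `|z - 1| <= `|t - 1| /\ 0 < z &
  t `^ p - 1 = p * z `^ (p - 1) * (t - 1).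
Proof.
move=> t0; have cont (x y : R) : 0 < x ->
    {within `[x, y], continuous (fun u : R => u `^ p)}.
  move=> x0; apply: derivable_within_continuous => u; rewrite in_itv/= => /andP[xu _].
  by apply: derivable_powR; rewrite in_itv/= andbT; exact: lt_le_trans xu.
have der (x y : R) : 0 < x -> forall u, u \in `]x, y[ ->
    is_derive u 1 (fun u : R => u `^ p) (p * u `^ (p - 1)).
  move=> x0 u; rewrite in_itv/= => /andP[xu _].
  by apply: is_derive1_powR; exact: lt_trans xu.
have [t1|/ltW t1] := leP t 1.
  have [z] := MVT_segment t1 (der t 1 t0) (cont t 1 t0).
  rewrite in_itv/= powR1 => /andP[tz z1] E; exists z; last first.
    by rewrite -[LHS]opprB E -mulrN opprB.
  by split; [rewrite !ler0_norm; lra|exact: lt_le_trans tz].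
have [z] := MVT_segment t1 (der 1 t ltr01) (cont 1 t ltr01).
rewrite in_itv/= powR1 => /andP[z1 zt] E; exists z => //.
by split; [rewrite !ger0_norm; lra|exact: lt_le_trans z1].
Qed.

(** The remainder vanishes at [1] and its derivative is controlled by the mean
    value theorem for the exponent [m - 1]. Uniformity in [t] is what allows the
    expansion to be integrated over densities close to a constant. *)
Lemma powR_taylor2 (e : R) : 0 < e ->
  exists2 dl, 0 < dl & forall t, `|t - 1| <= dl ->
    `|t `^ m - 1 - m * (t - 1) - m * (m - 1) / 2 * (t - 1) ^+ 2|
      <= e * (t - 1) ^+ 2.
Proof.
move=> e0; have m10 : 0 < m - 1 by rewrite subr_gt0.
pose g (t : R) := t `^ m - m * t - m * (m - 1) / 2 * (t - 1) ^+ 2.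
have c : {for (1 : R), continuous (fun u : R => u `^ (m - 1 - 1))}.
  apply: differentiable_continuous; apply/derivable1_diffP.
  by apply: derivable_powR; rewrite in_itv/= ltr01.
have k0 : 0 < e / (m * (m - 1)) by rewrite divr_gt0// mulr_gt0// subr_gt0.
move/cvgrPdist_le : c => /(_ _ k0) /nbhs_ballP[/= r r0 H].
exists (Num.min (r / 2) (1 / 2)); first by rewrite lt_min !divr_gt0.
move=> t; rewrite le_min => /andP[tr t2].
have t0 : 0 < t by move: t2; rewrite ler_norml; lra.
have gder (z : R) : 0 < z -> is_derive z 1 g
    (m * z `^ (m - 1) - m - m * (m - 1) * (z - 1)).
  move=> z0; have ? := is_derive1_powR m z0.
  rewrite /g; apply: is_derive_eq.
  by rewrite /GRing.scale/=; field.
have bnd z : 0 < z -> `|z - 1| <= `|t - 1| ->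
    `|m * z `^ (m - 1) - m - m * (m - 1) * (z - 1)| <= e * `|z - 1|.
  move=> z0 zt; have [y [y1 y0]] := powR_MVT (m - 1) z0.
  have -> : m * z `^ (m - 1) - m - m * (m - 1) * (z - 1) =
     m * (z `^ (m - 1) - 1) - m * (m - 1) * (z - 1) by ring.
  move=> ->; have -> : m * ((m - 1) * y `^ (m - 1 - 1) * (z - 1)) -
     m * (m - 1) * (z - 1) = (m * (m - 1) * (z - 1)) * (y `^ (m - 1 - 1) - 1).
    by ring.
  rewrite normrM normrM mulrAC ler_wpM2r//.
  have mm : 0 < m * (m - 1) by rewrite mulr_gt0.
  rewrite (ger0_norm (ltW mm)) mulrC -ler_pdivlMr//.
  have /H : ball (1 : R) r y.
    by rewrite /ball/= distrC (le_lt_trans (le_trans y1 zt))//; lra.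
  by rewrite /= powR1 distrC.
have gE : t `^ m - 1 - m * (t - 1) - m * (m - 1) / 2 * (t - 1) ^+ 2 = g t - g 1.
  by rewrite /g powR1; ring.
rewrite gE.
have cont (x y : R) : 0 < x -> {within `[x, y], continuous g}.
  move=> x0; apply: derivable_within_continuous => u; rewrite in_itv/= => /andP[xu _].
  by have [] := gder u (lt_le_trans x0 xu).
have der (x y : R) : 0 < x -> forall u, u \in `]x, y[ -> is_derive u 1 g
    (m * u `^ (m - 1) - m - m * (m - 1) * (u - 1)).
  by move=> x0 u; rewrite in_itv/= => /andP[xu _]; apply: gder; exact: lt_trans xu.
have fin z : 0 < z -> `|z - 1| <= `|t - 1| ->
  `|(m * z `^ (m - 1) - m - m * (m - 1) * (z - 1)) * (t - 1)| <= e * (t - 1) ^+ 2.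
  move=> z0 z1; rewrite normrM -[(t - 1) ^+ 2]real_normK ?num_real//.
  rewrite expr2 mulrA ler_wpM2r//; apply: le_trans (bnd z z0 z1) _.
  by rewrite ler_wpM2l// ltW.
have [t1|/ltW t1] := leP t 1.
  have [z] := MVT_segment t1 (der t 1 t0) (cont t 1 t0).
  rewrite in_itv/= => /andP[tz z1] E; rewrite distrC E.
  rewrite -normrN -mulrN opprB.
  by apply: fin; [exact: lt_le_trans tz|rewrite !ler0_norm; lra].
have [z] := MVT_segment t1 (der 1 t ltr01) (cont 1 t ltr01).
rewrite in_itv/= => /andP[z1 zt] ->.
by apply: fin; [exact: lt_le_trans z1|rewrite !ger0_norm; lra].
Qed.

End powers.

(** * Integrable functions, bilinear forms and the inequality of Bessel *)

Section real_integral.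
Context d (T : measurableType d) (R : realType).
Variable mu : {measure set T -> \bar R}.
Implicit Types f g : T -> R.

Definition L1 f := mu.-integrable setT (EFin \o f).

Definition bounded_by f (M : R) := measurable_fun setT f /\ forall x, `|f x| <= M.

Local Notation I f := (\int[mu]_x f x).

Lemma L1_meas f : L1 f -> measurable_fun setT f.
Proof. by move=> /(measurable_int mu)/measurable_EFinP. Qed.

Lemma L1_eq f g : f =1 g -> L1 f -> L1 g.
Proof. by move=> /funext ->. Qed.

Lemma I_eq f g : f =1 g -> I f = I g.
Proof. by move=> /funext ->. Qed.

Lemma L1D f g : L1 f -> L1 g -> L1 (fun x => f x + g x).
Proof. exact: integrableD. Qed.

Lemma L1B f g : L1 f -> L1 g -> L1 (fun x => f x - g x).
Proof. exact: integrableB. Qed.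

Lemma L1Z (k : R) f : L1 f -> L1 (fun x => k * f x).
Proof. exact: integrableZl. Qed.

Lemma L1_norm f : L1 f -> L1 (fun x => `|f x|).
Proof. exact: integrable_norm. Qed.

Lemma L1_le f g : measurable_fun setT f -> (forall x, `|f x| <= g x) ->
  L1 g -> L1 f.
Proof.
move=> mf fg; apply: le_integrable => //; first exact/measurable_EFinP.
by move=> x _ /=; rewrite lee_fin (le_trans (fg x))// ler_norm.
Qed.

Lemma L1M f g M : L1 f -> bounded_by g M -> L1 (fun x => f x * g x).
Proof.
move=> Lf [mg gM]; apply: (@L1_le _ (fun x => M * `|f x|)).
- by apply: measurable_funM => //; exact: L1_meas.
- by move=> x; rewrite normrM mulrC ler_wpM2r.
- exact/L1Z/L1_norm.
Qed.

Lemma L1_sum (J : Type) (s : seq J) (F : J -> T -> R) :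
  (forall j, L1 (F j)) -> L1 (fun x => \sum_(j <- s) F j x).
Proof.
move=> LF; elim: s => [|j s IH].
  have /(@L1_eq (fun=> 0)) : L1 (fun=> 0) by exact: integrable0.
  by apply => x; rewrite big_nil.
by apply: L1_eq (L1D (LF j) IH) => x; rewrite big_cons.
Qed.

Lemma ID f g : L1 f -> L1 g -> I (fun x => f x + g x) = I f + I g.
Proof. exact: RintegralD. Qed.

Lemma IB f g : L1 f -> L1 g -> I (fun x => f x - g x) = I f - I g.
Proof. exact: RintegralB. Qed.

Lemma IZ (k : R) f : L1 f -> I (fun x => k * f x) = k * I f.
Proof. exact: RintegralZl. Qed.

Lemma I_cst (k : R) : I (fun=> k) = k * fine (mu setT).
Proof. exact: Rintegral_cst. Qed.

Lemma I_sum (J : Type) (s : seq J) (F : J -> T -> R) :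
  (forall j, L1 (F j)) -> I (fun x => \sum_(j <- s) F j x) = \sum_(j <- s) I (F j).
Proof.
move=> LF; elim: s => [|j s IH].
  rewrite big_nil -[RHS](mul0r (fine (mu setT))) -I_cst.
  by apply: I_eq => x; rewrite big_nil.
rewrite big_cons -IH -ID//; last exact: L1_sum.
by apply: I_eq => x; rewrite big_cons.
Qed.

Lemma I_le f g : L1 f -> L1 g -> (forall x, f x <= g x) -> I f <= I g.
Proof. by move=> Lf Lg fg; apply: le_Rintegral. Qed.

Lemma I_ge0 f : (forall x, 0 <= f x) -> 0 <= I f.
Proof. by move=> f0; apply: Rintegral_ge0. Qed.

Lemma I_norm f : L1 f -> `|I f| <= I (fun x => `|f x|).
Proof. exact: le_normr_Rintegral. Qed.

Lemma I_EFin f : L1 f -> (I f)%:E = (\int[mu]_x (f x)%:E)%E.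
Proof. by move=> Lf; rewrite /Rintegral fineK// integrable_fin_num. Qed.

Lemma I_ae f g : measurable_fun setT f -> measurable_fun setT g ->
  {ae mu, forall x, f x = g x} -> I f = I g.
Proof.
move=> mf mg fg; congr fine; apply: ae_eq_integral => //.
- exact/measurable_EFinP.
- exact/measurable_EFinP.
- by apply: filterS fg => x + _ => /= ->.
Qed.

Lemma L1_ae f g : measurable_fun setT g -> L1 f ->
  {ae mu, forall x, f x = g x} -> L1 g.
Proof.
move=> mg /integrableP[mf fi] fg; apply/integrableP; split.
  exact/measurable_EFinP.
apply: le_lt_trans fi; rewrite le_eqVlt; apply/orP; left; apply/eqP.
apply: ge0_ae_eq_integral => //.
- by apply/measurableT_comp => //; exact/measurable_EFinP.
- exact: measurableT_comp.
- by apply: filterS fg => x /= -> _.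
Qed.

Lemma I_eq0_ae f : L1 f -> (forall x, 0 <= f x) -> I f = 0 ->
  {ae mu, forall x, f x = 0}.
Proof.
move=> Lf f0 If0.
have : (\int[mu]_x `|(f x)%:E| = 0)%E.
  under eq_integral do rewrite abse_EFin ger0_norm//.
  by rewrite -I_EFin// If0.
move/ae_eq_integral_abs => /(_ measurableT) H.
have /H : measurable_fun setT (EFin \o f) by exact: measurable_int Lf.
by apply: filterS => x /(_ Logic.I) [].
Qed.

Lemma fatou_bound (u : nat -> T -> R) f (C : R) : measurable_fun setT f ->
  (forall n, L1 (u n)) -> (forall n x, 0 <= u n x) ->
  (forall n, I (u n) <= C) -> (forall x, 0 <= f x) ->
  {ae mu, forall x, u ^~ x @ \oo --> f x} -> L1 f /\ I f <= C.
Proof.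
move=> mf Lu u0 uC f0 uf.
have mu_ n : measurable_fun setT (EFin \o u n) by exact: measurable_int (Lu n).
have := @fatou _ _ _ mu setT measurableT (fun n => EFin \o u n) mu_ _.
have u0' n x : setT x -> (0 <= (EFin \o u n) x)%E by move=> _; rewrite lee_fin.
move=> /(_ u0') F.
have {}F : (\int[mu]_x (f x)%:E <= C%:E)%E.
  apply: le_trans (le_trans F _).
    rewrite le_eqVlt; apply/orP; left; apply/eqP; apply: ae_eq_integral => //.
    - exact/measurable_EFinP.
    - rewrite /limn_einf; apply: measurableT_comp => //.
      apply: (@measurable_fun_limn_esup _ _ _ _ (fun n x => (- (u n x)%:E)%E)) => n.
      exact: measurableT_comp (mu_ n).
    apply: filterS uf => x ux _ /=.
    have : (EFin (u n x)) @[n --> \oo] --> (f x)%:E by apply: cvg_EFin => //; exact: nearW.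
    move=> h; rewrite is_cvg_limn_einfE; last by apply/cvg_ex; eexists; exact: h.
    by apply/esym/cvg_lim => //; exact: h.
  rewrite limn_einf_lim; apply: lime_le; first exact: is_cvg_einfs.
  apply: nearW => n; apply: (@le_trans _ _ (\int[mu]_x (u n x)%:E)%E).
    by apply: ereal_inf_lbound; exists n => /=.
  by rewrite -I_EFin// lee_fin.
have Lf : L1 f.
  apply/integrableP; split; first exact/measurable_EFinP.
  under eq_integral do rewrite /= ger0_norm//.
  by rewrite (le_lt_trans F)// ltry.
by split => //; rewrite -lee_fin I_EFin.
Qed.

(** The pointwise sum of the increments has integral at most [C]: it is finite
    almost everywhere, where the sequence converges, and together with [u 0] it
    dominates the sequence, so that the convergence also holds in L1. *)
Lemma L1_complete (u : nat -> T -> R) (C : R) : (forall n, L1 (u n)) ->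
  (forall n, \sum_(i < n) I (fun x => `|u i.+1 x - u i x|) <= C) ->
  exists f, [/\ L1 f, {ae mu, forall x, u ^~ x @ \oo --> f x} &
    I (fun x => `|f x - u n x|) @[n --> \oo] --> 0].
Proof.
move=> Lu uC; pose a n x := `|u n.+1 x - u n x|.
have La n : L1 (a n) by apply: L1_norm; exact: L1B.
have a0 n x : (0 <= (a n x)%:E)%E by rewrite lee_fin normr_ge0.
have ma n : measurable_fun setT (fun x => (a n x)%:E).
  exact: measurable_int (La n).
pose G x := (\sum_(0 <= n <oo) (a n x)%:E)%E.
have G0 x : (0 <= G x)%E by apply: nneseries_ge0 => n _ _.
have mG : measurable_fun setT G by exact: ge0_emeasurable_sum.
have iG : (\int[mu]_x G x <= C%:E)%E.
  rewrite integral_nneseries//; apply: lime_le.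
    by apply: is_cvg_nneseries => n _ _; exact: integral_ge0.
  apply: nearW => n; rewrite big_mkord.
  under eq_bigr do rewrite -I_EFin//.
  by rewrite sumEFin lee_fin; exact: uC.
have LG : mu.-integrable setT G.
  apply/integrableP; split => //; under eq_integral do rewrite gee0_abs//.
  by rewrite (le_lt_trans iG)// ltry.
have aeG := integrable_ae measurableT LG.
have ucvg x : G x \is a fin_num -> cvgn (u ^~ x).
  move=> Gx; pose w n := u n.+1 x - u n x.
  have : cvgn [normed series w].
    apply: nondecreasing_is_cvgn.
      by apply: nondecreasing_series => n _ _; exact: normr_ge0.
    exists (fine (G x)) => _ [n _ <-]; rewrite -lee_fin fineK// /series/=.
    rewrite -sumEFin; exact: nneseries_lim_ge.
  move/normed_cvg => /cvg_ex[l wl]; apply/cvg_ex; exists (l + u 0%N x).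
  have -> : u ^~ x = (fun n => series w n + u 0%N x).
    by apply/funext => n; rewrite /series/= telescope_sumr// subrK.
  by apply: cvgD => //; exact: cvg_cst.
pose f x := fine (limn_esup (fun n => (u n x)%:E)).
have uf : {ae mu, forall x, u ^~ x @ \oo --> f x}.
  apply: filterS aeG => x /(_ Logic.I) /ucvg /cvg_ex[l ul].
  have h : (u n x)%:E @[n --> \oo] --> l%:E by apply: cvg_EFin => //; exact: nearW.
  rewrite /f is_cvg_limn_esupE; last by apply/cvg_ex; exists l%:E.
  by rewrite (cvg_lim _ h).
have mf : measurable_fun setT f.
  apply: measurableT_comp => //.
  by apply: measurable_fun_limn_esup => n; exact: measurable_int (Lu n).
have Lg : mu.-integrable setT (fun x => `|u 0%N x|%:E + G x)%E.
  by apply: integrableD => //; exact: L1_norm.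
have mu_ n : measurable_fun setT (EFin \o u n) by exact: measurable_int (Lu n).
have [| | |Lf H _] :=
  @dominated_convergence _ _ _ mu setT measurableT _ (EFin \o f) _ mu_ _ _ Lg.
- exact/measurable_EFinP.
- by apply: filterS uf => x ux _; apply: cvg_EFin => //; exact: nearW.
- apply: aeW => x n _ /=.
  have -> : u n x = u 0%N x + \sum_(0 <= i < n) (u i.+1 x - u i x).
    by rewrite telescope_sumr// addrC subrK.
  rewrite (@le_trans _ _ (`|u 0%N x| + \sum_(0 <= i < n) a i x)%:E)//.
    by rewrite lee_fin (le_trans (ler_normD _ _))// lerD2l ler_norm_sum.
  rewrite EFinD leeD2l// -sumEFin; exact: nneseries_lim_ge.
exists f; split => //.
have -> : (fun n => I (fun x => `|f x - u n x|)) =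
    fine \o (fun n => \int[mu]_x `|(u n x)%:E - (f x)%:E|)%E.
  apply/funext => n; rewrite /Rintegral/=; congr fine.
  by apply: eq_integral => x _; rewrite distrC.
exact: fine_cvg H.
Qed.
End real_integral.

Section finite_integral.
Context d (T : measurableType d) (R : realType).
Variable mu : {finite_measure set T -> \bar R}.
Implicit Types f g : T -> R.

Lemma L1_cst (k : R) : L1 mu (fun=> k).
Proof. exact: finite_measure_integrable_cst. Qed.

Lemma L1_bounded f M : bounded_by f M -> L1 mu f.
Proof. by move=> [mf fM]; apply: L1_le _ _ (L1_cst M). Qed.

End finite_integral.

Section product_integral.
Context d1 d2 (T1 : measurableType d1) (T2 : measurableType d2) (R : realType).
Variables (mu1 : {finite_measure set T1 -> \bar R})
  (mu2 : {finite_measure set T2 -> \bar R}).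
Implicit Types (g : T1 -> R) (h : T2 -> R).

Lemma measurable_prod_fun g h : measurable_fun setT g -> measurable_fun setT h ->
  measurable_fun setT (fun z : T1 * T2 => g z.1 * h z.2).
Proof. by move=> mg mh; apply: measurable_funM; apply: measurableT_comp. Qed.

Lemma L1_prod g h : L1 mu1 g -> L1 mu2 h ->
  L1 (mu1 \x mu2)%E (fun z => g z.1 * h z.2).
Proof.
move=> Lg Lh; apply/integrable12ltyP => /=.
  by apply/measurable_EFinP; exact: measurable_prod_fun (L1_meas Lg) (L1_meas Lh).
under eq_integral => x _.
  under eq_integral do rewrite /= normrM EFinM.
  rewrite integralZl//; last exact: L1_norm.
  rewrite -I_EFin; last exact: L1_norm.
  rewrite -EFinM mulrC; over.
rewrite -I_EFin ?ltry//; apply: L1Z; exact: L1_norm.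
Qed.

Lemma I_prod g h : L1 mu1 g -> L1 mu2 h ->
  \int[(mu1 \x mu2)%E]_z (g z.1 * h z.2) = \int[mu1]_x g x * \int[mu2]_x h x.
Proof.
move=> Lg Lh; have Lp := L1_prod Lg Lh.
rewrite /Rintegral -integral12_prod_meas1//= -[in RHS]/(Rintegral _ _ _).
rewrite -[X in _ = _ * X]/(\int[mu2]_x h x) mulrC -IZ//.
rewrite /Rintegral; congr fine; apply: eq_integral => x _ /=.
rewrite /fubini_F/=; under eq_integral do rewrite EFinM.
by rewrite integralZl// -I_EFin// -EFinM mulrC.
Qed.

End product_integral.

Section bilinear_form.
Context d (T : measurableType d) (R : realType).
Variable mu : {finite_measure set T -> \bar R}.
Implicit Types f g h : T -> R.

Definition bil (w : T * T -> R) g h := \int[(mu \x mu)%E]_z (g z.1 * h z.2 * w z).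

Variables (w : T * T -> R) (M : R).
Hypothesis wM : bounded_by w M.

Let LB g h : L1 mu g -> L1 mu h -> L1 (mu \x mu)%E (fun z => g z.1 * h z.2 * w z).
Proof. by move=> Lg Lh; apply: L1M wM; exact: L1_prod. Qed.

Lemma bilDl f g h : L1 mu f -> L1 mu g -> L1 mu h ->
  bil w (fun x => f x + g x) h = bil w f h + bil w g h.
Proof.
move=> Lf Lg Lh; rewrite /bil -ID; [|exact: LB..].
by apply: I_eq => z; ring.
Qed.

Lemma bilDr f g h : L1 mu f -> L1 mu g -> L1 mu h ->
  bil w h (fun x => f x + g x) = bil w h f + bil w h g.
Proof.
move=> Lf Lg Lh; rewrite /bil -ID; [|exact: LB..].
by apply: I_eq => z; ring.
Qed.

Lemma bilZl k g h : L1 mu g -> L1 mu h -> bil w (fun x => k * g x) h = k * bil w g h.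
Proof.
move=> Lg Lh; rewrite /bil -IZ; [|exact: LB].
by apply: I_eq => z; ring.
Qed.

Lemma bilZr k g h : L1 mu g -> L1 mu h -> bil w h (fun x => k * g x) = k * bil w h g.
Proof.
move=> Lg Lh; rewrite /bil -IZ; [|exact: LB].
by apply: I_eq => z; ring.
Qed.

Lemma bil_le g h : L1 mu g -> L1 mu h ->
  `|bil w g h| <= M * (\int[mu]_x `|g x| * \int[mu]_x `|h x|).
Proof.
move=> Lg Lh; apply: le_trans (I_norm (LB Lg Lh)) _.
have [Lg' Lh'] := (L1_norm Lg, L1_norm Lh).
rewrite -I_prod// -IZ; last exact: (L1_prod Lg' Lh').
apply: I_le => [||z].
- exact: (L1_norm (LB Lg Lh)).
- exact: (L1Z M (L1_prod Lg' Lh')).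
- rewrite !normrM [X in _ <= X]mulrC ler_wpM2l ?mulr_ge0//.
  by have [_] := wM; apply.
Qed.

Lemma bil_close w' M' e g h : bounded_by w' M' ->
  (forall z, `|w z - w' z| <= e) -> L1 mu g -> L1 mu h ->
  `|bil w g h - bil w' g h| <=
    e * (\int[mu]_x `|g x| * \int[mu]_x `|h x|).
Proof.
move=> w'M we Lg Lh; have Lp := L1_prod Lg Lh.
have Lp' := L1M Lp w'M.
have mp := measurable_funB wM.1 w'M.1.
have Lq : L1 (mu \x mu)%E (fun z => g z.1 * h z.2 * (w z - w' z)).
  by apply: (@L1M _ _ _ _ _ _ e Lp); split.
rewrite /bil -IB//; last exact: LB.
rewrite (@I_eq _ _ _ _ _ (fun z => g z.1 * h z.2 * (w z - w' z))); last first.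
  by move=> z; rewrite mulrBr.
apply: le_trans (I_norm Lq) _.
have [Lg' Lh'] := (L1_norm Lg, L1_norm Lh).
rewrite -I_prod// -IZ; last exact: (L1_prod Lg' Lh').
apply: I_le => [||z].
- exact: (L1_norm Lq).
- exact: (L1Z e (L1_prod Lg' Lh')).
- by rewrite !normrM [X in _ <= X]mulrC ler_wpM2l ?mulr_ge0.
Qed.

End bilinear_form.

Section finite_rank.
Context d (T : measurableType d) (R : realType).
Variable mu : {finite_measure set T -> \bar R}.
Variables (J : finType) (p : J -> R) (phi : J -> T -> R).
Hypothesis phi1 : forall j, bounded_by (phi j) 1.

Definition finite_rank_kernel (z : T * T) := \sum_j p j * (phi j z.1 * phi j z.2).

Lemma finite_rank_bounded : bounded_by finite_rank_kernel (\sum_j `|p j|).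
Proof.
split.
  apply: measurable_sum => j; apply: measurable_funM => //.
  by apply: measurable_prod_fun; case: (phi1 j).
move=> z; apply: le_trans (ler_norm_sum _ _ _) _; apply: ler_sum => j _.
by rewrite 2!normrM ler_piMr// mulr_ile1//; case: (phi1 j).
Qed.

(** A finite-rank kernel only sees finitely many moments of its arguments. *)
Lemma bil_finite_rank (g h : T -> R) : L1 mu g -> L1 mu h ->
  bil mu finite_rank_kernel g h =
  \sum_j p j * (\int[mu]_x (g x * phi j x) * \int[mu]_x (h x * phi j x)).
Proof.
move=> Lg Lh; have Lphi f j : L1 mu f -> L1 mu (fun x => f x * phi j x).
  by move=> Lf; exact: L1M (phi1 j).
have Lj j := L1_prod (Lphi g j Lg) (Lphi h j Lh).
under eq_bigr do rewrite -I_prod ?Lphi// -(IZ _ (Lj _)).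
rewrite -I_sum; last by move=> j; exact: (L1Z (p j) (Lj j)).
apply: I_eq => z; rewrite /finite_rank_kernel mulr_sumr.
by apply: eq_bigr => j _; ring.
Qed.

End finite_rank.

Section bessel.
Context d (T : measurableType d) (R : realType).
Variable mu : {finite_measure set T -> \bar R}.
Variables (J : finType) (phi : J -> T -> R) (nu : J -> R).
Hypotheses (phi1 : forall j, bounded_by (phi j) 1)
  (orth : forall i j, \int[mu]_x (phi i x * phi j x) = if i == j then nu i else 0).

(** The square of [h] minus its projection has nonnegative integral. Elements of
    the family may vanish: the sum skips those of norm zero. *)
Lemma bessel (h : T -> R) C : bounded_by h C ->
  \sum_(j | 0 < nu j) (\int[mu]_x (h x * phi j x)) ^+ 2 / nu j <=
  \int[mu]_x (h x ^+ 2).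
Proof.
move=> hC; have Lh := L1_bounded mu hC.
pose mom j := \int[mu]_x (h x * phi j x).
pose c j := if 0 < nu j then mom j / nu j else 0.
pose g x := \sum_j c j * phi j x.
have Lphi j : L1 mu (phi j) by exact: L1_bounded (phi1 j).
have Lhp j : L1 mu (fun x => h x * phi j x) by exact: L1M (phi1 j).
have Lpp i j : L1 mu (fun x => phi i x * phi j x) by exact: L1M (phi1 j).
have Lhh : L1 mu (fun x => h x * h x) by exact: L1M hC.
have Lhg : L1 mu (fun x => \sum_j c j * (h x * phi j x)).
  by apply: L1_sum => j; exact: L1Z.
have Lgg : L1 mu (fun x => \sum_i \sum_j c i * (c j * (phi i x * phi j x))).
  by apply: L1_sum => i; apply: L1_sum => j; do 2 apply: L1Z.
have S0 : 0 <= \int[mu]_x (h x - g x) ^+ 2 by apply: I_ge0 => x; exact: sqr_ge0.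
have SE : \int[mu]_x (h x - g x) ^+ 2 = \int[mu]_x (h x * h x) -
    2 * (\sum_j c j * mom j) + \sum_i c i * (c i * nu i).
  rewrite (@I_eq _ _ _ _ _ (fun x => h x * h x - 2 * (\sum_j c j * (h x * phi j x)) +
     \sum_i \sum_j c i * (c j * (phi i x * phi j x)))); last first.
    move=> x.
    have -> : \sum_j c j * (h x * phi j x) = h x * g x.
      by rewrite /g mulr_sumr; apply: eq_bigr => j _; rewrite mulrCA.
    have -> : \sum_i \sum_j c i * (c j * (phi i x * phi j x)) = g x * g x.
      rewrite {1}/g mulr_suml; apply: eq_bigr => i _.
      by rewrite /g mulr_sumr; apply: eq_bigr => j _; ring.
    by ring.
  rewrite ID//; last by apply: L1B => //; exact: L1Z.
  rewrite IB//; last exact: L1Z.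
  rewrite IZ// I_sum; last by move=> j; exact: L1Z.
  congr (_ - 2 * _ + _); first by apply: eq_bigr => j _; rewrite IZ.
  rewrite I_sum; last by move=> i; apply: L1_sum => j; do 2 apply: L1Z.
  apply: eq_bigr => i _; rewrite I_sum; last by move=> j; do 2 apply: L1Z.
  rewrite (bigD1 i)//= big1 ?addr0.
    by rewrite IZ ?IZ ?orth ?eqxx//; exact: L1Z.
  by move=> j ji; rewrite IZ ?IZ ?orth 1?eq_sym ?(negbTE ji) ?mulr0//; exact: L1Z.
have cE j : c j * (c j * nu j) = c j * mom j.
  rewrite /c; case: ifPn => [n0|_]; last by rewrite !mul0r.
  by rewrite divfK// gt_eqF.
have -> : \int[mu]_x (h x ^+ 2) = \int[mu]_x (h x * h x).
  by apply: I_eq => x; rewrite expr2.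
have -> : \sum_(j | 0 < nu j) mom j ^+ 2 / nu j = \sum_j c j * mom j.
  rewrite big_mkcond/=; apply: eq_bigr => j _; rewrite /c; case: ifPn => // _.
    by rewrite expr2 mulrAC.
  by rewrite mul0r.
have S2 : \sum_i c i * (c i * nu i) = \sum_i c i * mom i.
  by apply: eq_bigr => i _; exact: cE.
by move: S0; rewrite SE S2; lra.
Qed.

End bessel.

(** * Densities of small excess on a finite measure space *)

(** The limit is the supremum of the levels exceeded on a set of the ultrafilter. *)
Lemma ultra_bounded_cvg (X : Type) (R : realType) (U : set_system X)
    (a : X -> R) (C : R) : UltraFilter U -> U [set x | `|a x| <= C] ->
  exists l, forall e, 0 < e -> U [set x | `|a x - l| <= e].
Proof.
move=> UU UC; pose S := [set t | U [set x | t <= a x]].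
have S0 : S (- C).
  by apply: filterS UC => x /=; rewrite ler_norml => /andP[].
have Sub : ubound S C.
  move=> t St; have [x [/= tx xC]] := filter_ex (filterI St UC).
  by rewrite (le_trans tx)// (le_trans (ler_norm _)).
have supS : has_sup S by split; [exists (- C)|exists C].
exists (sup S) => e e0.
have [t St tl] := sup_adherent e0 supS.
have : U (~` [set x | sup S + e <= a x]).
  have [SU|//] := in_ultra_setVsetC [set x | sup S + e <= a x] UU.
  by have := ub_le_sup supS.2 SU; lra.
apply: filterS2 St => x /= tx /negP; rewrite -ltNge => xl.
rewrite ler_distl; lra.
Qed.

Section variational.
Context d (T : measurableType d) (R : realType).
Variables (mu : {finite_measure set T -> \bar R}) (w : T * T -> R) (M m : R).
Hypotheses (m1 : 1 < m) (wM : bounded_by w M) (muT : 0 < fine (mu setT)).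
Implicit Types f g h : T -> R.

Local Notation I f := (\int[mu]_x f x).
Local Notation V := (fine (mu setT)).
Local Notation rho := (fine (mu setT))^-1.
Local Notation N f := (\int[mu]_x `|f x|).
Local Notation E f := (bil mu w f f).

Definition finite_rank_approx := forall e : R, 0 < e ->
  exists (J : finType) (p : J -> R) (phi : J -> T -> R),
    (forall j, bounded_by (phi j) 1) /\
    forall z, `|w z - finite_rank_kernel p phi z| <= e.

Definition annihilates_constants := forall f, L1 mu f ->
  bil mu w f (fun=> 1) = 0 /\ bil mu w (fun=> 1) f = 0.

Definition density_fun f := [/\ forall x, 0 <= f x, L1 mu f, I f = 1 &
  L1 mu (fun x => f x `^ m)].

(** With inverse temperature [b], this is [b] times the free energy, shifted so
    that the constant density has excess 0 if the kernel annihilates constants.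
    Multiplying by [b] makes the functional affine in the parameter. *)
Definition excess (b : R) f :=
  (I (fun x => f x `^ m) - rho `^ (m - 1)) / (m - 1) + b / 2 * E f.

Definition excess_minimiser b f :=
  density_fun f /\ forall g, density_fun g -> excess b f <= excess b g.

Let m0 : 0 < m. Proof. exact: lt_trans m1. Qed.
Let m10 : 0 < m - 1. Proof. by rewrite subr_gt0. Qed.
Let rho0 : 0 < rho. Proof. by rewrite invr_gt0. Qed.
Let M0 : 0 <= M.
Proof. by have [_ /(_ (point, point))] := wM; apply: le_trans. Qed.

Lemma measurable_powm f : measurable_fun setT f ->
  measurable_fun setT (fun x => f x `^ m).
Proof. by move=> mf; apply: (measurableT_comp (measurable_powR m)). Qed.

Lemma N_ge0 f : 0 <= N f.
Proof. exact: I_ge0. Qed.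

Lemma N_density f : density_fun f -> N f = 1.
Proof.
move=> [f0 Lf <- _]; apply: I_eq => x; exact: ger0_norm.
Qed.

Lemma N_sub_le f g : L1 mu f -> L1 mu g ->
  N (fun x => f x - g x) <= N f + N g.
Proof.
move=> Lf Lg; rewrite -ID; try exact: L1_norm.
apply: I_le => [||x].
- exact/L1_norm/L1B.
- by apply: L1D; exact: L1_norm.
- exact: ler_normB.
Qed.

Lemma bilBl f g h : L1 mu f -> L1 mu g -> L1 mu h ->
  bil mu w (fun x => f x - g x) h = bil mu w f h - bil mu w g h.
Proof.
move=> Lf Lg Lh; have Lg' := L1Z (-1) Lg.
rewrite -mulN1r -(bilZl wM)// -(bilDl wM)//.
by congr bil; apply/funext => x; rewrite mulN1r.
Qed.

Lemma bilBr f g h : L1 mu f -> L1 mu g -> L1 mu h ->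
  bil mu w h (fun x => f x - g x) = bil mu w h f - bil mu w h g.
Proof.
move=> Lf Lg Lh; have Lg' := L1Z (-1) Lg.
rewrite -mulN1r -(bilZr wM)// -(bilDr wM)//.
by congr bil; apply/funext => x; rewrite mulN1r.
Qed.

Lemma bil_parallelogram f g : L1 mu f -> L1 mu g ->
  E (fun x => (f x + g x) / 2) = (E f + E g) / 2 - E (fun x => f x - g x) / 4.
Proof.
move=> Lf Lg; have Ls := L1D Lf Lg; have Ld := L1B Lf Lg.
rewrite (bilBl Lf Lg Ld) !bilBr//.
have -> : (fun x => (f x + g x) / 2) = (fun x => 2^-1 * (f x + g x)).
  by apply/funext => x; rewrite mulrC.
rewrite (bilZl wM)//; last exact: L1Z.
rewrite (bilZr wM)// (bilDl wM)// !(bilDr wM)//.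
by field.
Qed.

Lemma bil_continuous f g : L1 mu f -> L1 mu g ->
  `|E f - E g| <= M * ((N f + N g) * N (fun x => f x - g x)).
Proof.
move=> Lf Lg; have Ld := L1B Lf Lg.
have -> : E f - E g = bil mu w (fun x => f x - g x) f +
    bil mu w g (fun x => f x - g x).
  by rewrite bilBl// bilBr//; ring.
apply: le_trans (ler_normD _ _) _.
have := bil_le wM Ld Lf; have := bil_le wM Lg Ld.
have -> : M * ((N f + N g) * N (fun x => f x - g x)) =
  M * (N (fun x => f x - g x) * N f) + M * (N g * N (fun x => f x - g x)).
  by ring.
move=> h1 h2; exact: lerD.
Qed.

Lemma bil_density_le f : density_fun f -> `|E f| <= M.
Proof.
move=> Df; have [_ Lf _ _] := Df.
by apply: le_trans (bil_le wM Lf Lf) _; rewrite N_density// !mulr1.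
Qed.

Lemma density_rho : density_fun (fun=> rho).
Proof.
split => //; rewrite ?I_cst ?mulVf ?gt_eqF//.
- by move=> _; exact: ltW.
- exact: L1_cst.
- exact: L1_cst.
Qed.

Section constants.
Hypothesis w1 : annihilates_constants.

Lemma bil_rho f : L1 mu f ->
  bil mu w f (fun=> rho) = 0 /\ bil mu w (fun=> rho) f = 0.
Proof.
move=> Lf; have L : L1 mu (fun=> 1) by exact: L1_cst.
have -> : (fun=> rho) = (fun x : T => rho * (fun=> 1) x).
  by apply/funext => x; rewrite mulr1.
by rewrite (bilZl wM)// (bilZr wM)// (w1 Lf).1 (w1 Lf).2 mulr0.
Qed.

Lemma bil_shift f : L1 mu f -> E f = E (fun x => f x - rho).
Proof.
move=> Lf; have Lr : L1 mu (fun=> rho) by exact: L1_cst.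
have Ld := L1B Lf Lr.
by rewrite (bilBl Lf Lr Ld) !bilBr// !(bil_rho _).1// (bil_rho _).2// !subr0.
Qed.

Lemma excess_rho b : excess b (fun=> rho) = 0.
Proof.
rewrite /excess (bil_rho (L1_cst mu rho)).1 mulr0 addr0 I_cst -(mulr_powRB1 (ltW rho0) m0).
by rewrite mulrAC mulVf ?gt_eqF// mul1r subrr mul0r.
Qed.

End constants.

Lemma L1_gap f g : density_fun f -> density_fun g ->
  L1 mu (fun x => gap m (f x) (g x)).
Proof.
move=> [f0 Lf f1 fm] [g0 Lg g1 gm].
have Ls := L1D fm gm; apply: (@L1_le _ _ _ _ _ _ _ _ Ls).
  apply: measurable_funB; first exact: L1_meas Ls.
  apply: measurable_funM => //; apply: measurable_powm.
  by apply: measurable_funM => //; apply: L1_meas (L1D Lf Lg).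
move=> x; rewrite ger0_norm ?gap_ge0// /gap lerBlDr lerDl mulr_ge0//.
exact: powR_ge0.
Qed.

Lemma density_midpoint f g : density_fun f -> density_fun g ->
  density_fun (fun x => (f x + g x) / 2).
Proof.
move=> Df Dg; have Lgap := L1_gap Df Dg.
move: Df Dg => [f0 Lf f1 fm] [g0 Lg g1 gm].
have -> : (fun x => (f x + g x) / 2) = (fun x => 2^-1 * (f x + g x)).
  by apply/funext => x; rewrite mulrC.
split.
- by move=> x; rewrite mulr_ge0// addr_ge0.
- exact/L1Z/L1D.
- by rewrite IZ ?ID ?f1 ?g1//; [field|exact: L1D].
- have := L1Z 2^-1 (L1B (L1D fm gm) Lgap); apply: L1_eq => x.
  by rewrite /gap [_ * (f x + g x)]mulrC; field.
Qed.

(** The interaction is quadratic, so that its midpoint defect is its value at the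
    difference; the entropy contributes its convexity gap. *)
Lemma excess_midpoint b f g : density_fun f -> density_fun g ->
  excess b (fun x => (f x + g x) / 2) = (excess b f + excess b g) / 2
    - I (fun x => gap m (f x) (g x)) / 2 / (m - 1) - b / 8 * E (fun x => f x - g x).
Proof.
move=> Df Dg; have Lgap := L1_gap Df Dg.
have [_ _ _ hm] := density_midpoint Df Dg.
move: Df Dg => [f0 Lf f1 fm] [g0 Lg g1 gm].
rewrite /excess bil_parallelogram//.
have -> : I (fun x => gap m (f x) (g x)) = I (fun x => f x `^ m) +
    I (fun x => g x `^ m) - 2 * I (fun x => ((f x + g x) / 2) `^ m).
  rewrite -IZ// -ID// -IB//; [exact: L1D|exact: L1Z].
by field; rewrite gt_eqF.
Qed.

(** [dist_le_gap] integrated; the total masses are [1]. *)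
Lemma L1_dist_le_gap (e : R) : 0 < e -> exists2 K, 0 <= K &
  forall f g, density_fun f -> density_fun g ->
    N (fun x => f x - g x) <= e + K * I (fun x => gap m (f x) (g x)).
Proof.
move=> e0; have e'0 : 0 < e / (V + 2) by rewrite divr_gt0// addr_gt0.
have [K K0 HK] := dist_le_gap m1 e'0; exists K => // f g Df Dg.
have Lgap := L1_gap Df Dg.
move: Df Dg => [f0 Lf f1 fm] [g0 Lg g1 gm].
have Ls : L1 mu (fun x => 1 + f x + g x).
  by apply: L1D => //; apply: L1D => //; exact: L1_cst.
have -> : e = e / (V + 2) * I (fun x => 1 + f x + g x).
  rewrite ID ?ID ?I_cst// ?f1 ?g1 ?mul1r; first by field; rewrite gt_eqF ?addr_gt0.
  - exact: L1_cst.
  - by apply: L1D => //; exact: L1_cst.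
rewrite -!IZ// -ID; [|exact: L1Z|exact: L1Z].
apply: I_le => [||x]; [exact/L1_norm/L1B|by apply: L1D; exact: L1Z|exact: HK].
Qed.

(** Along the ultrafilter the finitely many moments seen by a finite-rank
    approximation of the kernel converge, so that the interaction energy of the
    difference of two densities is almost zero. By the midpoint identity their
    entropy gap is then almost zero too, since their midpoint cannot have excess
    below [c]; and the entropy gap controls the distance in L1. *)
Lemma cauchy_of_moments (b : R) (c : R) (U : set_system (T -> R)) :
  finite_rank_approx -> 0 <= b -> UltraFilter U ->
  (forall f, density_fun f -> c <= excess b f) ->
  (forall e, 0 < e -> U [set f | density_fun f /\ excess b f <= c + e]) ->
  forall e, 0 < e -> exists2 A, U A & forall f g, A f -> A g ->
    N (fun x => f x - g x) <= e.
Proof.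
move=> fr b0 UU cmin Uc e e0.
have e20 : 0 < e / 2 by rewrite divr_gt0.
have [K K0 HK] := L1_dist_le_gap e20.
(* The tolerance [t] is used for the kernel and for the excess; [s] is the
   tolerance for the moments. *)
pose t := e / 2 / ((K + 1) * (2 * (m - 1) * (1 + b))).
have t0 : 0 < t.
  rewrite /t divr_gt0// mulr_gt0// ?mulr_gt0//; last by lra.
  by rewrite ltr_wpDl.
have [J [p [phi [phi1 approx]]]] := fr t t0.
pose s := t / (1 + \sum_j `|p j|).
have sum0 : 0 <= \sum_j `|p j| by exact: sumr_ge0.
have s0 : 0 < s by rewrite divr_gt0// ltr_pwDl.
have UD : U density_fun by apply: filterS (Uc 1 ltr01) => f [].
have Lphi f j : L1 mu f -> L1 mu (fun x => f x * phi j x).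
  by move=> Lf; exact: L1M (phi1 j).
have moment_le f j : L1 mu f -> `|I (fun x => f x * phi j x)| <= N f.
  move=> Lf; apply: le_trans (I_norm (Lphi f j Lf)) _.
  apply: I_le => [||x]; [exact/L1_norm/Lphi|exact: L1_norm|].
  by rewrite normrM ler_piMr//; have [_] := phi1 j; apply.
(* [xget] selects the limit of each moment along the ultrafilter. *)
have Umom : U [set f | forall j, `|I (fun x => f x * phi j x) -
    xget 0 [set l | forall e, 0 < e ->
      U [set f | `|I (fun x => f x * phi j x) - l| <= e]]| <= s / 2].
  apply: filter_forall => j; case: xgetP => [l _ /= Hl|H].
    by apply: Hl; rewrite divr_gt0.
  have [|l /H//] := @ultra_bounded_cvg _ R U (fun f => I (fun x => f x * phi j x)) 1 UU.
  by apply: filterS UD => f Df /=; rewrite -(N_density Df); apply: moment_le; case: Df.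
exists ([set f | density_fun f /\ excess b f <= c + t] `&` [set f | forall j,
  `|I (fun x => f x * phi j x) - xget 0 [set l | forall e, 0 < e ->
      U [set f | `|I (fun x => f x * phi j x) - l| <= e]]| <= s / 2]).
  exact: filterI (Uc t t0) Umom.
move=> f g [[Df ft] fm] [[Dg gt] gm].
have [[_ Lf _ _] [_ Lg _ _]] := (Df, Dg).
have Lh := L1B Lf Lg; pose h x := f x - g x.
have mom_h j : `|I (fun x => h x * phi j x)| <= s.
  have -> : I (fun x => h x * phi j x) =
      I (fun x => f x * phi j x) - I (fun x => g x * phi j x).
    rewrite -IB; [|exact: Lphi|exact: Lphi].
    by apply: I_eq => x; rewrite /h mulrBl.
  apply: le_trans (ler_distD (xget 0 [set l | forall e, 0 < e ->
      U [set f | `|I (fun x => f x * phi j x) - l| <= e]]) _ _) _.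
  by rewrite [s]splitr lerD// distrC.
have Nh : N h <= 2.
  by apply: le_trans (N_sub_le Lf Lg) _; rewrite !N_density.
have Eh : - (6 * t) <= E h.
  have := bil_close wM (finite_rank_bounded p phi1) approx Lh Lh.
  rewrite bil_finite_rank// => close.
  have {}close := le_trans close (ler_wpM2l (ltW t0)
    (ler_pM (N_ge0 h) (N_ge0 h) Nh Nh)).
  have : `|\sum_j p j * (I (fun x => h x * phi j x) * I (fun x => h x * phi j x))|
      <= 2 * t.
    apply: le_trans (ler_norm_sum _ _ _) _.
    apply: (@le_trans _ _ (\sum_j `|p j| * (2 * s))).
      apply: ler_sum => j _; rewrite !normrM ler_wpM2l// ler_pM//.
      exact: le_trans (moment_le h j Lh) Nh.
    rewrite -mulr_suml mulrCA ler_pM2l// /s mulrA ler_pdivrMr; last by rewrite ltr_pwDl.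
    by rewrite mulrC ler_pM2l// lerDr.
  move: close; rewrite ler_distl => /andP[+ _]; rewrite ler_norml => + /andP[+ _].
  by rewrite /h; lra.
have := cmin _ (density_midpoint Df Dg); rewrite excess_midpoint//.
set g0 := I (fun x => gap m (f x) (g x)) => cm.
have m10' : 0 < 2 * (m - 1) by rewrite mulr_gt0.
have gapb : g0 <= 2 * (m - 1) * (1 + b) * t.
  rewrite -mulrA -ler_pdivrMl//.
  have -> : (2 * (m - 1))^-1 * g0 = g0 / 2 / (m - 1) by field; rewrite gt_eqF.
  have : b * - (6 * t) <= b * E h by rewrite ler_wpM2l.
  have : 0 <= b * t by rewrite mulr_ge0// ltW.
  by move: cm ft gt; rewrite -/h; lra.
apply: le_trans (HK f g Df Dg) _; rewrite -/g0 [leRHS]splitr lerD2l.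
apply: le_trans (ler_wpM2l K0 gapb) _.
have -> : K * (2 * (m - 1) * (1 + b) * t) = e / 2 * (K / (K + 1)).
  by rewrite /t; field; rewrite !gt_eqF//; lra.
rewrite ler_piMr ?(ltW e20)// ler_pdivrMr; lra.
Qed.

Lemma N_cvg0_lt (u : nat -> R) (e : R) : u @ \oo --> 0 -> 0 < e ->
  exists n0, forall n, (n0 <= n)%N -> u n <= e.
Proof.
move=> /cvgrPdist_le /(_ e) + e0 => /(_ e0)[n0 _ H]; exists n0 => n nn0.
by have := H n nn0; rewrite /= sub0r normrN; apply: le_trans; exact: ler_norm.
Qed.

(** Fatou's lemma for the entropy, continuity for the interaction. *)
Lemma excess_lsc (b c : R) (u : nat -> T -> R) f : 0 <= b ->
  L1 mu f -> (forall n, density_fun (u n)) ->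
  {ae mu, forall x, u ^~ x @ \oo --> f x} ->
  N (fun x => f x - u n x) @[n --> \oo] --> 0 ->
  (forall e, 0 < e -> exists n0, forall n, (n0 <= n)%N -> excess b (u n) <= c + e) ->
  exists2 g, density_fun g /\ excess b g <= c &
    N (fun x => g x - u n x) @[n --> \oo] --> 0.
Proof.
move=> b0 Lf Du uf Nf uc.
have mf := L1_meas Lf.
(* [f] is nonnegative almost everywhere only. *)
pose g x := Num.max (f x) 0.
have g0 x : 0 <= g x by rewrite le_max lexx orbT.
have mg : measurable_fun setT g by exact: measurable_maxr.
have fg : {ae mu, forall x, f x = g x}.
  apply: filterS uf => x ux; rewrite /g max_l//.
  by apply: (cvgr_to_ge ux); apply: nearW => n; have [] := Du n.
have Lg : L1 mu g by exact: L1_ae Lf fg.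
have Lu n : L1 mu (u n) by have [] := Du n.
have Ng : N (fun x => g x - u n x) @[n --> \oo] --> 0.
  have -> : (fun n => N (fun x => g x - u n x)) = (fun n => N (fun x => f x - u n x)).
    apply/funext => n; apply: I_ae; [| |by apply: filterS fg => x ->].
    - exact: (L1_meas (L1_norm (L1B Lg (Lu n)))).
    - exact: (L1_meas (L1_norm (L1B Lf (Lu n)))).
  exact: Nf.
have ug : {ae mu, forall x, u ^~ x @ \oo --> g x}.
  by apply: filterS2 uf fg => x + <-.
have If1 : I g = 1.
  apply/eqP; rewrite -subr_eq0 -normr_eq0; apply/negP => /negP ne.
  have p0 : 0 < `|I g - 1| / 2 by rewrite divr_gt0// normr_gt0 -normr_eq0.
  have [n0 /(_ n0 (leqnn _))] := N_cvg0_lt Ng p0.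
  have [_ _ u1 _] := Du n0; have := I_norm (L1B Lg (Lu n0)).
  by rewrite IB// u1; move: p0; lra.
have Eb n : `|E g - E (u n)| <= M * (2 * N (fun x => g x - u n x)).
  apply: le_trans (bil_continuous Lg (Lu n)) _.
  rewrite ler_wpM2l// (N_density (Du n)) ler_wpM2r ?N_ge0//.
  have -> : N g = I g by apply: I_eq => x; exact: ger0_norm.
  by rewrite If1; lra.
have bound e : 0 < e -> L1 mu (fun x => g x `^ m) /\
    I (fun x => g x `^ m) <= (c + e - b / 2 * E g) * (m - 1) + rho `^ (m - 1).
  move=> e0; have e20 : 0 < e / 2 by rewrite divr_gt0.
  have e'0 : 0 < e / 2 / (1 + b * M) by rewrite divr_gt0// ltr_pwDl// mulr_ge0.
  have [n1 Hn1] := uc _ e20; have [n2 Hn2] := N_cvg0_lt Ng e'0.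
  apply: (@fatou_bound _ _ _ mu (fun n x => u (n + (n1 + n2))%N x `^ m)).
  - exact: measurable_powm.
  - by move=> n; case: (Du (n + (n1 + n2))%N).
  - by move=> n x; exact: powR_ge0.
  - move=> n; set k := (_ + _)%N.
    have le1 := Hn1 k (leq_trans (leq_addr n2 n1) (leq_addl n _)).
    have close := Hn2 k (leq_trans (leq_addl n1 n2) (leq_addl n _)).
    have := Eb k; move/(ler_wpM2l b0).
    have : b * (M * (2 * N (fun x => g x - u k x))) <= e.
      have -> : b * (M * (2 * N (fun x => g x - u k x))) =
        (b * M) * 2 * N (fun x => g x - u k x) by ring.
      apply: (@le_trans _ _ (b * M * 2 * (e / 2 / (1 + b * M)))).
        by rewrite ler_wpM2l// mulr_ge0// mulr_ge0.
      have -> : b * M * 2 * (e / 2 / (1 + b * M)) = e * (b * M / (1 + b * M)).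
        by field; rewrite gt_eqF// ltr_pwDl// mulr_ge0.
      rewrite ler_piMr ?(ltW e0)// ler_pdivrMr ?mul1r ?lerDr//.
      by rewrite ltr_pwDl// mulr_ge0.
    move=> h1 /le_trans - /(_ _ h1) h2.
    move: le1; rewrite {1}/excess -lerBrDr ler_pdivrMr// lerBlDr => /le_trans; apply.
    rewrite lerD2r ler_pM2r//.
    have : b * (E g - E (u k)) <= e.
      by apply: le_trans h2; rewrite ler_wpM2l// ler_norm.
    by lra.
  - by move=> x; exact: powR_ge0.
  - apply: filterS ug => x /= ux; apply: (powR_cvg m1) => //.
      by move=> n; have [] := Du (n + (n1 + n2))%N.
    by rewrite -(cvg_shiftn (n1 + n2)) in ux.
exists g => //; split.
  by split => //; have [] := bound _ ltr01.
apply/ler_addgt0Pr => e e0.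
have [_] := bound e e0.
by rewrite -lerBlDr -ler_pdivrMr// lerBrDr.
Qed.

Lemma sum_half_powers n : \sum_(i < n) (2^-1 : R) ^+ i <= 2.
Proof.
suff -> : \sum_(i < n) (2^-1 : R) ^+ i = 2 - 2 * 2^-1 ^+ n.
  by rewrite lerBlDr lerDl mulr_ge0// exprn_ge0.
elim: n => [|n IH]; first by rewrite big_ord0 expr0; ring.
by rewrite big_ord_recr/= IH exprS; field.
Qed.

(** The direct method, restricted to a set [S] so that it also yields cluster
    points of families of almost minimisers. Since an ultrafilter is no sequence,
    a sequence with increments [2 ^ - n] is chosen from the sets of small
    diameter that it contains. *)
Lemma almost_minimisers_compact (b c : R) (S : set (T -> R)) :
  finite_rank_approx -> 0 <= b ->
  (forall f, density_fun f -> c <= excess b f) ->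
  (forall f, S f -> density_fun f) ->
  (forall e, 0 < e -> exists2 f, S f & excess b f <= c + e) ->
  exists2 f, density_fun f /\ excess b f <= c &
    forall e, 0 < e -> exists2 g, S g & N (fun x => f x - g x) <= e.
Proof.
move=> fr b0 cmin SD Sc.
pose F := [set A : set (T -> R) | exists2 e, 0 < e &
  [set f | S f /\ excess b f <= c + e] `<=` A].
have PF : ProperFilter F.
  apply: Build_ProperFilter_ex => [A [e e0 sub]|].
    by have [f Sf fe] := Sc e e0; exists f; exact: sub.
  split; first by exists 1.
  - move=> A B [e e0 sA] [e' e'0 sB]; exists (Num.min e e').
      by rewrite lt_min e0.
    move=> f [Sf fe]; split; [apply: sA|apply: sB]; split=> //;
      apply: le_trans fe _; rewrite lerD2l ge_min lexx ?orbT//.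
  - by move=> A B AB [e e0 sA]; exists e => //; exact: subset_trans AB.
have [U [UU FU]] := ultraFilterLemma PF.
have US e : 0 < e -> U [set f | S f /\ excess b f <= c + e].
  by move=> e0; apply: FU; exists e.
have UD e : 0 < e -> U [set f | density_fun f /\ excess b f <= c + e].
  by move=> e0; apply: filterS (US e e0) => f [/SD].
have h0 n : 0 < (2^-1 : R) ^+ n by rewrite exprn_gt0.
have /choice[A HA] : forall n, exists A, U A /\ forall f g, A f -> A g ->
    N (fun x => f x - g x) <= 2^-1 ^+ n.
  move=> n; have [A UA HA] := cauchy_of_moments fr b0 UU cmin UD (h0 n).
  by exists A.
have /choice[u Hu] : forall n, exists f, (S f /\ excess b f <= c + 2^-1 ^+ n) /\
    forall i : 'I_n.+1, A i f.
  move=> n; apply: (@filter_ex _ U); apply: filterI (US _ (h0 n)) _.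
  by apply: filter_forall => i; have [] := HA i.
have Du n : density_fun (u n) by have [[/SD]] := Hu n.
have Lu n : L1 mu (u n) by have [] := Du n.
have close n : N (fun x => u n.+1 x - u n x) <= 2^-1 ^+ n.
  have [_] := HA n; apply.
  - by have [_ /(_ (inord n))] := Hu n.+1; rewrite inordK.
  - by have [_ /(_ ord_max)] := Hu n.
have sumle n : \sum_(i < n) N (fun x => u i.+1 x - u i x) <= 2.
  by apply: le_trans (sum_half_powers n); apply: ler_sum.
have [f [Lf uf Nf]] := L1_complete Lu sumle.
have h_cvg (e : R) : 0 < e -> exists n0, forall n, (n0 <= n)%N -> 2^-1 ^+ n <= e.
  by apply: N_cvg0_lt; apply: cvg_expr; rewrite ger0_norm// invf_lt1// ltr1n.
have uc e : 0 < e -> exists n0, forall n, (n0 <= n)%N -> excess b (u n) <= c + e.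
  move=> /h_cvg[n0 H]; exists n0 => n nn0.
  by have [[_]] := Hu n => /le_trans + _; apply; rewrite lerD2l H.
have [g [Dg gc] Ng] := excess_lsc b0 Lf Du uf Nf uc.
exists g => // e e0; have [n0 /(_ n0 (leqnn _)) H] := N_cvg0_lt Ng e0.
by exists (u n0) => //; have [[]] := Hu n0.
Qed.

Lemma excess_ge b f : 0 <= b -> density_fun f ->
  - (rho `^ (m - 1) / (m - 1)) - b * M <= excess b f.
Proof.
move=> b0 Df; rewrite /excess mulrBl.
have : 0 <= I (fun x => f x `^ m) / (m - 1).
  by rewrite divr_ge0 ?(ltW m10)//; apply: I_ge0 => x; exact: powR_ge0.
have := ler_wpM2l b0 (bil_density_le Df).
have := ler_wpM2l b0 (ler_norm (- E f)); rewrite normrN.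
have : 0 <= b * M by rewrite mulr_ge0.
by lra.
Qed.

Lemma excess_minimiser_exists b : finite_rank_approx -> 0 <= b ->
  exists f, excess_minimiser b f.
Proof.
move=> fr b0; pose S := [set excess b f | f in density_fun].
have Sinf : has_inf S.
  split; first by exists (excess b (fun=> rho)), (fun=> rho) => //; exact: density_rho.
  exists (- (rho `^ (m - 1) / (m - 1)) - b * M) => _ [f Df <-].
  exact: excess_ge.
have [|||f [Df fc] _] := @almost_minimisers_compact b (inf S) density_fun fr b0.
- by move=> f Df; apply: ge_inf; [case: Sinf|exists f].
- by [].
- move=> e e0; have [_ [f Df <-] lt] := inf_adherent e0 Sinf.
  by exists f => //; exact: ltW.
exists f; split=> // g Dg; apply: le_trans fc _.
by apply: ge_inf; [case: Sinf|exists g].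
Qed.

Lemma density_ae f g : density_fun f -> measurable_fun setT g ->
  (forall x, 0 <= g x) -> {ae mu, forall x, f x = g x} ->
  density_fun g /\ forall b, excess b g = excess b f.
Proof.
move=> Df mg g0 fg; have [f0 Lf f1 fm] := Df.
have Lg := L1_ae mg Lf fg.
have fgm : {ae mu, forall x, f x `^ m = g x `^ m} by apply: filterS fg => x ->.
have mgm := measurable_powm mg.
have E1 := I_ae (L1_meas Lf) mg fg.
have Em := I_ae (L1_meas fm) mgm fgm.
split; first by split; rewrite -?E1//; exact: L1_ae fgm.
move=> b; rewrite /excess Em; congr (_ + b / 2 * _).
apply/eqP; rewrite -subr_eq0 -normr_le0.
apply: le_trans (bil_continuous Lg Lf) _.
have -> : N (fun x => g x - f x) = 0.
  rewrite -(mul0r V) -I_cst; apply: I_ae => //.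
    exact: (L1_meas (L1_norm (L1B Lg Lf))).
  by apply: filterS fg => x ->; rewrite subrr normr0.
by rewrite !mulr0.
Qed.

Lemma mean_zero_nonpos_set g : L1 mu g -> I g = 0 -> mu [set x | g x <= 0] != 0%E.
Proof.
move=> Lg Ig; apply/negP => /eqP H.
have mS : measurable [set x | g x <= 0].
  rewrite -[X in measurable X]setTI; apply: measurable_fun_le => //; exact: L1_meas Lg.
have gpos : {ae mu, forall x, 0 < g x}.
  exists [set x | g x <= 0]; split => // x /=.
  by move/negP; rewrite -leNgt.
have INg : N g = 0.
  rewrite -Ig; apply: I_ae; [exact: L1_meas (L1_norm Lg)|exact: L1_meas Lg|].
  by apply: filterS gpos => x g0; rewrite ger0_norm// ltW.
have g0 := I_eq0_ae (L1_norm Lg) (fun x => normr_ge0 _) INg.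
have : {ae mu, forall x : T, False}.
  by apply: filterS2 gpos g0 => x + /normr0_eq0 gx; rewrite gx ltxx.
case=> A [mA A0 sA]; move: muT.
have -> : mu setT = 0%E.
  by apply/eqP; rewrite eq_le measure_ge0 andbT -A0 le_measure// ?inE// => x _; exact: sA.
by rewrite ltxx.
Qed.

Section phase_diagram.
Hypothesis w1 : annihilates_constants.

(** First variation without derivatives: moving a small mass [t] from the set
    where the minimiser is at least [a] to the set where it is at most [c] lowers
    the entropy by at least [t] times the left-hand side and raises the
    interaction by at most [t] times the right-hand side plus a multiple of
    [t ^ 2]. Minimality compares the two, and [t] tends to 0. *)
Lemma swap_bound b f a a' c c' : 0 <= b -> excess_minimiser b f ->
  0 <= a' -> a' < a -> c < c' -> c' <= a' ->
  mu [set x | a <= f x] != 0%E -> mu [set x | f x <= c] != 0%E ->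
  m / (m - 1) * (a' `^ (m - 1) - c' `^ (m - 1)) <=
    2 * b * M * N (fun x => f x - rho).
Proof.
move=> b0 [Df fmin] a'0 a'a cc' c'a'; have [f0 Lf f1 fm] := Df.
set A := [set x | a <= f x]; set B := [set x | f x <= c] => A0 B0.
have mf := L1_meas Lf.
have mA : measurable A.
  by rewrite -[X in measurable X]setTI; apply: measurable_fun_le.
have mB : measurable B.
  by rewrite -[X in measurable X]setTI; apply: measurable_fun_le.
pose al := fine (mu A); pose be := fine (mu B).
have fin X : measurable X -> mu X != 0%E -> 0 < fine (mu X).
  move=> mX X0; rewrite fine_gt0// lt0e X0 measure_ge0/=.
  by rewrite -ge0_fin_numE// fin_num_measure.
have al0 : 0 < al := fin _ mA A0.
have be0 : 0 < be := fin _ mB B0.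
have ind (X : set T) : measurable X -> bounded_by (\1_X : T -> R) 1.
  by move=> mX; split => // x; rewrite indicE; case: (x \in X); rewrite ?normr0 ?normr1.
have LA : L1 mu (\1_A : T -> R) by exact: L1_bounded (ind _ mA).
have LB : L1 mu (\1_B : T -> R) by exact: L1_bounded (ind _ mB).
have Iind (X : set T) : measurable X -> I (\1_X : T -> R) = fine (mu X).
  by move=> mX; rewrite /Rintegral integral_indic// setIT.
pose h x := f x - rho.
have Lr : L1 mu (fun=> rho) by exact: L1_cst.
have Lh : L1 mu h by exact: L1B.
apply/ler_addgt0Pr => e e0.
pose t := Num.min (Num.min ((a - a') * al) ((c' - c) * be)) (e / (2 * b * M + 1)).
have bM : 0 <= 2 * b * M by rewrite mulr_ge0// mulr_ge0.
have t0 : 0 < t.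
  have k0 : 0 < 2 * b * M + 1 by lra.
  by rewrite !lt_min (divr_gt0 e0 k0) andbT; apply/andP; split; rewrite mulr_gt0 ?subr_gt0.
have ta : t / al <= a - a' by rewrite ler_pdivrMr// !ge_min lexx.
have tb : t / be <= c' - c by rewrite ler_pdivrMr// !ge_min lexx orbT.
have te : t * (2 * b * M) <= e.
  apply: (@le_trans _ _ (t * (2 * b * M + 1))); first by rewrite ler_pM2l// lerDl.
  by rewrite -ler_pdivlMr ?ge_min ?lexx ?orbT//; lra.
pose k x := (t / be) * \1_B x - (t / al) * \1_A x.
have Lk : L1 mu k by apply: L1B; exact: L1Z.
have Ik : I k = 0.
  rewrite IB ?IZ ?Iind//; [|exact: L1Z|exact: L1Z].
  by rewrite -/al -/be !divfK ?gt_eqF// subrr.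
have Nk : N k <= 2 * t.
  apply: le_trans (N_sub_le (L1Z _ LB) (L1Z _ LA)) _.
  rewrite (@I_eq _ _ _ _ _ (fun x => t / be * \1_B x)); last first.
    by move=> x; rewrite ger0_norm// mulr_ge0// ltW// divr_gt0.
  rewrite [X in _ + X](@I_eq _ _ _ _ _ (fun x => t / al * \1_A x)); last first.
    by move=> x; rewrite ger0_norm// mulr_ge0// ltW// divr_gt0.
  rewrite !IZ// !Iind// -/al -/be !divfK ?gt_eqF//; lra.
pose g x := f x + k x.
have Lg : L1 mu g by exact: L1D.
have s0 : 0 < t / al by rewrite divr_gt0.
have u0 : 0 < t / be by rewrite divr_gt0.
have pw x : 0 <= g x /\ g x `^ m <= f x `^ m +
    (m * (t / be) * c' `^ (m - 1)) * \1_B x - (m * (t / al) * a' `^ (m - 1)) * \1_A x.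
  rewrite /g /k !indicE; have fx0 := f0 x.
  have [/set_mem xA|/negP xA] := boolP (x \in A);
  have [/set_mem xB|/negP xB] := boolP (x \in B); rewrite ?mulr1 ?mulr0.
  - by move: xA xB; rewrite /A /B /=; lra.
  - have gx : a' <= f x - t / al by move: xA; rewrite /A/=; lra.
    have gx0 : 0 <= f x - t / al by exact: le_trans gx.
    rewrite add0r addr0; split=> //.
    have := tangent_powR m1 gx0 fx0.
    have : a' `^ (m - 1) <= (f x - t / al) `^ (m - 1).
      by apply: ge0_ler_powR; rewrite ?nnegrE// ltW.
    rewrite -(ler_pM2l (mulr_gt0 m0 s0)); lra.
  - have gx0 : 0 <= f x + t / be by rewrite addr_ge0// ltW.
    rewrite !subr0; split=> //.
    have := tangent_powR m1 gx0 fx0.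
    have : (f x + t / be) `^ (m - 1) <= c' `^ (m - 1).
      have ? : f x + t / be <= c' by move: xB; rewrite /B/=; lra.
      by apply: ge0_ler_powR; rewrite ?nnegrE ?(ltW m10)// (le_trans gx0).
    rewrite -(ler_pM2l (mulr_gt0 m0 u0)); lra.
  - by rewrite subrr !addr0 subr0.
pose q x := f x `^ m + (m * (t / be) * c' `^ (m - 1)) * \1_B x -
   (m * (t / al) * a' `^ (m - 1)) * \1_A x.
have Lq : L1 mu q by apply: L1B; [apply: L1D => //|]; exact: L1Z.
have Dg : density_fun g.
  split => //; first by move=> x; have [] := pw x.
  - by rewrite ID// f1 Ik addr0.
  - apply: L1_le Lq; first by apply: measurable_powm; exact: L1_meas Lg.
    by move=> x; rewrite ger0_norm ?powR_ge0//; have [] := pw x.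
have Igm : I (fun x => g x `^ m) <= I (fun x => f x `^ m) +
     m * t * (c' `^ (m - 1) - a' `^ (m - 1)).
  have Lgm : L1 mu (fun x => g x `^ m) by case: Dg.
  apply: le_trans (I_le Lgm Lq (fun x => (pw x).2)) _.
  rewrite IB ?ID ?IZ ?Iind//; try exact: L1Z; last by apply: L1D => //; exact: L1Z.
  rewrite -/al -/be le_eqVlt; apply/orP; left; apply/eqP.
  by field; rewrite !gt_eqF.
have EgE : E g <= E f + 4 * t * (M * N h) + 4 * t * (M * t).
  rewrite (bil_shift w1 Lg) (bil_shift w1 Lf) -/h.
  have -> : (fun x => g x - rho) = (fun x => h x + k x).
    by apply/funext => x; rewrite /g /h; ring.
  rewrite (bilDl wM Lh Lk (L1D Lh Lk)) (bilDr wM Lh Lk Lh) (bilDr wM Lh Lk Lk).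
  have := bil_le wM Lh Lk; have := bil_le wM Lk Lh; have := bil_le wM Lk Lk.
  move=> /(le_trans (ler_norm _)) h1 /(le_trans (ler_norm _)) h2.
  move=> /(le_trans (ler_norm _)) h3.
  have Mh : 0 <= M * N h by rewrite mulr_ge0// N_ge0.
  have := ler_wpM2l Mh Nk.
  have := ler_wpM2l M0 (ler_pM (N_ge0 k) (N_ge0 k) Nk Nk).
  lra.
have i0 : 0 <= (m - 1)^-1 by rewrite invr_ge0 ltW.
have := fmin g Dg; rewrite /excess.
have := ler_wpM2l b0 EgE; have := ler_wpM2r i0 Igm.
move=> h1 h2 h3; rewrite -(ler_pM2l t0) -/h.
apply: (@le_trans _ _ (t * (2 * b * M * N h + t * (2 * b * M)))).
  move: h1 h2 h3; set i := (m - 1)^-1; lra.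
by rewrite ler_pM2l// lerD2l.
Qed.

Lemma ae_of_null_set (A : set T) (P : T -> Prop) : measurable A -> mu A = 0%E ->
  (forall x, ~ A x -> P x) -> {ae mu, forall x, P x}.
Proof.
move=> mA A0 AP; exists A; split => // x /= nP.
by apply: contrapT => /AP.
Qed.

(** If some mass of the minimiser were above or below [rho] by more than [eta],
    moving part of it to the other side of [rho] would lower the entropy by a
    fixed amount per unit of mass, which an L1-small deviation from [rho] does
    not allow. *)
Lemma minimiser_uniform (bmax eta : R) : 0 <= bmax -> 0 < eta ->
  exists2 dl, 0 < dl & forall b f, 0 <= b <= bmax -> excess_minimiser b f ->
    N (fun x => f x - rho) <= dl -> {ae mu, forall x, `|f x - rho| <= eta}.
Proof.
move=> bmax0; wlog er : eta / eta <= rho.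
  move=> H eta0; have [|re] := leP eta rho; first by move=> /H; apply.
  have [dl dl0 Hdl] := H rho (lexx _) rho0; exists dl => // b f b0 fm fdl.
  by apply: filterS (Hdl b f b0 fm fdl) => x /le_trans; apply; exact: ltW.
move=> eta0.
pose cost u v := m / (m - 1) * (u `^ (m - 1) - v `^ (m - 1)).
have cost0 (u v : R) : 0 <= v -> v < u -> 0 < cost u v.
  move=> v0 vu; rewrite /cost mulr_gt0 ?divr_gt0// subr_gt0.
  by apply: gt0_ltr_powR; rewrite ?nnegrE//; exact: ltW (le_lt_trans v0 vu).
pose k1 := cost (rho + 2 * eta / 3) (rho + eta / 3).
pose k2 := cost (rho - eta / 3) (rho - 2 * eta / 3).
have k10 : 0 < k1 by move: rho0 => r0; apply: cost0; lra.
have k20 : 0 < k2 by apply: cost0; lra.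
pose dl := Num.min k1 k2 / (2 * bmax * M + 1).
have bM : 0 <= 2 * bmax * M by rewrite mulr_ge0// mulr_ge0.
have bM1 : 0 < 2 * bmax * M + 1 by lra.
have dl0 : 0 < dl by rewrite divr_gt0// lt_min k10.
exists dl => // b f /andP[b0 bb] fmin fdl.
have small : 2 * b * M * N (fun x => f x - rho) < Num.min k1 k2.
  apply: (@le_lt_trans _ _ (2 * bmax * M * dl)).
    apply: ler_pM => //; first by rewrite mulr_ge0// mulr_ge0.
      exact: N_ge0.
    by rewrite ler_wpM2r// ler_wpM2l.
  have : (2 * bmax * M + 1) * dl = Num.min k1 k2.
    by rewrite /dl mulrC divfK// gt_eqF.
  lra.
have [[f0 Lf f1 fm] _] := fmin.
have Lr : L1 mu (fun=> rho) by exact: L1_cst.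
have Irho : I (fun=> rho) = 1 by rewrite I_cst mulVf// gt_eqF.
have below : mu [set x | f x <= rho] != 0%E.
  have := mean_zero_nonpos_set (L1B Lf Lr).
  rewrite IB// f1 Irho subrr => /(_ erefl).
  by under eq_set do rewrite subr_le0.
have above : mu [set x | rho <= f x] != 0%E.
  have := mean_zero_nonpos_set (L1B Lr Lf).
  rewrite IB// f1 Irho subrr => /(_ erefl).
  by under eq_set do rewrite subr_le0.
have mf := L1_meas Lf.
have up : mu [set x | rho + eta <= f x] = 0%E.
  apply/eqP/negP => /negP H.
  have := @swap_bound b f (rho + eta) (rho + 2 * eta / 3) rho (rho + eta / 3)
    b0 fmin _ _ _ _ H below.
  move: rho0 => r0; rewrite -/(cost _ _) -/k1 => Hk.
  have : k1 < k1; last by rewrite ltxx.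
  apply: le_lt_trans (Hk _ _ _ _) (lt_le_trans small _); try lra.
  by rewrite ge_min lexx.
have dn : mu [set x | f x <= rho - eta] = 0%E.
  apply/eqP/negP => /negP H.
  have := @swap_bound b f rho (rho - eta / 3) (rho - eta) (rho - 2 * eta / 3)
    b0 fmin _ _ _ _ above H.
  rewrite -/(cost _ _) -/k2 => Hk.
  have : k2 < k2; last by rewrite ltxx.
  apply: le_lt_trans (Hk _ _ _ _) (lt_le_trans small _); try lra.
  by rewrite ge_min lexx orbT.
have mup : measurable [set x | rho + eta <= f x].
  by rewrite -[X in measurable X]setTI; apply: measurable_fun_le.
have mdn : measurable [set x | f x <= rho - eta].
  by rewrite -[X in measurable X]setTI; apply: measurable_fun_le.
have h1 : {ae mu, forall x, f x < rho + eta}.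
  by apply: ae_of_null_set up _ => // x /= /negP; rewrite -ltNge.
have h2 : {ae mu, forall x, rho - eta < f x}.
  by apply: ae_of_null_set dn _ => // x /= /negP; rewrite -ltNge.
by apply: filterS2 h1 h2 => x; rewrite ler_distl; lra.
Qed.

(** The first-order terms vanish because [h] has mean zero and the kernel
    annihilates constants. The quadratic form that remains decides the local
    stability of the constant density. *)
Lemma excess_expansion (e : R) : 0 < e -> exists2 dl, 0 < dl &
  forall h, bounded_by h dl -> I h = 0 -> density_fun (fun x => rho + h x) /\
    forall b, `|excess b (fun x => rho + h x) -
      (m / 2 * rho `^ (m - 2) * I (fun x => h x ^+ 2) + b / 2 * E h)| <=
      e * I (fun x => h x ^+ 2).
Proof.
move=> e0; have r2 : 0 < rho `^ (m - 2) by rewrite powR_gt0.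
have e'0 : 0 < e * (m - 1) / rho `^ (m - 2) by rewrite divr_gt0// mulr_gt0.
have [r r0 taylor] := powR_taylor2 m1 e'0.
exists (Num.min rho (rho * r)); first by rewrite lt_min rho0 mulr_gt0.
move=> h hb Ih; have [mh hle] := hb.
have hle1 x : `|h x| <= rho by rewrite (le_trans (hle x))// ge_min lexx.
have hle2 x : `|h x| <= rho * r by rewrite (le_trans (hle x))// ge_min lexx orbT.
have Lh := L1_bounded mu hb.
have Lr : L1 mu (fun=> rho) by exact: L1_cst.
pose f x := rho + h x.
have f0 x : 0 <= f x by rewrite -lerBlDl sub0r; have := hle1 x; rewrite ler_norml => /andP[].
have fle x : f x <= 2 * rho.
  by rewrite /f; have := hle1 x; rewrite ler_norml => /andP[_]; lra.
have Lf : L1 mu f by exact: L1D.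
have Lfm : L1 mu (fun x => f x `^ m).
  apply: (@L1_bounded _ _ _ _ _ ((2 * rho) `^ m)); split.
    exact/measurable_powm/(L1_meas Lf).
  move=> x; rewrite ger0_norm ?powR_ge0//; apply: ge0_ler_powR; rewrite ?nnegrE ?(ltW m0)//.
  by rewrite mulr_ge0// ltW.
have Irho : I (fun=> rho) = 1 by rewrite I_cst mulVf// gt_eqF.
have If : I f = 1 by rewrite ID// Ih addr0.
have Lh2 : L1 mu (fun x => h x ^+ 2).
  by apply: L1_eq (L1M Lh hb) => x; rewrite expr2.
split; first by split.
move=> b.
have pw x : `|f x `^ m - rho `^ m - m * rho `^ (m - 1) * h x -
    m * (m - 1) / 2 * rho `^ (m - 2) * h x ^+ 2| <= e * (m - 1) * h x ^+ 2.
  have rn : rho != 0 by rewrite gt_eqF.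
  have fE : f x = rho * (f x / rho) by rewrite mulrC divfK.
  have t1 : f x / rho - 1 = h x / rho by rewrite /f mulrDl divff// addrAC subrr add0r.
  have : `|f x / rho - 1| <= r.
    by rewrite t1 normrM normfV (gtr0_norm rho0) ler_pdivrMr// mulrC.
  move/taylor; rewrite t1 -(ler_pM2l (powR_gt0 m rho0)).
  rewrite -[X in X * `|_|](gtr0_norm (powR_gt0 m rho0)) -normrM.
  have E1 : rho `^ (m - 1) = rho * rho `^ (m - 2).
    have -> : m - 2 = m - 1 - 1 by ring.
    by rewrite mulr_powRB1// ltW.
  have Em : rho `^ m = rho * (rho * rho `^ (m - 2)).
    by rewrite -E1 mulr_powRB1// ltW.
  have fmE : f x `^ m = rho `^ m * (f x / rho) `^ m.
    by rewrite -powRM ?(ltW rho0)// ?divr_ge0 ?(ltW rho0)// -fE.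
  rewrite fmE E1 => H.
  have -> : rho `^ m * (f x / rho) `^ m - rho `^ m -
    m * (rho * rho `^ (m - 2)) * h x - m * (m - 1) / 2 * rho `^ (m - 2) * h x ^+ 2
   = rho `^ m * ((f x / rho) `^ m - 1 - m * (h x / rho) -
        m * (m - 1) / 2 * (h x / rho) ^+ 2).
    by rewrite Em; field; rewrite gt_eqF.
  apply: le_trans H _; rewrite le_eqVlt; apply/orP; left; apply/eqP.
  by rewrite Em; field; rewrite !gt_eqF.
have Lq : L1 mu (fun x => f x `^ m - rho `^ m - m * rho `^ (m - 1) * h x -
    m * (m - 1) / 2 * rho `^ (m - 2) * h x ^+ 2).
  by apply: L1B; [apply: L1B; [apply: L1B => //; exact: L1_cst|]|]; exact: L1Z.
have := le_trans (I_norm Lq) (I_le (L1_norm Lq) (L1Z _ Lh2) pw).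
rewrite IZ// IB; last 2 first.
- by apply: L1B; [apply: L1B => //; exact: L1_cst|]; exact: L1Z.
- exact: L1Z.
rewrite IB; last 2 first.
- by apply: L1B => //; exact: L1_cst.
- exact: L1Z.
rewrite IB//; last exact: L1_cst.
rewrite !IZ// Ih mulr0 subr0 I_cst.
have -> : rho `^ m * V = rho `^ (m - 1).
  by rewrite -(mulr_powRB1 (ltW rho0) m0) mulrAC mulVf ?gt_eqF// mul1r.
rewrite /excess (bil_shift w1 Lf).
have -> : (fun x => f x - rho) = h by apply/funext => x; rewrite /f addrAC subrr add0r.
have i0 : 0 < (m - 1)^-1 by rewrite invr_gt0.
rewrite -(ler_pM2l i0) -[X in X * `|_|](gtr0_norm i0) -normrM => H.
have -> : e * I (fun x => h x ^+ 2) = (m - 1)^-1 * (e * (m - 1) * I (fun x => h x ^+ 2)).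
  by field; rewrite gt_eqF.
apply: le_trans H; rewrite le_eqVlt; apply/orP; left; apply/eqP; congr (`| _ |).
by field; rewrite gt_eqF.
Qed.

Variable lam : R.
Hypothesis lam0 : lam < 0.
Local Notation bsharp := (m * rho `^ (m - 2) / - lam).

(** Together with the next definition: [lam] is the bottom of the spectrum of the
    interaction operator on functions of mean zero. *)
Definition spectral_lower_bound := forall h C, bounded_by h C -> I h = 0 ->
  lam * I (fun x => h x ^+ 2) <= E h.

Definition spectral_bound_approached := forall l, lam < l -> exists h C,
  [/\ bounded_by h C, I h = 0, 0 < I (fun x => h x ^+ 2) &
      E h <= l * I (fun x => h x ^+ 2)].

Lemma bsharp_gt0 : 0 < bsharp.
Proof. by rewrite divr_gt0 ?oppr_gt0// mulr_gt0// powR_gt0. Qed.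

(** Below [bsharp] the quadratic part of the excess is positive definite. The
    neighbourhood is uniform in the parameter up to [b]. *)
Lemma rho_strict_local_minimiser b : spectral_lower_bound -> 0 <= b < bsharp ->
  exists2 eta, 0 < eta & forall b' f, 0 <= b' <= b -> density_fun f ->
    {ae mu, forall x, `|f x - rho| <= eta} -> excess b' f <= 0 ->
    {ae mu, forall x, f x = rho}.
Proof.
move=> slb /andP[b0 bb].
pose s := m / 2 * rho `^ (m - 2) + b / 2 * lam.
have s0 : 0 < s.
  by move: bb; rewrite ltr_pdivlMr ?oppr_gt0// /s; lra.
have s20 : 0 < s / 2 by rewrite divr_gt0.
have [eta eta0 Heta] := excess_expansion s20; exists eta => //.
move=> b' f /andP[b'0 b'b] Df fae fle; have [f0 Lf f1 fm] := Df.
have mf := L1_meas Lf.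
(* Truncation makes the deviation bounded everywhere and not just almost
   everywhere. *)
pose h x := Num.max (- eta) (Num.min eta (f x - rho)).
have hb : bounded_by h eta.
  split.
    apply: measurable_maxr => //; apply: measurable_minr => //.
    exact: measurable_funB.
  move=> x; rewrite ler_norml /h le_max lexx/= ge_max ge_min lexx andbT.
  by rewrite ge0_cp// ltW.
have fh : {ae mu, forall x, f x = rho + h x}.
  apply: filterS fae => x; rewrite ler_norml /h => /andP[h1 h2].
  by rewrite min_r// max_r// addrC subrK.
have Lr : L1 mu (fun=> rho) by exact: L1_cst.
have Irho : I (fun=> rho) = 1 by rewrite I_cst mulVf// gt_eqF.
have Lh := L1_bounded mu hb.
have Ih : I h = 0.
  have := I_ae mf (L1_meas (L1D Lr Lh)) fh.
  by rewrite f1 ID// Irho => /eqP; rewrite -subr_eq0 opprD addrA subrr add0r oppr_eq0 => /eqP.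
have [Dg /(_ b')] := Heta h hb Ih.
have [g0 Lg _ _] := Dg.
have [_ ->] := density_ae Df (L1_meas Lg) g0 fh.
set q := I (fun x => h x ^+ 2) => Hq.
have q0 : 0 <= q by apply: I_ge0 => x; exact: sqr_ge0.
have qle : q <= 0.
  have Eh : b' * (lam * q) <= b' * E h by rewrite ler_wpM2l//; exact: slb hb Ih.
  have : b * (lam * q) <= b' * (lam * q).
    by rewrite ler_wnM2r// nmulr_rle0.
  move: Hq; rewrite ler_distl => /andP[+ _] => H1 H2.
  have : s / 2 * q <= 0 by rewrite /s in H1 *; lra.
  by rewrite pmulr_rle0.
have q00 : q = 0 by apply/eqP; rewrite eq_le qle.
have Lh2 : L1 mu (fun x => h x ^+ 2).
  by apply: L1_eq (L1M Lh hb) => x; rewrite expr2.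
have hz := I_eq0_ae Lh2 (fun x => sqr_ge0 _) q00.
apply: filterS2 hz fh => x /eqP; rewrite sqrf_eq0 => /eqP -> ->.
by rewrite addr0.
Qed.

(** Above [bsharp] a small perturbation along an almost extremal direction has
    negative second variation. *)
Lemma rho_unstable b : spectral_bound_approached -> bsharp < b ->
  exists2 f, density_fun f & excess b f < 0.
Proof.
move=> sba bb; have b0 : 0 < b by apply: lt_trans bb; exact: bsharp_gt0.
pose s := - (m / 2 * rho `^ (m - 2) + b / 2 * lam).
have s0 : 0 < s.
  by move: bb; rewrite ltr_pdivrMr ?oppr_gt0// /s; lra.
pose l := lam + s / b.
have ll : lam < l by rewrite ltrDl divr_gt0.
have bl : b * l = b * lam + s by rewrite /l mulrDr [b * (s / b)]mulrC divfK// gt_eqF.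
have [h [C [hC Ih q0 Eh]]] := sba l ll.
have [mh hle] := hC.
have s40 : 0 < s / 4 by rewrite divr_gt0.
have [dl dl0 Hdl] := excess_expansion s40.
have C0 : 0 <= C by exact: le_trans (normr_ge0 _) (hle point).
pose t := dl / (C + 1).
have C10 : 0 < C + 1 by lra.
have t0 : 0 < t by rewrite divr_gt0.
pose k x := t * h x.
have kb : bounded_by k dl.
  split; first exact: measurable_funM.
  move=> x; rewrite normrM (gtr0_norm t0) /t mulrAC ler_pdivrMr// ler_pM2l//.
  by have := hle x; lra.
have Lh := L1_bounded mu hC.
have Ik : I k = 0 by rewrite IZ// Ih mulr0.
have [Dg /(_ b)] := Hdl k kb Ik.
have Lh2 : L1 mu (fun x => h x ^+ 2).
  by apply: L1_eq (L1M Lh hC) => x; rewrite expr2.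
have -> : I (fun x => k x ^+ 2) = t ^+ 2 * I (fun x => h x ^+ 2).
  by rewrite -IZ//; apply: I_eq => x; rewrite exprMn.
have -> : E k = t ^+ 2 * E h.
  by rewrite (bilZl wM)//; [rewrite (bilZr wM)// mulrA expr2|exact: L1Z].
set q := I (fun x => h x ^+ 2) in q0 Eh *; move=> Hq; exists (fun x => rho + k x) => //.
have t20 : 0 < t ^+ 2 by rewrite exprn_gt0.
have h1 : b * (t ^+ 2 * E h) <= b * l * (t ^+ 2 * q).
  by rewrite -mulrA ler_pM2l// mulrCA ler_pM2l.
rewrite bl in h1.
have : 0 < s * (t ^+ 2 * q) by rewrite mulr_gt0// mulr_gt0.
move: Hq; rewrite ler_distl => /andP[_]; rewrite /s in h1 *; lra.
Qed.

Lemma entropy_gap_le f : density_fun f ->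
  I (fun x => gap m (f x) rho) <= I (fun x => f x `^ m) - rho `^ (m - 1).
Proof.
move=> Df; have Lg := L1_gap Df density_rho; move: Df => [f0 Lf f1 fm].
have Lr (k : R) : L1 mu (fun=> k) by exact: L1_cst.
have Lfr : L1 mu (fun x => m * rho `^ (m - 1) * (f x - rho)) by apply: L1Z; exact: L1B.
have Irho : I (fun=> rho) = 1 by rewrite I_cst mulVf// gt_eqF.
have -> : I (fun x => f x `^ m) - rho `^ (m - 1) =
   I (fun x => f x `^ m - rho `^ m - m * rho `^ (m - 1) * (f x - rho)).
  rewrite IB//; last exact: L1B.
  rewrite IB// IZ; last exact: L1B.
  rewrite IB// f1 Irho subrr mulr0 subr0 I_cst -(mulr_powRB1 (ltW rho0) m0).
  by rewrite mulrAC mulVf ?gt_eqF// mul1r.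
apply: I_le => //; first by apply: L1B => //; exact: L1B.
by move=> x; apply: gap_le_bregman => //; exact: ltW.
Qed.

Lemma near_uniform_of_excess b f : 0 <= b -> density_fun f -> excess b f <= 0 ->
  I (fun x => gap m (f x) rho) <= (m - 1) * (b * M / 2).
Proof.
move=> b0 Df; rewrite /excess -lerBrDr sub0r ler_pdivrMr// => H.
apply: le_trans (entropy_gap_le Df) (le_trans H _).
rewrite mulrC ler_pM2l//.
have := ler_wpM2l b0 (bil_density_le Df).
have := ler_wpM2l b0 (ler_norm (- E f)); rewrite normrN; lra.
Qed.

(** For small [b] the entropy of a minimiser is close to that of [rho], hence the
    minimiser is close to [rho] in L1, then uniformly, and local stability identifies it with [rho]. *)
Lemma uniform_minimal_small_b : finite_rank_approx -> spectral_lower_bound ->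
  exists2 b, 0 < b & forall f, density_fun f -> 0 <= excess b f.
Proof.
move=> fr slb; have bs0 := bsharp_gt0.
pose bm := bsharp / 2.
have bm0 : 0 <= bm <= bm by rewrite lexx divr_ge0// ltW.
have bms : 0 <= bm < bsharp by rewrite (andP bm0).1/= /bm ltr_pdivrMr// ltr_pMr// ltr1n.
have [eta eta0 Heta] := rho_strict_local_minimiser slb bms.
have [dl dl0 Hdl] := minimiser_uniform (andP bm0).1 eta0.
have dl20 : 0 < dl / 2 by rewrite divr_gt0.
have [K K0 HK] := L1_dist_le_gap dl20.
have den0 : 0 < K * ((m - 1) * (M / 2)) + 1.
  by rewrite ltr_wpDl// mulr_ge0// mulr_ge0 ?(ltW m10)// divr_ge0.
pose b := Num.min bm (dl / 2 / (K * ((m - 1) * (M / 2)) + 1)).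
have bmp : 0 < bm by rewrite divr_gt0.
have b0 : 0 < b by rewrite lt_min bmp divr_gt0.
have bbm : 0 <= b <= bm by rewrite (ltW b0) ge_min lexx.
exists b => //.
have [f [Df fmin]] := excess_minimiser_exists fr (ltW b0).
have fle : excess b f <= 0 by rewrite -(excess_rho w1 b); apply: fmin; exact: density_rho.
have close : N (fun x => f x - rho) <= dl.
  apply: le_trans (HK _ _ Df density_rho) _.
  rewrite [leRHS]splitr lerD2l.
  apply: le_trans (ler_wpM2l K0 (near_uniform_of_excess (ltW b0) Df fle)) _.
  have -> : K * ((m - 1) * (b * M / 2)) = b * (K * ((m - 1) * (M / 2))) by ring.
  apply: (@le_trans _ _ (b * (K * ((m - 1) * (M / 2)) + 1))).
    by rewrite ler_pM2l// lerDl.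
  by rewrite -ler_pdivlMr// ge_min lexx orbT.
have fu := Hdl b f bbm (conj Df fmin) close.
have frho := Heta b f bbm Df fu fle.
have [_ H] := density_ae Df (measurable_cst rho) (fun=> ltW rho0) frho.
by move=> g Dg; rewrite -(excess_rho w1 b) H; exact: fmin.
Qed.

(** Minimisers at parameters decreasing to [b0] are almost minimal at [b0]. If
    they stayed away from [rho] in L1, a cluster point would be a second minimiser
    at [b0]; and closeness in L1 becomes uniform by [minimiser_uniform]. *)
Lemma minimisers_continuous b0 eta : finite_rank_approx -> 0 < b0 -> 0 < eta ->
  (forall f, density_fun f -> 0 <= excess b0 f) ->
  (forall f, density_fun f -> excess b0 f <= 0 -> {ae mu, forall x, f x = rho}) ->
  exists2 dl, 0 < dl & forall b f, b0 <= b <= b0 + dl -> excess_minimiser b f ->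
    {ae mu, forall x, `|f x - rho| <= eta}.
Proof.
move=> fr b00 eta0 min0 uniq0.
have bm0 : 0 <= b0 + 1 by lra.
have [dl dl0 Hdl] := minimiser_uniform bm0 eta0.
have minle b f : excess_minimiser b f -> excess b f <= 0.
  by move=> [_ fmin]; rewrite -(excess_rho w1 b); apply: fmin; exact: density_rho.
apply: contrapT => /forall2NP nex.
pose S := [set f | density_fun f /\ exists2 b, excess_minimiser b f &
  b0 <= b <= b0 + 1 /\ dl < N (fun x => f x - rho)].
have [f|f Sf|e e0|f [Df fle] Hf] := @almost_minimisers_compact b0 0 S fr (ltW b00).
- exact: min0.
- by case: Sf.
- pose r := Num.min 1 (2 * e / (M + 1)).
  have M10 : 0 < M + 1 by rewrite ltr_wpDl.
  have r0 : 0 < r by rewrite lt_min ltr01 divr_gt0// mulr_gt0.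
  have [//|/existsNP[b /existsNP[f /not_implyP[/andP[bb0 bbr] /not_implyP[fmin nf]]]]] :=
    nex r.
  have b1 : b0 <= b <= b0 + 1.
    by rewrite bb0 (le_trans bbr)// lerD2l ge_min lexx.
  exists f.
    split; first by case: fmin.
    exists b => //; split => //; rewrite ltNge; apply/negP => close.
    apply: nf; apply: (Hdl b f _ fmin close).
    by case/andP: b1 => h1 h2; rewrite h2 andbT (le_trans _ h1)// ltW.
  have := minle b f fmin; have [Df _] := fmin.
  have -> : excess b0 f = excess b f - (b - b0) / 2 * E f.
    by rewrite /excess; ring.
  move=> fle; have : (b - b0) * `|E f| <= r * (M + 1).
    apply: ler_pM => //; [by rewrite subr_ge0|by rewrite lerBlDl|].
    by rewrite (le_trans (bil_density_le Df))// lerDl.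
  have : r * (M + 1) <= 2 * e by rewrite -ler_pdivlMr// ge_min lexx orbT.
  have : (b - b0) * - `|E f| <= (b - b0) * E f.
    by rewrite ler_wpM2l ?subr_ge0// lerNl -normrN ler_norm.
  lra.
have frho := uniq0 f Df fle.
have [|g [Dg [b _ [_ far]]]] := Hf (dl / 2); first by rewrite divr_gt0.
have [[_ Lf _ _] [_ Lg _ _]] := (Df, Dg).
have Lr : L1 mu (fun=> rho) by exact: L1_cst.
have -> : N (fun x => f x - g x) = N (fun x => g x - rho).
  apply: I_ae; [exact: (L1_meas (L1_norm (L1B Lf Lg)))|
    exact: (L1_meas (L1_norm (L1B Lg Lr)))|].
  by apply: filterS frho => x ->; rewrite distrC.
by move: far dl0; lra.
Qed.

Lemma ae_of_gap0 f : density_fun f -> I (fun x => gap m (f x) rho) <= 0 ->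
  {ae mu, forall x, f x = rho}.
Proof.
move=> Df g0; have [f0 Lf _ _] := Df.
have Lr : L1 mu (fun=> rho) by exact: L1_cst.
have N0 : N (fun x => f x - rho) = 0.
  apply/eqP; rewrite eq_le N_ge0 andbT; apply/ler_addgt0Pr => e e0; rewrite add0r.
  have [K K0 HK] := L1_dist_le_gap e0.
  apply: le_trans (HK _ _ Df density_rho) _.
  by rewrite gerDl mulr_ge0_le0.
have := I_eq0_ae (L1_norm (L1B Lf Lr)) (fun x => normr_ge0 _) N0.
by apply: filterS => x /normr0_eq0 /eqP; rewrite subr_eq0 => /eqP.
Qed.

(** The excess is affine in the parameter, with a nonnegative value at [0] that
    vanishes only at [rho]. *)
Lemma excess_below b b' f : 0 <= b' < b -> (forall f, density_fun f -> 0 <= excess b f) ->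
  density_fun f -> 0 <= excess b' f /\
    (excess b' f <= 0 -> {ae mu, forall x, f x = rho}).
Proof.
move=> /andP[b'0 b'b] min Df; have b0 := le_lt_trans b'0 b'b.
have g0 : 0 <= I (fun x => gap m (f x) rho).
  by apply: I_ge0 => x; apply: gap_ge0 => //; [case: Df|exact: ltW].
have gD := entropy_gap_le Df.
have exE : excess b' f = (1 - b' / b) *
    ((I (fun x => f x `^ m) - rho `^ (m - 1)) / (m - 1)) + b' / b * excess b f.
  by rewrite /excess; field; rewrite !gt_eqF.
have r0 : 0 <= b' / b by rewrite divr_ge0// ltW.
have r1 : 0 < 1 - b' / b by rewrite subr_gt0 ltr_pdivrMr// mul1r.
have h := mulr_ge0 r0 (min f Df).
have i0 : 0 < (m - 1)^-1 by rewrite invr_gt0.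
split.
  rewrite exE addr_ge0// mulr_ge0 ?(ltW r1)// mulr_ge0 ?(ltW i0)//.
  exact: le_trans gD.
move=> le0; apply: ae_of_gap0 => //; apply: le_trans gD _.
rewrite -(pmulr_lle0 _ i0) -(pmulr_rle0 _ r1).
by move: le0; rewrite exE; lra.
Qed.

(** The critical parameter is the supremum of the parameters at which [rho] is
    minimal. It is attained, as the excess of each density is affine in the
    parameter, and bounded by [bsharp]. *)
Lemma critical_parameter : finite_rank_approx -> spectral_lower_bound ->
  spectral_bound_approached -> exists bc, [/\ 0 < bc,
    forall f, density_fun f -> 0 <= excess bc f &
    forall b, bc < b -> exists2 f, excess_minimiser b f & excess b f < 0].
Proof.
move=> fr slb sba.
pose S := [set b | 0 < b /\ forall f, density_fun f -> 0 <= excess b f].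
have [b1 b10 Sb1] := uniform_minimal_small_b fr slb.
have S1 : S b1 by [].
have Sub : ubound S bsharp.
  move=> b [b0 Sb]; rewrite leNgt; apply/negP => /(rho_unstable sba)[f Df].
  by rewrite ltNge Sb.
have supS : has_sup S by split; [exists b1|exists bsharp].
have bc0 : 0 < sup S by apply: lt_le_trans b10 _; exact: (ub_le_sup supS.2 S1).
exists (sup S); split=> //.
  move=> f Df; rewrite leNgt; apply/negP => lt0.
  have [E0|E0] := leP 0 (E f).
    move: lt0; rewrite ltNge /excess addr_ge0//.
      rewrite mulr_ge0 ?invr_ge0 ?(ltW m10)//.
      apply: le_trans (entropy_gap_le Df); apply: I_ge0 => x.
      by apply: gap_ge0 => //; [case: Df|exact: ltW].
    by rewrite mulr_ge0// divr_ge0// ltW.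
  pose dl := excess (sup S) f / E f.
  have dl0 : 0 < dl by rewrite /dl nmulr_lgt0// invr_lt0.
  have [b [b0 Sb] bs] := sup_adherent dl0 supS.
  have := Sb f Df; rewrite leNgt => /negP; apply.
  have -> : excess b f = excess (sup S) f - (sup S - b) / 2 * E f.
    by rewrite /excess; ring.
  have : dl * E f = excess (sup S) f by rewrite divfK// lt_eqF.
  have : (sup S - dl - b) * - E f < 0.
    by rewrite nmulr_rlt0 ?oppr_gt0// subr_lt0.
  move: lt0; lra.
move=> b sb; have b0 := lt_trans bc0 sb.
have [f [Df fmin]] := excess_minimiser_exists fr (ltW b0).
exists f => //; rewrite ltNge; apply/negP => f0.
have : S b by split=> // g Dg; exact: le_trans (fmin g Dg).
by move/(ub_le_sup supS.2); rewrite leNgt sb.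
Qed.

End phase_diagram.
End variational.

(** * Cosine approximation of even periodic functions *)

Section bernstein.
Variable R : realType.
Implicit Types (u : R) (g : nat -> R).

(** The binomial weights 'C(n, j) u^j (1 - u)^(n - j), by Pascal's recursion. *)
Fixpoint bernstein (n : nat) u (j : nat) : R :=
  if n is n'.+1 then
    (1 - u) * bernstein n' u j + u * (if j is j'.+1 then bernstein n' u j' else 0)
  else (j == 0%N)%:R.

Lemma bernstein_ge0 n u j : 0 <= u <= 1 -> 0 <= bernstein n u j.
Proof.
move=> /andP[u0 u1]; elim: n j => [|n IH] j /=; first exact: ler0n.
rewrite addr_ge0 ?mulr_ge0 ?subr_ge0//.
by case: j => [|j] //.
Qed.

Lemma bernstein_gt n u j : (n < j)%N -> bernstein n u j = 0.
Proof.
elim: n j => [|n IH] [|j]//= nj.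
by rewrite !IH ?mulr0 ?addr0// ltnW.
Qed.

Lemma bernstein_sumS n u g :
  \sum_(j < n.+2) bernstein n.+1 u j * g j =
  (1 - u) * (\sum_(j < n.+1) bernstein n u j * g j) +
  u * (\sum_(j < n.+1) bernstein n u j * g j.+1).
Proof.
rewrite !mulr_sumr.
under eq_bigr do rewrite /= mulrDl.
rewrite big_split/=; congr (_ + _).
  rewrite big_ord_recr/= (bernstein_gt _ (ltnSn n)) mulr0 mul0r addr0.
  by apply: eq_bigr => j _; rewrite mulrA.
rewrite big_ord_recl/= mulr0 mul0r add0r.
by apply: eq_bigr => j _; rewrite mulrA.
Qed.

Lemma bernstein_sum1 n u : \sum_(j < n.+1) bernstein n u j = 1.
Proof.
have E k : \sum_(j < k.+1) bernstein k u j = \sum_(j < k.+1) bernstein k u j * (fun=> 1) (nat_of_ord j).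
  by apply: eq_bigr => j _; rewrite mulr1.
elim: n => [|n IH]; first by rewrite big_ord1.
by rewrite E (bernstein_sumS n u (fun=> 1)) -!E IH; ring.
Qed.

(** The shift [c] is what makes the induction on [n] go through. *)
Lemma bernstein_variance n u c :
  \sum_(j < n.+1) bernstein n u j * (j%:R - n%:R * u + c) ^+ 2 =
  n%:R * (u * (1 - u)) + c ^+ 2.
Proof.
elim: n c => [|n IH] c; first by rewrite big_ord1/=; ring.
rewrite (bernstein_sumS n u (fun j => (j%:R - n.+1%:R * u + c) ^+ 2)).
have E1 : \sum_(j < n.+1) bernstein n u j * (j%:R - n.+1%:R * u + c) ^+ 2 =
    n%:R * (u * (1 - u)) + (c - u) ^+ 2.
  rewrite -IH; apply: eq_bigr => j _; congr (_ * _ ^+ 2); rewrite -natr1; ring.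
have E2 : \sum_(j < n.+1) bernstein n u j * (j.+1%:R - n.+1%:R * u + c) ^+ 2 =
    n%:R * (u * (1 - u)) + (c + 1 - u) ^+ 2.
  rewrite -IH; apply: eq_bigr => j _; congr (_ * _ ^+ 2); rewrite -!natr1; ring.
by rewrite E1 E2 -natr1; ring.
Qed.

Lemma bernstein_mean_square n u : 0 <= u <= 1 -> (0 < n)%N ->
  \sum_(j < n.+1) bernstein n u j * (u - j%:R / n%:R) ^+ 2 <= n%:R^-1.
Proof.
move=> /andP[u0 u1] n0; have n0' : n%:R != 0 :> R by rewrite pnatr_eq0 -lt0n.
have -> : \sum_(j < n.+1) bernstein n u j * (u - j%:R / n%:R) ^+ 2 =
    (n%:R ^- 2) * (\sum_(j < n.+1) bernstein n u j * (j%:R - n%:R * u + 0) ^+ 2).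
  by rewrite mulr_sumr; apply: eq_bigr => j _; field.
rewrite bernstein_variance -[X in _ <= X]mulr1.
have -> : n%:R ^- 2 * (n%:R * (u * (1 - u)) + 0 ^+ 2) = n%:R^-1 * (u * (1 - u)).
  by field.
by rewrite ler_wpM2l ?invr_ge0// mulr_ile1 ?subr_ge0// lerBlDr lerDl.
Qed.

End bernstein.

Section cosine_polynomials.
Variables (R : realType) (L : R).

Definition angle (k : nat) (t : R) : R := 2 * pi * k%:R * t / L.

Definition cos_poly (n : nat) (f : R -> R) :=
  exists q : nat -> R, forall t, f t = \sum_(k < n.+1) q k * cos (angle k t).

Lemma cos_poly_ext n f g : f =1 g -> cos_poly n f -> cos_poly n g.
Proof. by move=> fg [q Hq]; exists q => t; rewrite -fg. Qed.

Lemma cos_poly_sum n (J : Type) (s : seq J) (c : J -> R) (F : J -> R -> R) :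
  (forall j, cos_poly n (F j)) -> cos_poly n (fun t => \sum_(j <- s) c j * F j t).
Proof.
move=> /choice[q Hq]; exists (fun k => \sum_(j <- s) c j * q j k) => t.
under [RHS]eq_bigr do rewrite mulr_suml.
rewrite exchange_big/=; apply: eq_bigr => j _; rewrite Hq mulr_sumr.
by apply: eq_bigr => k _; rewrite mulrA.
Qed.

Lemma cos_polyD n f g a b : cos_poly n f -> cos_poly n g ->
  cos_poly n (fun t => a * f t + b * g t).
Proof.
move=> [p Hp] [q Hq]; exists (fun k => a * p k + b * q k) => t.
rewrite Hp Hq !mulr_sumr -big_split/=.
by apply: eq_bigr => k _; rewrite mulrDl !mulrA.
Qed.

Lemma cos_poly_cos n k : (k <= n)%N -> cos_poly n (fun t => cos (angle k t)).
Proof.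
move=> kn; exists (fun i => (i == k)%:R) => t.
rewrite (bigD1 (Ordinal (kn : (k < n.+1)%N)))//= eqxx mul1r big1 ?addr0// => i ik.
by rewrite (_ : (_ == k) = false) ?mul0r//; apply: contraNF ik => /eqP ik; apply/eqP/val_inj.
Qed.

Lemma cos_polyS n f : cos_poly n f -> cos_poly n.+1 f.
Proof.
move=> [q Hq]; apply: (@cos_poly_ext _ (fun t => \sum_(k <- enum 'I_n.+1) q k * cos (angle k t))).
  by move=> t; rewrite Hq big_enum.
apply: (@cos_poly_sum n.+1 'I_n.+1 _ _ (fun (k : 'I_n.+1) t => cos (angle k t))) => k.
by apply: cos_poly_cos; rewrite ltnW.
Qed.

Lemma angleD k l t : angle (k + l) t = angle k t + angle l t.
Proof. by rewrite /angle natrD; ring. Qed.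

Lemma cos_polyM n f : cos_poly n f ->
  cos_poly n.+1 (fun t => cos (angle 1 t) * f t).
Proof.
move=> [q Hq]; apply: (@cos_poly_ext _
   (fun t => \sum_(k <- enum 'I_n.+1) q k * (cos (angle 1 t) * cos (angle k t)))).
  by move=> t; rewrite Hq big_enum mulr_sumr; apply: eq_bigr => k _; rewrite mulrCA.
apply: (@cos_poly_sum n.+1 'I_n.+1 _ _ (fun (k : 'I_n.+1) t => cos (angle 1 t) * cos (angle k t))) => k.
case: k => [[|k] kn]/=.
  apply: (@cos_poly_ext _ (fun t => cos (angle 1 t))); last exact: cos_poly_cos.
  by move=> t; rewrite [angle 0 t]/angle mulr0 !mul0r cos0 mulr1.
apply: (@cos_poly_ext _ (fun t => 2^-1 * cos (angle k.+2 t) + 2^-1 * cos (angle k t))).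
  move=> t; rewrite -[k.+2]addn1 angleD cosD.
  have -> : angle k t = angle k.+1 t - angle 1 t by rewrite -[k.+1]addn1 angleD addrK.
  by rewrite cosB; field.
by apply: cos_polyD; apply: cos_poly_cos => //; rewrite ltnW// ltnW.
Qed.

Lemma bernstein_cos_poly n j :
  cos_poly n (fun t => bernstein n ((1 + cos (angle 1 t)) / 2) j).
Proof.
elim: n j => [|n IH] j.
  by exists (fun=> (j == 0%N)%:R) => t; rewrite big_ord1 /angle mulr0 !mul0r cos0 mulr1.
have half f : cos_poly n f -> cos_poly n.+1 (fun t => (1 - (1 + cos (angle 1 t)) / 2) * f t).
  move=> cf; apply: cos_poly_ext (cos_polyD 2^-1 (- 2^-1) (cos_polyS cf) (cos_polyM cf)).
  by move=> t /=; field.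
have half' f : cos_poly n f -> cos_poly n.+1 (fun t => (1 + cos (angle 1 t)) / 2 * f t).
  move=> cf; apply: cos_poly_ext (cos_polyD 2^-1 2^-1 (cos_polyS cf) (cos_polyM cf)).
  by move=> t /=; field.
have [p Hp] := half _ (IH j).
have [q Hq] : cos_poly n.+1 (fun t => (1 + cos (angle 1 t)) / 2 *
    (if j is j'.+1 then bernstein n ((1 + cos (angle 1 t)) / 2) j' else 0)).
  case: j {Hp} => [|j]; last exact: half'.
  exists (fun=> 0) => t; rewrite mulr0 big1// => k _; exact: mul0r.
exists (fun k => p k + q k) => t; rewrite /= Hp Hq -big_split/=.
by apply: eq_bigr => k _; rewrite mulrDl.
Qed.

End cosine_polynomials.

(** Otherwise counterexamples for [c = 0, 1, 2, ...] would accumulate at a zero of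
    [g] at which [f] is at least [e]. *)
Lemma compact_majorant (R : realType) (X : topologicalType) (K : set X)
    (f g : X -> R) : compact K -> continuous f -> continuous g ->
  (forall x, 0 <= g x) -> (forall x, K x -> g x = 0 -> f x <= 0) ->
  forall e, 0 < e -> exists2 c, 0 <= c & forall x, K x -> f x <= e + c * g x.
Proof.
move=> cK cf cg g0 fg e e0; apply: contrapT => /forall2NP H.
pose S (n : nat) := [set x | K x /\ e + n%:R * g x < f x].
have S0 n : exists x, S n x.
  have [|/existsNP[x /not_implyP[Kx /negP]]] := H n%:R; first by rewrite ler0n.
  by rewrite -ltNge; exists x.
have SS n k : (n <= k)%N -> S k `<=` S n.
  move=> nk x [Kx h]; split => //; apply: le_lt_trans h.
  by rewrite lerD2l ler_wpM2r// ler_nat.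
pose F := [set A : set X | exists n, S n `<=` A].
have PF : ProperFilter F.
  apply: Build_ProperFilter_ex => [A [n sA]|].
    by have [x Sx] := S0 n; exists x; exact: sA.
  split; first by exists 0%N.
  - move=> A B [n sA] [k sB]; exists (maxn n k) => x Sx; split.
      by apply/sA/(SS _ _ (leq_maxl n k)).
    by apply/sB/(SS _ _ (leq_maxr n k)).
  - by move=> A B AB [n sA]; exists n; exact: subset_trans AB.
have [|p [Kp clp]] := cK F PF; first by exists 0%N => x [].
have bound n : e + n%:R * g p <= f p.
  rewrite leNgt; apply/negP => lt.
  have ch : continuous (fun x => e + n%:R * g x - f x).
    move=> x; apply: cvgB; last exact: cf.
    by apply: cvgD; [exact: cvg_cst|apply: cvgMr; exact: cg].
  have nb : nbhs p [set x | 0 < e + n%:R * g x - f x].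
    by apply: (cvgr_gt _ (ch p)); rewrite subr_gt0.
  have Fn : F (S n) by exists n.
  have [x [[_ /= h1]]] := clp _ _ Fn nb.
  by rewrite /= subr_gt0 ltNge (ltW h1).
have gp : g p = 0.
  apply/eqP; rewrite eq_le g0 andbT leNgt; apply/negP => gp.
  pose n := Num.truncn (f p / g p); have := bound n.+1.
  have := truncnS_gt (f p / g p); rewrite -/n ltr_pdivrMr// => h1 h2.
  by move: (le_lt_trans h2 h1); rewrite gtrDr ltNge (ltW e0).
have := fg p Kp gp; have := bound 0%N; rewrite gp mulr0 addr0 => h1 h2.
by move: (le_trans h1 h2); rewrite leNgt e0.
Qed.

Section approximation.
Variables (R : realType) (d : nat) (L : R) (W : 'rV[R]_d -> R).
Hypotheses (L0 : 0 < L) (Wper : torus_periodic L W) (Weven : even_coordinates W)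
  (Wcont : continuous W).
Local Notation cosL t := (cos (angle L 1 t)).

Lemma W_translate i (n : int) (x : 'rV[R]_d) :
  W (x + (n%:~R * L) *: delta_mx 0 i) = W x.
Proof.
have nat_case (k : nat) y : W (y + (k%:R * L) *: delta_mx 0 i) = W y.
  rewrite -[RHS](periodicn (Wper i) k); congr W.
  by rewrite mulr_natl -scalerMnl.
case: n => k; first exact: nat_case.
rewrite -(nat_case k.+1); congr W.
by rewrite NegzE mulrNz mulNr scaleNr subrK.
Qed.

(** The identifications of points of the line that periodicity and evenness allow in
    one coordinate of [W]. *)
Definition folded (t t' : R) :=
  exists n : int, t' = t - n%:~R * L \/ t' = - (t - n%:~R * L).

Lemma W_fold1 i t' (x : 'rV[R]_d) : folded (x 0 i) t' ->
  W (\row_j (if j == i then t' else x 0 j)) = W x.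
Proof.
move=> [n tE]; pose y := x + ((- n)%:~R * L) *: delta_mx 0 i.
rewrite -(W_translate i (- n) x) -/y.
have yE j : y 0 j = if j == i then x 0 i - n%:~R * L else x 0 j.
  rewrite !mxE eqxx/=; case: eqVneq => [->|ji]; rewrite ?mulr1 ?mulr0 ?addr0//.
  by rewrite mulrNz mulNr.
case: tE => ->.
  by congr W; apply/rowP => j; rewrite mxE yE.
rewrite -[RHS](Weven i); congr W; apply/rowP => j; rewrite mxE [RHS]mxE yE.
by case: eqVneq.
Qed.

Lemma W_fold (x y : 'rV[R]_d) : (forall i, folded (x 0 i) (y 0 i)) -> W y = W x.
Proof.
move=> xy; pose z k : 'rV_d := \row_j (if (j < k)%N then y 0 j else x 0 j).
have zW k : W (z k) = W x.
  elim: k => [|k IH].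
    by congr W; apply/rowP => j; rewrite mxE.
  have [kd|dk] := ltnP k d; last first.
    rewrite -IH; congr W; apply/rowP => j; rewrite !mxE ltnS leq_eqVlt.
    by rewrite (ltn_eqF (leq_trans (ltn_ord j) dk)).
  have zk : z k 0 (Ordinal kd) = x 0 (Ordinal kd) by rewrite /z mxE/= ltnn.
  rewrite -IH -[RHS](@W_fold1 (Ordinal kd) (y 0 (Ordinal kd))) ?zk//.
  congr W; apply/rowP => j; rewrite !mxE ltnS leq_eqVlt -val_eqE/=.
  by case: eqVneq => //= jk; rewrite (_ : j = Ordinal kd)//; exact: val_inj.
by rewrite -(zW d); congr W; apply/rowP => j; rewrite mxE ltn_ord.
Qed.

(** The representative of [t] in [[0, L / 2]], where the cosine of period [L] is
    injective. *)
Definition fold (t : R) := L / (2 * pi) * acos (cosL t).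

Let pi0 : 0 < pi :> R := pi_gt0 R.
Let tp0 : 2 * pi != 0 :> R. Proof. by rewrite mulf_neq0// gt_eqF. Qed.

Lemma angle1E t : angle L 1 t = 2 * pi * t / L.
Proof. by rewrite /angle mulr1. Qed.

Lemma cos_period (n : int) (t : R) : cos (t + n%:~R * (2 * pi)) = cos t.
Proof.
have nat_case (k : nat) s : cos (s + k%:R * (2 * pi)) = cos s :> R.
  rewrite -[RHS](periodicn (@cosD2pi R) k); congr cos.
  by rewrite [k%:R * _]mulr_natl -[pi *+ 2]mulr_natl.
case: n => k; first exact: nat_case.
by rewrite -(nat_case k.+1) NegzE mulrNz mulNr subrK.
Qed.

Lemma folded_fold t : folded t (fold t).
Proof.
pose n := Num.floor (t / L + 2^-1); exists n.
have Lneq : L != 0 by rewrite gt_eqF.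
have pneq : pi != 0 :> R by rewrite gt_eqF.
have := floor_le (t / L + 2^-1); have := floorD1_gt (t / L + 2^-1).
rewrite -/n intrD => h1 h2.
pose r := 2 * pi * (t / L - n%:~R).
have cosr : cosL t = cos r.
  rewrite -(cos_period n r); congr cos; rewrite angle1E /r.
  by generalize (pi : R) => p; field.
have [rpos|rneg] := leP 0 r.
  left; rewrite /fold cosr cosK.
    by move: pneq; rewrite /r; generalize (pi : R) => p pneq; field; rewrite Lneq.
  rewrite in_itv/= rpos/= /r mulrAC -[X in _ <= X]mul1r ler_pM2r//; lra.
right; rewrite /fold cosr cosKN; first by move: pneq; rewrite /r; generalize (pi : R) => p pneq; field; rewrite Lneq.
rewrite (ltW rneg) andbT /r mulrAC -mulN1r ler_pM2r//; lra.
Qed.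

Lemma fold_itv t : 0 <= fold t <= L / 2.
Proof.
have c : -1 <= cosL t <= 1 by rewrite cos_geN1 cos_le1.
have l0 : 0 < L / (2 * pi) by rewrite divr_gt0// mulr_gt0.
rewrite mulr_ge0 ?(ltW l0) ?acos_ge0//=.
have -> : L / 2 = L / (2 * pi) * pi.
  by move: pi0; generalize (pi : R) => p p0; field; rewrite gt_eqF.
by rewrite /fold ler_pM2l// acos_lepi.
Qed.

Lemma cosL_fold t : cosL (fold t) = cosL t.
Proof.
rewrite angle1E /fold.
have -> : 2 * pi * (L / (2 * pi) * acos (cosL t)) / L = acos (cosL t).
  move: pi0; set a := acos _; move: a; generalize (pi : R) => p a p0.
  by field; rewrite !gt_eqF.
by rewrite acosK// in_itv/= cos_geN1 cos_le1.
Qed.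

Definition fold_row (x : 'rV[R]_d) : 'rV[R]_d := \row_i fold (x 0 i).

Lemma W_fold_row x : W (fold_row x) = W x.
Proof. by apply: W_fold => i; rewrite mxE; exact: folded_fold. Qed.

Lemma continuous_cosL : continuous (fun t : R => cosL t).
Proof.
move=> t; apply: (@continuous_comp _ _ _ (angle L 1) cos); last exact: continuous_cos.
by apply: cvgMl; apply: cvgMr; exact: cvg_id.
Qed.

(** [W] is a function of the cosines of the coordinates: folding moves both points
    to the cube of side [L / 2], where equal cosines mean equal points, and
    compactness turns this into a modulus of continuity. *)
Lemma W_modulus e : 0 < e -> exists2 c, 0 <= c & forall x y : 'rV[R]_d,
  `|W x - W y| <= e + c * \sum_i (cosL (x 0 i) - cosL (y 0 i)) ^+ 2.
Proof.
move=> e0.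
pose K1 := [set v : 'rV[R]_d | forall i, [set` `[0, L / 2]] (v 0 i)].
have cK1 : compact K1.
  by apply: (@rV_compact _ _ (fun=> [set` `[0, L / 2]])) => i; exact: segment_compact.
pose f (z : 'rV[R]_d * 'rV[R]_d) := `|W z.1 - W z.2|.
pose g (z : 'rV[R]_d * 'rV[R]_d) := \sum_i (cosL (z.1 0 i) - cosL (z.2 0 i)) ^+ 2.
have g0 z : 0 <= g z by apply: sumr_ge0 => i _; exact: sqr_ge0.
have cW1 (p : 'rV[R]_d * 'rV[R]_d -> 'rV[R]_d) : continuous p -> continuous (W \o p).
  by move=> cp z; apply: continuous_comp; [exact: cp|exact: Wcont].
have ccos (p : 'rV[R]_d * 'rV[R]_d -> 'rV[R]_d) i : continuous p ->
    continuous (fun z => cosL (p z 0 i)).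
  move=> cp z; apply: (@continuous_comp _ _ _ (fun z => p z 0 i) (fun t => cosL t)).
    apply: (@continuous_comp _ _ _ p (fun v : 'rV[R]_d => v 0 i)); first exact: cp.
    exact: coord_continuous.
  exact: continuous_cosL.
have c1 : continuous (@fst 'rV[R]_d 'rV[R]_d) by move=> z; exact: cvg_fst.
have c2 : continuous (@snd 'rV[R]_d 'rV[R]_d) by move=> z; exact: cvg_snd.
have cf : continuous f.
  by move=> z; apply: cvg_norm; apply: cvgB; [exact: cW1|exact: cW1].
have cg : continuous g.
  move=> z; apply: cvg_big => [|i _]; first exact: add_continuous.
  have cd : {for z, continuous (fun z : 'rV[R]_d * 'rV[R]_d => cosL (z.1 0 i) - cosL (z.2 0 i))}.
    by apply: cvgB; exact: ccos.
  by under eq_fun do rewrite expr2; apply: cvgM.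
have fg z : (K1 `*` K1) z -> g z = 0 -> f z <= 0.
  case: z => x y [/= Kx Ky] /eqP; rewrite psumr_eq0/=; last by move=> i _; exact: sqr_ge0.
  move=> /allP H; rewrite /f/= (_ : x = y) ?subrr ?normr0//.
  apply/rowP => i; have := H i; rewrite mem_index_enum => /(_ isT).
  rewrite sqrf_eq0 subr_eq0 => /eqP xy.
  have box (v : 'rV[R]_d) : K1 v -> angle L 1 (v 0 i) \in `[0, pi].
    move=> /(_ i); rewrite /= !in_itv/= angle1E => /andP[v0 vL].
    have p20 : 0 <= 2 * pi :> R by rewrite mulr_ge0// ltW.
    apply/andP; split; first by apply: divr_ge0; [exact: mulr_ge0|exact: ltW].
    rewrite ler_pdivrMr//.
    have -> : pi * L = 2 * pi * (L / 2) by generalize (pi : R) => p; field.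
    by rewrite ler_wpM2l.
  have := cos_inj (box _ Kx) (box _ Ky) xy; rewrite !angle1E.
  move=> /(congr1 (fun t => t * L)); rewrite !divfK ?gt_eqF//.
  exact: (mulfI tp0).
have [c c0 Hc] := compact_majorant (compact_setX cK1 cK1) cf cg g0 fg e0.
exists c => // x y; rewrite -(W_fold_row x) -(W_fold_row y).
have := Hc (fold_row x, fold_row y); rewrite /f /g/=.
under eq_bigr do rewrite !mxE !cosL_fold.
by apply; split=> i /=; rewrite mxE in_itv/=; exact: fold_itv.
Qed.

(** [W] is a continuous function of the cosines of its coordinates. Its Bernstein
    polynomial in these variables is a cosine polynomial, and it is close to [W]
    uniformly because the quadratic modulus of [W] is paired with the variance of
    the binomial weights. *)
Lemma trig_approximation (e : R) (N : nat) : 0 < e ->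
  exists2 n, (N <= n)%N & exists p : {ffun 'I_d -> 'I_n.+1} -> R,
    forall x : 'rV[R]_d,
      `|W x - \sum_k p k * \prod_i cos (angle L (k i) (x 0 i))| <= e.
Proof.
move=> e0; have e20 : 0 < e / 2 by rewrite divr_gt0.
have [c c0 Wc] := W_modulus e20.
pose n := (maxn N (Num.truncn (c * 4 * d%:R / (e / 2)))).+1.
exists n; first by rewrite ltnW// ltnS leq_maxl.
have n0 : 0 < n%:R :> R by rewrite ltr0n.
have nbig : c * 4 * d%:R / n%:R <= e / 2.
  rewrite ler_pdivrMr// [e / 2 * _]mulrC -ler_pdivrMr//.
  apply: ltW; apply: lt_le_trans (truncnS_gt _) _.
  by rewrite ler_nat ltnS leq_maxr.
pose u (x : 'rV[R]_d) i := (1 + cosL (x 0 i)) / 2.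
have u01 x i : 0 <= u x i <= 1.
  by rewrite /u; have := cos_geN1 (angle L 1 (x 0 i)); have := cos_le1 (angle L 1 (x 0 i)); lra.
(* The point whose coordinates have the cosines [2 j / n - 1]. *)
pose node (j : {ffun 'I_d -> 'I_n.+1}) : 'rV[R]_d :=
  \row_i (L / (2 * pi) * acos (2 * (j i)%:R / n%:R - 1)).
have cos_node j i : cosL (node j 0 i) = 2 * (j i)%:R / n%:R - 1.
  rewrite mxE angle1E.
  have -> : 2 * pi * (L / (2 * pi) * acos (2 * (j i)%:R / n%:R - 1)) / L =
      acos (2 * (j i)%:R / n%:R - 1).
    move: pi0; set a := acos _; move: a; generalize (pi : R) => p a p0.
    by field; rewrite !gt_eqF.
  rewrite acosK// in_itv/=.
  have : 0 <= (j i)%:R / n%:R :> R by rewrite divr_ge0.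
  have : (j i)%:R / n%:R <= 1 :> R.
    by rewrite ler_pdivrMr// mul1r ler_nat -ltnS.
  by lra.
pose wt (x : 'rV[R]_d) (j : {ffun 'I_d -> 'I_n.+1}) := \prod_i bernstein n (u x i) (j i).
have wt0 x j : 0 <= wt x j by apply: prodr_ge0 => i _; exact: bernstein_ge0.
have wt1 x : \sum_j wt x j = 1.
  rewrite -(bigA_distr_bigA (fun i (j : 'I_n.+1) => bernstein n (u x i) j)).
  by rewrite big1// => i _; exact: bernstein_sum1.
have wt2 x l : \sum_j wt x j * (u x l - (j l)%:R / n%:R) ^+ 2 <= n%:R^-1.
  pose F i (k : 'I_n.+1) := bernstein n (u x i) k *
    (if i == l then (u x i - k%:R / n%:R) ^+ 2 else 1).
  have -> : \sum_j wt x j * (u x l - (j l)%:R / n%:R) ^+ 2 =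
      \sum_(j : {ffun 'I_d -> 'I_n.+1}) \prod_i F i (j i).
    apply: eq_bigr => j _; rewrite /F big_split/=; congr (_ * _).
    by rewrite -big_mkcond/= big_pred1_eq.
  rewrite -bigA_distr_bigA (bigD1 l)//= [X in _ * X]big1 ?mulr1.
    under eq_bigr do rewrite /F eqxx.
    exact: bernstein_mean_square.
  move=> i il; under eq_bigr do rewrite /F (negbTE il) mulr1.
  exact: bernstein_sum1.
have approx x : `|W x - \sum_j W (node j) * wt x j| <= e.
  have -> : W x - \sum_j W (node j) * wt x j = \sum_j wt x j * (W x - W (node j)).
    under [RHS]eq_bigr do rewrite mulrBr.
    rewrite sumrB -mulr_suml wt1 mul1r; congr (_ - _).
    by apply: eq_bigr => j _; rewrite mulrC.
  apply: le_trans (ler_norm_sum _ _ _) _.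
  pose B j := wt x j * (e / 2) + c * 4 * \sum_i wt x j * (u x i - (j i)%:R / n%:R) ^+ 2.
  apply: (@le_trans _ _ (\sum_j B j)).
    apply: ler_sum => j _; rewrite normrM (ger0_norm (wt0 x j)).
    apply: le_trans (ler_wpM2l (wt0 x j) (Wc x (node j))) _.
    rewrite mulrDr lerD2l -mulr_sumr mulrCA -mulrA ler_wpM2l// mulrCA ler_wpM2l//.
    rewrite mulr_sumr; apply: ler_sum => i _; rewrite cos_node le_eqVlt.
    by apply/orP; left; apply/eqP; rewrite /u; field; rewrite gt_eqF.
  rewrite big_split/= -mulr_suml wt1 mul1r -mulr_sumr exchange_big/=.
  rewrite [leRHS]splitr lerD2l.
  apply: le_trans _ nbig; rewrite -[leRHS]mulrA ler_wpM2l ?mulr_ge0//.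
  apply: (@le_trans _ _ (\sum_(i < d) n%:R^-1)); first exact: ler_sum.
  by rewrite sumr_const card_ord -[_ *+ d]mulr_natl.
have /choice[q Hq] : forall j, exists q : nat -> R, forall t,
    bernstein n ((1 + cosL t) / 2) j = \sum_(k < n.+1) q k * cos (angle L k t).
  by move=> j; exact: bernstein_cos_poly.
exists (fun k : {ffun 'I_d -> 'I_n.+1} => \sum_j W (node j) * \prod_i q (j i) (k i)) => x.
suff -> : \sum_(k : {ffun 'I_d -> 'I_n.+1}) (\sum_j W (node j) * \prod_i q (j i) (k i)) *
    \prod_i cos (angle L (k i) (x 0 i)) = \sum_j W (node j) * wt x j by exact: approx.
under eq_bigr do rewrite mulr_suml.
rewrite exchange_big/=; apply: eq_bigr => j _.
under eq_bigr do rewrite -mulrA -big_split/=.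
rewrite -mulr_sumr -(bigA_distr_bigA (fun i (k : 'I_n.+1) => q (j i) k * cos (angle L k (x 0 i)))).
by congr (_ * _); apply: eq_bigr => i _; rewrite /u Hq.
Qed.

Lemma W_bounded : exists B, forall x, `|W x| <= B.
Proof.
have [c c0 Wc] := W_modulus ltr01; pose z : 'rV[R]_d := 0.
exists (`|W z| + 1 + c * (d%:R * 4)) => x.
have := Wc x z; have := ler_dist_dist (W x) (W z).
have : \sum_i (cosL (x 0 i) - cosL (z 0 i)) ^+ 2 <= d%:R * 4.
  apply: (@le_trans _ _ (\sum_(i < d) (4 : R))); last by rewrite sumr_const card_ord -[_ *+ d]mulr_natl.
  apply: ler_sum => i _; rewrite -real_normK ?num_real//.
  have := cos_max (angle L 1 (x 0 i)); have := cos_max (angle L 1 (z 0 i)).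
  have := ler_normB (cosL (x 0 i)) (cosL (z 0 i)) => h1 h2 h3.
  have h4 : `|cosL (x 0 i) - cosL (z 0 i)| <= 2 by lra.
  have -> : 4 = 2 ^+ 2 :> R by ring.
  by rewrite lerXn2r ?nnegrE.
move=> /(ler_wpM2l c0) h1 h2 h3.
by move: (le_trans (ler_norm _) h2); lra.
Qed.

End approximation.

(** * Trigonometric modes on the cell *)

Section one_dimension.
Variables (R : realType) (L : R).
Hypothesis L0 : 0 < L.
Local Notation side := (side_measure L).
Local Notation mR := (measurableTypeR R).

Lemma integral_side (f : R -> R) : L1 side (f : mR -> R) ->
  \int[side]_x f x = \int[@lebesgue_measure R]_(x in `[0, L[) f x.
Proof.
move=> Lf; congr fine.
have mD : @measurable _ mR `[0, L[%classic by exact: measurable_itv.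
rewrite (@negligible_integral _ _ _ side setT (~` `[0, L[%classic))//.
- rewrite setTD setCK; apply: eq_measure_integral => A mA AD.
  rewrite /=/mfrestr/mrestr; congr (lebesgue_measure _).
  exact/setIidl.
- exact: measurableC.
- by rewrite /=/mfrestr/mrestr setICl measure0.
Qed.

Lemma integral_side_derivative (f F : R -> R) : continuous f ->
  (forall t : R, is_derive t 1 F (f t)) ->
  L1 side (f : mR -> R) -> \int[side]_x f x = F L - F 0.
Proof.
move=> cf dF Lf; rewrite integral_side//.
have cF : continuous F.
  by move=> t; apply: differentiable_continuous; apply/derivable1_diffP; have [] := dF t.
have cfw : {within `[0, L], continuous f} by exact: continuous_subspaceT.
have intf : lebesgue_measure.-integrable `[0, L] (EFin \o f).
  exact: continuous_compact_integrable (@segment_compact _ _ _) cfw.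
rewrite Rintegral_itv_bndo_bndc; last first.
  apply: integrableS intf => //; apply: subset_itvl; rewrite bnd_simp//.
have := continuous_FTC2 L0 cfw (F := F).
rewrite /Rintegral => -> //.
- split; first by move=> t _; have [] := dF t.
  + exact: cvg_at_right_filter (cF 0).
  + exact: cvg_at_left_filter (cF L).
- by move=> t _; rewrite derive1E; have [_ ->] := dF t.
Qed.

(** Integer frequencies, so that the product formulas apply to differences. *)
Definition zangle (z : int) (t : R) : R := 2 * pi * z%:~R * t / L.

Lemma continuous_zangle z : continuous (zangle z).
Proof. by move=> t; apply: cvgMl; apply: cvgMr; exact: cvg_id. Qed.

Lemma bounded_side (f : R -> R) : continuous f -> (forall t, `|f t| <= 1) ->
  bounded_by (f : mR -> R) 1.
Proof. by move=> cf f1; split => //; exact: continuous_measurable_fun. Qed.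

Lemma continuous_cos_zangle z : continuous (fun t => cos (zangle z t)).
Proof.
move=> t; apply: continuous_comp; [exact: continuous_zangle|exact: continuous_cos].
Qed.

Lemma continuous_sin_zangle z : continuous (fun t => sin (zangle z t)).
Proof.
move=> t; apply: continuous_comp; [exact: continuous_zangle|exact: continuous_sin].
Qed.

Lemma bounded_cos_zangle z : bounded_by (fun t : mR => cos (zangle z t)) 1.
Proof. by apply: bounded_side; [exact: continuous_cos_zangle|move=> t; exact: cos_max]. Qed.

Lemma bounded_sin_zangle z : bounded_by (fun t : mR => sin (zangle z t)) 1.
Proof. by apply: bounded_side; [exact: continuous_sin_zangle|move=> t; exact: sin_max]. Qed.

Lemma is_derive_zangle z (t : R) : is_derive t 1 (zangle z) (2 * pi * z%:~R / L).
Proof.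
have -> : zangle z = (fun t => (2 * pi * z%:~R / L) *: t).
  by apply/funext => s; rewrite /zangle /GRing.scale/= mulrAC.
by apply: is_derive_eq; rewrite /GRing.scale/= mulr1.
Qed.

Lemma side_mass : fine (side setT) = L.
Proof.
rewrite /=/mfrestr/mrestr setTI lebesgue_measure_itv/= lte_fin L0.
by rewrite oppr0 addr0.
Qed.

Lemma integral_cos_zangle z :
  \int[side]_t cos (zangle z t) = if z == 0 then L else 0.
Proof.
case: eqVneq => [->|z0].
  rewrite (@I_eq _ _ _ _ _ (fun=> 1)); last by move=> t; rewrite /zangle mulr0 !mul0r cos0.
  by rewrite Rintegral_cst// side_mass mul1r.
pose c : R := 2 * pi * z%:~R / L.
have c0 : c != 0.
  by rewrite /c !mulf_neq0 ?invr_eq0 ?intr_eq0// gt_eqF// pi_gt0.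
have dF (t : R) : is_derive t 1 (fun t => c^-1 * sin (zangle z t)) (cos (zangle z t)).
  have d1 := is_derive_zangle z t.
  have d2 := is_derive1_comp (is_derive_sin (zangle z t)) d1.
  have d3 := is_deriveZ (c^-1) d2.
  by apply: (is_derive_eq d3); rewrite /GRing.scale/= -/c; field.
rewrite (integral_side_derivative (@continuous_cos_zangle z) dF (L1_bounded _ (bounded_cos_zangle z))).
rewrite /zangle mulr0 mul0r sin0 mulr0 subr0 mulfK ?gt_eqF//.
have -> : 2 * pi * z%:~R = 0 + z%:~R * (2 * pi) :> R by rewrite add0r mulrC.
have -> : sin (0 + z%:~R * (2 * pi)) = sin 0 :> R.
  by rewrite -!cosBpihalf -addrAC cos_period.
by rewrite sin0 mulr0.
Qed.

Lemma integral_sin_zangle z : \int[side]_t sin (zangle z t) = 0.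
Proof.
have [->|z0] := eqVneq z 0.
  rewrite (@I_eq _ _ _ _ _ (fun=> 0)); last by move=> t; rewrite /zangle mulr0 !mul0r sin0.
  by rewrite Rintegral_cst// mul0r.
pose c : R := 2 * pi * z%:~R / L.
have c0 : c != 0.
  by rewrite /c !mulf_neq0 ?invr_eq0 ?intr_eq0// gt_eqF// pi_gt0.
have dF (t : R) : is_derive t 1 (fun t => - c^-1 * cos (zangle z t)) (sin (zangle z t)).
  have d1 := is_derive_zangle z t.
  have d2 := is_derive1_comp (is_derive_cos (zangle z t)) d1.
  have d3 := is_deriveZ (- c^-1) d2.
  by apply: (is_derive_eq d3); rewrite /GRing.scale/= -/c; field.
rewrite (integral_side_derivative (@continuous_sin_zangle z) dF (L1_bounded _ (bounded_sin_zangle z))).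
rewrite /zangle mulr0 mul0r mulfK ?gt_eqF//.
have -> : 2 * pi * z%:~R = 0 + z%:~R * (2 * pi) :> R by rewrite add0r mulrC.
by rewrite cos_period subrr.
Qed.

End one_dimension.

Section product_functions.
Variables (R : realType) (L : R).
Hypothesis L0 : 0 < L.
Local Notation side := (side_measure L).
Local Notation mR := (measurableTypeR R).

Definition tensor d (g : 'I_d -> mR -> R) (x : pt R d) : R :=
  \prod_i g i (tnth x i).

Lemma bounded_tensor d (g : 'I_d -> mR -> R) : (forall i, bounded_by (g i) 1) ->
  bounded_by (tensor g) 1.
Proof.
move=> g1; split.
  apply: measurable_prod => i _; apply: measurableT_comp; first by case: (g1 i).
  exact: measurable_tnth.
move=> x; rewrite /tensor normr_prod.
have : \prod_(i < d) `|g i (tnth x i)| <= \prod_(i < d) (1 : R).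
  by apply: ler_prod => i _; rewrite normr_ge0; have [_ ->] := g1 i.
by rewrite [leRHS]big1.
Qed.

Lemma integral_tensor d (g : 'I_d -> mR -> R) : (forall i, bounded_by (g i) 1) ->
  \int[volume L d]_x tensor g x = \prod_i \int[side]_t g i t.
Proof.
elim: d g => [|d IH] g g1.
  rewrite big_ord0 (@I_eq _ _ _ _ _ (fun=> 1)); last by move=> x; rewrite /tensor big_ord0.
  by rewrite Rintegral_cst// mul1r /= /dirac indicT.
pose g' i := g (lift ord0 i).
have bg' : bounded_by (tensor g') 1 by apply: bounded_tensor => i; exact: g1.
rewrite big_ord_recl -(IH g')//; last by move=> i; exact: g1.
rewrite -I_prod; [|exact: L1_bounded (g1 ord0)|exact: L1_bounded bg'].
have tE (z : mR * pt R d) : tensor g (cons_pt z) = g ord0 z.1 * tensor g' z.2.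
  rewrite /tensor big_ord_recl; congr (_ * _).
  by apply: eq_bigr => i _; rewrite tnthS.
congr fine.
have Lp := L1_prod (L1_bounded side (g1 ord0)) (L1_bounded (volume L d) bg').
transitivity (\int[(side \x volume L d)%E]_z (EFin \o tensor g) (cons_pt z))%E.
  apply: (@integral_pushforward _ _ _ _ _ (@cons_pt R d) (@measurable_cons_pt R d)
    (side \x volume L d)%E setT (EFin \o tensor g)) => //.
    by apply/measurable_EFinP; have [] := bounded_tensor g1.
  rewrite preimage_setT; apply: eq_integrable Lp => // z _ /=.
  by rewrite tE.
by apply: eq_integral => z _ /=; rewrite tE.
Qed.

End product_functions.

Section trigonometric_modes.
Variables (R : realType) (L : R).
Hypothesis L0 : 0 < L.
Local Notation side := (side_measure L).
Local Notation mR := (measurableTypeR R).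

Definition trig (s : bool) (k : nat) : mR -> R :=
  fun t => if s then sin (zangle L k t) else cos (zangle L k t).

(** The square of the L2 norm. *)
Definition trig_norm (s : bool) (k : nat) : R :=
  if k == 0%N then (if s then 0 else L) else L / 2.

Lemma bounded_trig s k : bounded_by (trig s k) 1.
Proof. by case: s; [exact: bounded_sin_zangle|exact: bounded_cos_zangle]. Qed.

Lemma zangleD a b t : zangle L (a + b) t = zangle L a t + zangle L b t :> R.
Proof. by rewrite /zangle intrD; ring. Qed.

Lemma zangleB a b t : zangle L (a - b) t = zangle L a t - zangle L b t :> R.
Proof. by rewrite /zangle intrB; ring. Qed.

Lemma integral_trigM s k s' k' : \int[side]_t (trig s k t * trig s' k' t) =
  if (s == s') && (k == k') then trig_norm s k else 0.
Proof.
have Lc z : L1 side (fun t : mR => cos (zangle L z t)).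
  exact: L1_bounded (bounded_cos_zangle _ z).
have Ls z : L1 side (fun t : mR => sin (zangle L z t)).
  exact: L1_bounded (bounded_sin_zangle _ z).
pose a : int := k; pose b : int := k'.
have abD : (a + b == 0) = (k == 0%N) && (k' == 0%N).
  by rewrite /a /b -PoszD eqz_nat addn_eq0.
have abB : (a - b == 0) = (k == k') by rewrite subr_eq0 eqz_nat.
have ZZ f g x y : L1 side f -> L1 side g ->
    \int[side]_t (x * f t + y * g t) = x * \int[side]_t f t + y * \int[side]_t g t.
  by move=> Lf Lg; rewrite ID ?IZ//; exact: L1Z.
case: s; case: s'; rewrite /trig ?eqxx ?[_ == _ :> bool]/= ?andFb ?andTb.
- rewrite (@I_eq _ _ _ _ _ (fun t : mR => 2^-1 * cos (zangle L (a - b) t) +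
      - 2^-1 * cos (zangle L (a + b) t))); last first.
    by move=> t; rewrite zangleB zangleD cosB cosD; field.
  rewrite ZZ// !integral_cos_zangle// abD abB /trig_norm.
  case: eqVneq => [<-|kk']; first by rewrite andbb; case: ifP => _; field.
  case: ifP => [/andP[/eqP k0 /eqP k'0]|_]; last by rewrite !mulr0 addr0.
  by move: kk'; rewrite k0 k'0 eqxx.
- rewrite (@I_eq _ _ _ _ _ (fun t : mR => 2^-1 * sin (zangle L (a + b) t) +
      2^-1 * sin (zangle L (a - b) t))); last first.
    by move=> t; rewrite zangleB zangleD sinB sinD; field.
  by rewrite ZZ// !integral_sin_zangle// mulr0 addr0.
- rewrite (@I_eq _ _ _ _ _ (fun t : mR => 2^-1 * sin (zangle L (a + b) t) +
      - 2^-1 * sin (zangle L (a - b) t))); last first.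
    by move=> t; rewrite zangleB zangleD sinB sinD; field.
  by rewrite ZZ// !integral_sin_zangle// !mulr0 addr0.
- rewrite (@I_eq _ _ _ _ _ (fun t : mR => 2^-1 * cos (zangle L (a - b) t) +
      2^-1 * cos (zangle L (a + b) t))); last first.
    by move=> t; rewrite zangleB zangleD cosB cosD; field.
  rewrite ZZ// !integral_cos_zangle// abD abB /trig_norm.
  case: eqVneq => [<-|kk']; first by rewrite andbb; case: ifP => _; field.
  case: ifP => [/andP[/eqP k0 /eqP k'0]|_]; last by rewrite !mulr0 addr0.
  by move: kk'; rewrite k0 k'0 eqxx.
Qed.

Variable d : nat.
Local Notation vol := (volume L d).
Implicit Types (k l : 'I_d -> nat) (s t : 'I_d -> bool).

Definition mode k s : pt R d -> R := tensor (fun i => trig (s i) (k i)).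

Definition mode_norm k s : R := \prod_i trig_norm (s i) (k i).

Lemma bounded_mode k s : bounded_by (mode k s) 1.
Proof. by apply: bounded_tensor => i; exact: bounded_trig. Qed.

Lemma integral_modeM k s l t : \int[vol]_x (mode k s x * mode l t x) =
  if [forall i, (s i == t i) && (k i == l i)] then mode_norm k s else 0.
Proof.
pose g i (u : mR) := trig (s i) (k i) u * trig (t i) (l i) u.
have gb i : bounded_by (g i) 1.
  have [m1 b1] := bounded_trig (s i) (k i); have [m2 b2] := bounded_trig (t i) (l i).
  by split=> [|u]; [exact: measurable_funM|rewrite normrM mulr_ile1].
rewrite (@I_eq _ _ _ _ _ (tensor g)); last first.
  by move=> x; rewrite /mode /tensor -big_split.
rewrite integral_tensor//; under eq_bigr do rewrite integral_trigM//.
case: forallP => [H|/forallP]; first by apply: eq_bigr => i _; rewrite H.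
by rewrite negb_forall => /existsP[i /negbTE ni]; rewrite (bigD1 i)//= ni mul0r.
Qed.

Lemma mode_normE k s : (forall i, s i -> k i != 0%N) ->
  mode_norm k s = mode_norm k (fun=> false).
Proof.
move=> sk; apply: eq_bigr => i _; rewrite /trig_norm; case: ifPn => // ki.
by case: ifPn => // /sk; rewrite ki.
Qed.

Lemma mode_norm_gt0 k : 0 < mode_norm k (fun=> false).
Proof. by apply: prodr_gt0 => i _; rewrite /trig_norm; case: ifP => // _; rewrite divr_gt0. Qed.

Lemma mode_eq0 k s : ~~ [forall i, s i ==> (k i != 0%N)] -> mode k s = fun=> 0.
Proof.
rewrite negb_forall => /existsP[i]; rewrite negb_imply negbK => /andP[si /eqP ki].
apply/funext => x; rewrite /mode /tensor (bigD1 i)//= /trig si ki.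
by rewrite /zangle mulr0 !mul0r sin0 mul0r.
Qed.

Lemma mode0 : mode (fun=> 0%N) (fun=> false) = fun=> 1.
Proof.
apply/funext => x; rewrite /mode /tensor big1// => i _.
by rewrite /trig /zangle mulr0 !mul0r cos0.
Qed.

(** The addition formula for the cosine, expanded over the coordinates. *)
Lemma mode_kernel k (x y : pt R d) :
  \prod_i cos (zangle L (k i) (tnth x i - tnth y i)) =
  \sum_(s : {ffun 'I_d -> bool}) mode k s x * mode k s y.
Proof.
transitivity (\prod_i \sum_(b : bool) trig b (k i) (tnth x i) * trig b (k i) (tnth y i)).
  apply: eq_bigr => i _; rewrite big_bool/= /trig.
  have -> : zangle L (k i) (tnth x i - tnth y i) =
      zangle L (k i) (tnth x i) - zangle L (k i) (tnth y i).
    by rewrite /zangle; ring.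
  by rewrite cosB addrC.
by rewrite bigA_distr_bigA/=; apply: eq_bigr => s _; rewrite big_split.
Qed.

Lemma volume_mass : fine (vol setT) = L ^+ d.
Proof.
rewrite -[LHS]mul1r -(Rintegral_cst vol measurableT).
have -> : (fun=> 1) = tensor (fun (i : 'I_d) (_ : mR) => 1 : R) :> (pt R d -> R).
  by apply/funext => x; rewrite /tensor big1.
rewrite integral_tensor; last by move=> i; split => // t; rewrite normr1.
under eq_bigr do rewrite Rintegral_cst// side_mass// mul1r.
by rewrite prodr_const card_ord.
Qed.

End trigonometric_modes.

(** * The interaction kernel *)

Lemma measurable_of_uniform_approx d (T : measurableType d) (R : realType)
    (f : T -> R) : (forall e, 0 < e -> exists2 g : T -> R, measurable_fun setT g &
      forall x, `|f x - g x| <= e) -> measurable_fun setT f.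
Proof.
move=> H.
have /choice[g Hg] : forall n : nat, exists g : T -> R, measurable_fun setT g /\
    forall x, `|f x - g x| <= n.+1%:R^-1.
  by move=> n; have [|g mg gn] := H n.+1%:R^-1; [rewrite invr_gt0|exists g].
apply: (@measurable_fun_cvg _ _ _ _ g) => [n|x _]; first by have [] := Hg n.
apply/cvgrPdist_le => e e0; near=> n.
have [_ /(_ x)] := Hg n; move/le_trans; apply; apply: ltW.
near: n; exact: (near_infty_natSinv_lt (PosNum e0)).
Unshelve. all: by end_near. Qed.

Section torus_kernel.
Variables (R : realType) (d : nat) (L : R) (W : 'rV[R]_d -> R).
Hypotheses (L0 : 0 < L) (Wper : torus_periodic L W) (Weven : even_coordinates W)
  (Wcont : continuous W) (Wmean : mean_zero L W).
Local Notation vol := (volume L d).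
Local Notation V := (fine (volume L d setT)).
Local Notation I f := (\int[volume L d]_x f x).
Local Notation mode := (@mode R L d).
Local Notation K n := {ffun 'I_d -> 'I_n.+1}.
Local Notation J n := ({ffun 'I_d -> 'I_n.+1} * {ffun 'I_d -> bool})%type.

Definition kernel (z : pt R d * pt R d) : R := W (vec z.1 - vec z.2).

(** The frequencies are bounded by [n] in each coordinate; the booleans select the
    coordinates that carry a sine. *)
Definition torus_mode n (j : J n) : pt R d -> R := mode (fun i => j.1 i) (fun i => j.2 i).

Definition torus_mode_norm n (j : J n) : R := mode_norm L (fun i => j.1 i) (fun i => j.2 i).

Definition trig_poly n (p : K n -> R) (x : pt R d) :=
  \sum_k p k * mode (fun i => k i) (fun=> false) x.

Lemma mass_gt0 : 0 < V.
Proof. by rewrite volume_mass// exprn_gt0. Qed.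

Lemma bounded_torus_mode n (j : J n) : bounded_by (torus_mode j) 1.
Proof. exact: bounded_mode. Qed.

Lemma torus_mode_orthogonal n (i j : J n) :
  I (fun x => torus_mode i x * torus_mode j x) = if i == j then torus_mode_norm i else 0.
Proof.
rewrite integral_modeM//; congr (if _ then _ else _).
apply/forallP/eqP => [H|-> i']; last by rewrite !eqxx.
case: i j H => [k s] [l t] /= H; congr pair; apply/ffunP => i.
  by have /andP[_ /eqP /val_inj] := H i.
by have /andP[/eqP] := H i.
Qed.

Lemma torus_mode_norm_gt0P n (j : J n) : 0 < torus_mode_norm j ->
  torus_mode_norm j = mode_norm L (fun i => j.1 i) (fun=> false).
Proof.
move=> n0; apply: mode_normE => i si; apply/negP => /eqP ki; move: n0.
by rewrite /torus_mode_norm /mode_norm (bigD1 i)//= si /trig_norm ki mul0r ltxx.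
Qed.

Lemma torus_mode_eq0 n (j : J n) : ~~ (0 < torus_mode_norm j) -> torus_mode j = fun=> 0.
Proof.
move=> nj; apply: mode_eq0; apply: contra nj => /forallP H.
rewrite /torus_mode_norm mode_normE ?mode_norm_gt0// => i si.
by have := H i; rewrite si.
Qed.

(** By the addition formula one trigonometric approximation of [W] is at the same
    time a finite-rank approximation of the kernel, diagonal in the modes. *)
Lemma kernel_approximation e N : 0 < e -> exists2 n, (N <= n)%N &
  exists p : K n -> R, (forall x, `|W (vec x) - trig_poly p x| <= e) /\
    forall z, `|kernel z - finite_rank_kernel (fun j : J n => p j.1) (@torus_mode n) z| <= e.
Proof.
move=> e0; have [n Nn [p Hp]] := trig_approximation L0 Wper Weven Wcont N e0.
exists n => //; exists p; split=> [x|z].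
  have := Hp (vec x); congr (`|_ - _| <= _); apply: eq_bigr => k _.
  by congr (_ * _); apply: eq_bigr => i _; rewrite mxE.
have := Hp (vec z.1 - vec z.2); congr (`|_ - _| <= _).
rewrite /finite_rank_kernel.
rewrite -(pair_big xpredT xpredT (fun k s => p k * (torus_mode (k, s) z.1 * torus_mode (k, s) z.2)))/=.
apply: eq_bigr => k _; rewrite -mulr_sumr; congr (_ * _).
rewrite -(mode_kernel L (fun i => k i) z.1 z.2).
by apply: eq_bigr => i _; rewrite !mxE.
Qed.

Lemma trig_poly_bounded n (p : K n -> R) : bounded_by (trig_poly p) (\sum_k `|p k|).
Proof.
split.
  apply: measurable_sum => k; apply: measurable_funM => //.
  by case: (bounded_mode L (fun i => k i) (fun=> false)).
move=> x; apply: le_trans (ler_norm_sum _ _ _) _; apply: ler_sum => k _.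
by rewrite normrM ler_piMr//; have [_] := bounded_mode L (fun i => k i) (fun=> false); apply.
Qed.

Lemma W_vec_bounded : exists B, bounded_by (W \o @vec R d) B.
Proof.
have [B HB] := W_bounded L0 Wper Weven Wcont; exists B; split; last by move=> x; exact: HB.
apply: measurable_of_uniform_approx => e e0.
have [n _ [p [H _]]] := kernel_approximation 0 e0.
by exists (trig_poly p) => //; case: (trig_poly_bounded p).
Qed.

Lemma kernel_bounded : exists B, bounded_by kernel B.
Proof.
have [B HB] := W_bounded L0 Wper Weven Wcont; exists B; split; last by move=> x; exact: HB.
apply: measurable_of_uniform_approx => e e0.
have [n _ [p [_ H]]] := kernel_approximation 0 e0.
exists (finite_rank_kernel (fun j : J n => p j.1) (@torus_mode n)) => //.
by case: (finite_rank_bounded (fun j : J n => p j.1) (@bounded_torus_mode n)).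
Qed.

Lemma kernel_finite_rank : finite_rank_approx kernel.
Proof.
move=> e e0; have [n _ [p [_ H]]] := kernel_approximation 0 e0.
exists (J n), (fun j => p j.1), (@torus_mode n); split => //; exact: bounded_torus_mode.
Qed.

(** Up to normalisation, the Fourier coefficients of [W]; those of cosine products
    are the eigenvalues of the interaction operator. *)
Definition moment k s : R := I (fun x => W (vec x) * mode k s x).

Lemma moment_approx n (p : K n -> R) e k s :
  (forall x, `|W (vec x) - trig_poly p x| <= e) ->
  `|moment k s - \sum_l p l * I (fun x => mode (fun i => l i) (fun=> false) x * mode k s x)|
    <= e * V.
Proof.
move=> H; have [B WB] := W_vec_bounded.
have Lm k' s' : L1 vol (mode k' s') by exact: L1_bounded (bounded_mode _ _ _).
have LW : L1 vol (fun x => W (vec x) * mode k s x).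
  exact: (L1M (L1_bounded vol WB) (bounded_mode L k s)).
have Lp : L1 vol (fun x => trig_poly p x * mode k s x).
  exact: (L1M (L1_bounded vol (trig_poly_bounded p)) (bounded_mode L k s)).
have Lpp l : L1 vol (fun x => mode (fun i => l i) (fun=> false) x * mode k s x).
  exact: (L1M (Lm _ _) (bounded_mode L k s)).
have <- : I (fun x => trig_poly p x * mode k s x) =
    \sum_l p l * I (fun x => mode (fun i => l i) (fun=> false) x * mode k s x).
  under [RHS]eq_bigr do rewrite -IZ//.
  rewrite -I_sum; last by move=> l; exact: L1Z.
  apply: I_eq => x; rewrite /trig_poly mulr_suml.
  by apply: eq_bigr => l _; rewrite mulrA.
rewrite /moment -IB//; apply: le_trans (I_norm (L1B LW Lp)) _.
rewrite -(Rintegral_cst vol measurableT).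
apply: I_le; [exact: (L1_norm (L1B LW Lp))|exact: L1_cst|].
move=> x; rewrite -mulrBl normrM -[leRHS]mulr1 ler_pM//.
by have [_] := bounded_mode L k s; apply.
Qed.

(** Orthogonality isolates one coefficient of the approximation. *)
Lemma moment_mode n (p : K n -> R) e (k : K n) :
  (forall x, `|W (vec x) - trig_poly p x| <= e) ->
  `|moment (fun i => k i) (fun=> false) -
     p k * mode_norm L (fun i => k i) (fun=> false)| <= e * V.
Proof.
move=> /moment_approx => /(_ (fun i => k i) (fun=> false)).
rewrite (bigD1 k)//= integral_modeM//.
rewrite ifT; last by apply/forallP => i; rewrite !eqxx.
rewrite big1 ?addr0// => l lk; rewrite integral_modeM// ifF ?mulr0//.
apply: contraNF lk => /forallP H; apply/eqP/ffunP => i.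
by have /andP[_ /eqP/val_inj] := H i.
Qed.

(** Approximations of [W] contain cosines only. *)
Lemma moment_sin (k : 'I_d -> nat) (s : 'I_d -> bool) i : s i -> moment k s = 0.
Proof.
move=> si; apply/eqP; rewrite -normr_le0; apply/ler_addgt0Pr => e e0; rewrite add0r.
have eV0 : 0 < e / V by rewrite divr_gt0// mass_gt0.
have [n _ [p [H _]]] := kernel_approximation 0 eV0.
have := moment_approx k s H; rewrite divfK ?gt_eqF ?mass_gt0//.
rewrite big1 ?subr0// => l _; rewrite integral_modeM// ifF ?mulr0//.
by apply/negP => /forallP/(_ i); rewrite si.
Qed.

Lemma moment0 : moment (fun=> 0%N) (fun=> false) = 0.
Proof.
by rewrite /moment mode0 -[RHS]Wmean; apply: I_eq => x; rewrite mulr1.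
Qed.

Lemma mode_norm0 : mode_norm L (fun _ : 'I_d => 0%N) (fun=> false) = V.
Proof. by rewrite volume_mass// /mode_norm /trig_norm/= prodr_const card_ord. Qed.

Definition zero_index n : J n := ([ffun=> ord0], [ffun=> false]).

Lemma torus_mode_zero n : @torus_mode n (zero_index n) = fun=> 1.
Proof.
apply/funext => x; rewrite /torus_mode /mode /tensor big1// => i _.
by rewrite /= !ffunE /trig /zangle mulr0 !mul0r cos0.
Qed.

Lemma integral_torus_mode n (j : J n) : j != zero_index n -> I (torus_mode j) = 0.
Proof.
move=> j0; have := torus_mode_orthogonal j (zero_index n); rewrite (negbTE j0) torus_mode_zero => <-.
by apply: I_eq => x; rewrite mulr1.
Qed.

Lemma coef_zero_small n (p : K n -> R) e :
  (forall x, `|W (vec x) - trig_poly p x| <= e) -> `|p [ffun=> ord0] * V| <= e * V.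
Proof.
move=> /moment_mode => /(_ [ffun=> ord0]).
have -> : (fun i : 'I_d => nat_of_ord (([ffun=> ord0] : K n) i)) = fun=> 0%N.
  by apply/funext => i; rewrite ffunE.
by rewrite moment0 mode_norm0 sub0r normrN.
Qed.

(** Against a constant the approximating kernel leaves the constant mode only, with
    a small coefficient because [W] has mean zero. *)
Lemma kernel_annihilates_constants : annihilates_constants vol kernel.
Proof.
move=> f Lf; have [B KB] := kernel_bounded.
have L1c : L1 vol (fun=> 1) by exact: L1_cst.
have N1 : I (fun=> `|1|) = V by rewrite normr1 Rintegral_cst// mul1r.
pose Nf := I (fun x => `|f x|).
have Nf0 : 0 <= Nf by exact: I_ge0.
have fm n j : `|I (fun x => f x * @torus_mode n j x)| <= Nf.
  have Lfp := L1M Lf (bounded_torus_mode j).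
  apply: le_trans (I_norm Lfp) _; apply: I_le; [exact: L1_norm|exact: L1_norm|].
  by move=> x; rewrite normrM ler_piMr//; have [_] := bounded_torus_mode j; apply.
have mom1 n j : I (fun x => 1 * @torus_mode n j x) = if j == zero_index n then V else 0.
  case: eqVneq => [->|j0].
    rewrite (@I_eq _ _ _ _ _ (fun=> 1)); first by rewrite Rintegral_cst// mul1r.
    by move=> x; rewrite torus_mode_zero mulr1.
  rewrite -[RHS](integral_torus_mode j0); apply: I_eq => x; exact: mul1r.
have small (x : R) : (forall e, 0 < e -> `|x| <= e * (2 * V * Nf)) -> x = 0.
  move=> H; apply/eqP; rewrite -normr_le0; apply/ler_addgt0Pr => e e0; rewrite add0r.
  have c0 : 0 < 2 * V * Nf + 1.
    by rewrite ltr_wpDl// mulr_ge0// mulr_ge0// ltW// mass_gt0.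
  apply: le_trans (H (e / (2 * V * Nf + 1)) _) _; first exact: divr_gt0.
  by rewrite mulrAC ler_pdivrMr// ler_pM2l// lerDl.
have bound n (p : K n -> R) (e a b : R) : (forall x, `|W (vec x) - trig_poly p x| <= e) ->
   `|a - b| <= e * (Nf * V) -> b = p [ffun=> ord0] * (I (fun x => f x * @torus_mode n (zero_index n) x) * V) ->
   `|a| <= e * (2 * V * Nf).
  move=> H ab bE; have := coef_zero_small H.
  have hb : `|b| <= e * V * Nf.
    rewrite bE mulrA mulrAC normrM ler_pM//; exact: coef_zero_small H.
  move=> _; rewrite -[a](subrK b); apply: le_trans (ler_normD _ _) _.
  by apply: le_trans (lerD ab hb) _; rewrite le_eqVlt; apply/orP; left; apply/eqP; ring.
split; apply: small => e e0; have [n _ [p [H Hk]]] := kernel_approximation 0 e0.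
- have := bil_close KB (finite_rank_bounded _ (@bounded_torus_mode n)) Hk Lf L1c.
  rewrite N1 bil_finite_rank//; last exact: bounded_torus_mode.
  move/bound; apply; first exact: H.
  rewrite (bigD1 (zero_index n))//= mom1 eqxx big1 ?addr0// => j j0.
  by rewrite mom1 (negbTE j0) !mulr0.
- have := bil_close KB (finite_rank_bounded _ (@bounded_torus_mode n)) Hk L1c Lf.
  rewrite N1 bil_finite_rank//; last exact: bounded_torus_mode.
  rewrite -/Nf (mulrC V Nf).
  move/bound; apply; first exact: H.
  rewrite (bigD1 (zero_index n))//= mom1 eqxx big1 ?addr0 1?[V * _]mulrC// => j j0.
  by rewrite mom1 (negbTE j0) mul0r mulr0.
Qed.

(** In the approximating form each mode is multiplied by almost its moment, hence
    by at least [lam] up to a small error; as [lam <= 0], Bessel's inequality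
    bounds the sum. *)
Lemma kernel_lower_bound (lam : R) : lam <= 0 ->
  (forall k i, k i != 0%N -> lam <= moment k (fun=> false)) ->
  spectral_lower_bound vol kernel lam.
Proof.
move=> lam0 lamP h C hC Ih; have [B KB] := kernel_bounded.
have Lh := L1_bounded vol hC.
pose q := I (fun x => h x ^+ 2); pose Nh := I (fun x => `|h x|).
have q0 : 0 <= q by apply: I_ge0 => x; exact: sqr_ge0.
apply/ler_addgt0Pr => e e0.
have c0 : 0 < V * q + Nh * Nh + 1.
  by rewrite ltr_wpDl// addr_ge0// mulr_ge0//; [rewrite ltW// mass_gt0|exact: I_ge0..].
have e'0 : 0 < e / (V * q + Nh * Nh + 1) by exact: divr_gt0.
set e' := e / _ in e'0.
have [n _ [p [H Hk]]] := kernel_approximation 0 e'0.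
have := bil_close KB (finite_rank_bounded _ (@bounded_torus_mode n)) Hk Lh Lh.
rewrite bil_finite_rank//; last exact: bounded_torus_mode.
pose mom (j : J n) := I (fun x => h x * torus_mode j x).
rewrite -/Nh ler_distl => /andP[close _].
have lower : (lam - e' * V) * q <= \sum_(j : J n) p j.1 * (mom j * mom j).
  have neg : lam - e' * V <= 0.
    by rewrite lerBlDr add0r (le_trans lam0)// mulr_ge0 ?ltW// mass_gt0.
  apply: le_trans (ler_wnM2l neg (bessel (@bounded_torus_mode n) (@torus_mode_orthogonal n) hC)) _.
  rewrite mulr_sumr big_mkcond/=; apply: ler_sum => j _.
  case: ifPn => [n0|/torus_mode_eq0 pz]; last first.
    rewrite /mom (@I_eq _ _ _ _ _ (fun=> 0)) ?Rintegral_cst ?mul0r ?mulr0//.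
    by move=> x; rewrite pz mulr0.
  have [->|j0] := eqVneq j (zero_index n).
    rewrite /mom (@I_eq _ _ _ _ _ h) ?Ih; last by move=> x; rewrite torus_mode_zero mulr1.
    by rewrite expr0n/= mul0r !mulr0.
  have k0 : exists i, (j.1 i : nat) != 0%N.
    apply: contrapT => /forallNP k0; case/eqP: j0; case: j n0 k0 => k s n0 k0.
    have kz i : k i = ord0 by apply/val_inj/eqP/negPn/negP => /=; exact: k0.
    congr pair; apply/ffunP => i; rewrite ffunE//.
    have := n0; rewrite /torus_mode_norm /mode_norm (bigD1 i)//= /trig_norm kz/=.
    by case: (s i) => //; rewrite mul0r ltxx.
  have [i ki] := k0.
  have mk : lam - e' * V <= p j.1 * torus_mode_norm j.
    rewrite torus_mode_norm_gt0P//; have := moment_mode j.1 H.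
    have := lamP (fun i => j.1 i) i ki.
    rewrite ler_distl => h1 /andP[_ h2]; lra.
  have := ler_wpM2r (divr_ge0 (sqr_ge0 (mom j)) (ltW n0)) mk.
  have -> : p j.1 * torus_mode_norm j * (mom j ^+ 2 / torus_mode_norm j) = p j.1 * (mom j * mom j).
    by field; rewrite gt_eqF.
  by [].
have : e' * (V * q + Nh * Nh) <= e.
  rewrite /e' mulrAC ler_pdivrMr// ler_pM2l// lerDl//.
move: close lower; rewrite -/q; lra.
Qed.

(** Approximations by polynomials of high degree contain the mode itself. *)
Lemma energy_mode (k : 'I_d -> nat) :
  bil vol kernel (mode k (fun=> false)) (mode k (fun=> false)) =
  mode_norm L k (fun=> false) * moment k (fun=> false).
Proof.
have [B KB] := kernel_bounded; have Lm : L1 vol (mode k (fun=> false)).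
  exact: L1_bounded (bounded_mode L k _).
set E := bil _ _ _ _; set nk := mode_norm L k _.
have nk0 : 0 < nk by exact: mode_norm_gt0.
apply/eqP; rewrite -subr_eq0 -normr_le0; apply/ler_addgt0Pr => e e0; rewrite add0r.
pose Nm := I (fun x => `|mode k (fun=> false) x|).
have Nm0 : 0 <= Nm by exact: I_ge0.
have c0 : 0 < Nm * Nm + nk * V + 1.
  by rewrite ltr_wpDl// addr_ge0// mulr_ge0// ltW// mass_gt0.
have e'0 : 0 < e / (Nm * Nm + nk * V + 1) by exact: divr_gt0.
set e' := e / _ in e'0.
have [n kn [p [H Hk]]] := kernel_approximation (\max_i k i) e'0.
have ki i : (k i < n.+1)%N by rewrite ltnS (leq_trans _ kn)// leq_bigmax.
pose k' : K n := [ffun i => Ordinal (ki i)].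
have k'E : (fun i => nat_of_ord (k' i)) = k by apply/funext => i; rewrite ffunE.
pose j0 : J n := (k', [ffun=> false]).
have modej0 : torus_mode j0 = mode k (fun=> false).
  by rewrite /torus_mode /= k'E; congr mode; apply/funext => i; rewrite ffunE.
have nuj0 : torus_mode_norm j0 = nk.
  by rewrite /torus_mode_norm /= k'E; congr mode_norm; apply/funext => i; rewrite ffunE.
have := bil_close KB (finite_rank_bounded _ (@bounded_torus_mode n)) Hk Lm Lm.
rewrite bil_finite_rank//; last exact: bounded_torus_mode.
rewrite -/Nm -/E (bigD1 j0)//= -modej0 torus_mode_orthogonal eqxx nuj0 big1 ?addr0; last first.
  by move=> j jj; rewrite torus_mode_orthogonal eq_sym (negbTE jj) !mulr0.
have := moment_mode k' H; rewrite k'E -/nk => mm close.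
have -> : E - nk * moment k (fun=> false) = (E - p k' * (nk * nk)) -
    nk * (moment k (fun=> false) - p k' * nk) by ring.
apply: le_trans (ler_normB _ _) _; rewrite normrM (gtr0_norm nk0).
apply: le_trans (lerD close (ler_wpM2l (ltW nk0) mm)) _.
have -> : e' * (Nm * Nm) + nk * (e' * V) = e' * (Nm * Nm + nk * V) by ring.
by rewrite /e' mulrAC ler_pdivrMr// ler_pM2l// lerDl.
Qed.

Lemma kernel_bound_approached (lam : R) :
  (forall l, lam < l -> exists k, (exists i, k i != 0%N) /\ moment k (fun=> false) <= l) ->
  spectral_bound_approached vol kernel lam.
Proof.
move=> H l ll; have [k [[i ki] kl]] := H l ll.
exists (mode k (fun=> false)), 1; have qE : I (fun x => mode k (fun=> false) x ^+ 2) = mode_norm L k (fun=> false).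
  rewrite (@I_eq _ _ _ _ _ (fun x => mode k (fun=> false) x * mode k (fun=> false) x)); last by move=> x; rewrite expr2.
  by rewrite integral_modeM// ifT//; apply/forallP => i'; rewrite !eqxx.
split.
- exact: bounded_mode.
- have := integral_modeM L0 k (fun=> false) (fun=> 0%N) (fun=> false).
  rewrite ifF; last by apply/negP => /forallP/(_ i); rewrite (negbTE ki).
  by rewrite mode0 => <-; apply: I_eq => x; rewrite mulr1.
- by rewrite qE mode_norm_gt0.
- by rewrite qE energy_mode mulrC ler_pM2r// mode_norm_gt0.
Qed.

End torus_kernel.

(** * Measures and densities *)

Section measures_with_density.
Context d (T : measurableType d) (R : realType).
Variable mu : {finite_measure set T -> \bar R}.

Record probability_density := ProbabilityDensity {
  pdf :> T -> R;
  pdf_ge0 : forall x, 0 <= pdf x;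
  pdf_L1 : L1 mu pdf;
  pdf_mass : \int[mu]_x pdf x = 1 }.

Section construction.
Variable f : probability_density.
Local Open Scope ereal_scope.

Definition pdf_measure (A : set T) : \bar R := \int[mu]_(x in A) (f x)%:E.

Let pdf_measure0 : pdf_measure set0 = 0.
Proof. by rewrite /pdf_measure integral_set0. Qed.

Let pdf_measure_ge0 A : 0 <= pdf_measure A.
Proof. by apply: integral_ge0 => x _; rewrite lee_fin pdf_ge0. Qed.

Let pdf_measure_sigma_additive : semi_sigma_additive pdf_measure.
Proof.
move=> /= A mA tA mUA; rewrite /pdf_measure/= integral_bigcup//=; last first.
  by apply: (integrableS _ _ (subsetT _)) => //; exact: pdf_L1.
apply: is_cvg_ereal_nneg_natsum_cond => n _ _; exact: pdf_measure_ge0.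
Qed.

HB.instance Definition _ := isMeasure.Build _ _ _ pdf_measure
  pdf_measure0 pdf_measure_ge0 pdf_measure_sigma_additive.

Let pdf_measure_setT : pdf_measure [set: _] = 1.
Proof. by rewrite /pdf_measure -I_EFin ?pdf_mass//; exact: pdf_L1. Qed.

HB.instance Definition _ :=
  @Measure_isProbability.Build _ _ R pdf_measure pdf_measure_setT.

End construction.

Definition pdf_probability (f : probability_density) : probability T R :=
  pdf_measure f.

Definition real_density (P : probability T R) (x : T) : R :=
  fine (Radon_Nikodym_SigmaFinite.f P mu x).

Section real_density.
Variable P : probability T R.
Hypothesis Pmu : P `<< mu.

Lemma real_densityE x :
  (real_density P x)%:E = Radon_Nikodym_SigmaFinite.f P mu x.
Proof. by rewrite fineK// Radon_Nikodym_SigmaFinite.f_fin_num. Qed.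

Lemma real_density_ge0 x : 0 <= real_density P x.
Proof. by apply: fine_ge0; exact: Radon_Nikodym_SigmaFinite.f_ge0. Qed.

Lemma real_density_L1 : L1 mu (real_density P).
Proof.
have := Radon_Nikodym_SigmaFinite.f_integrable Pmu.
by apply: eq_integrable => // x _; rewrite -real_densityE.
Qed.

Lemma real_density_integral A : measurable A ->
  P A = (\int[mu]_(x in A) (real_density P x)%:E)%E.
Proof.
move=> mA; rewrite (Radon_Nikodym_SigmaFinite.f_integral Pmu mA).
by apply: eq_integral => x _; rewrite -real_densityE.
Qed.

Lemma real_density_mass : \int[mu]_x real_density P x = 1.
Proof.
by rewrite /Rintegral -real_density_integral// probability_setT.
Qed.

Lemma real_density_unique (f : T -> R) : L1 mu f ->
  (forall A, measurable A -> P A = (\int[mu]_(x in A) (f x)%:E)%E) ->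
  {ae mu, forall x, real_density P x = f x}.
Proof.
move=> Lf H.
have := @integral_ae_eq _ _ _ mu setT measurableT (EFin \o f) (EFin \o real_density P)
  real_density_L1 (measurable_int mu Lf).
have h E : E `<=` setT -> measurable E ->
    (\int[mu]_(x in E) (EFin \o real_density P) x = \int[mu]_(x in E) (EFin \o f) x)%E.
  by move=> _ mE; rewrite -H// -real_density_integral.
by move=> /(_ h); apply: filterS => x /(_ Logic.I) [].
Qed.

End real_density.

Lemma pdf_probability_dominated f : pdf_probability f `<< mu.
Proof.
move=> N N0 A mA AN; rewrite /=/pdf_measure; apply: null_set_integral => //.
  by apply: measurable_funTS; exact: (measurable_int mu (pdf_L1 f)).
exact: N0.
Qed.

Lemma real_density_pdf f : {ae mu, forall x, real_density (pdf_probability f) x = f x}.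
Proof.
by apply: real_density_unique => //; [exact: pdf_probability_dominated|exact: pdf_L1].
Qed.

Lemma eq_probability_density (P Q : probability T R) : P `<< mu -> Q `<< mu ->
  (forall A, measurable A -> P A = Q A) <->
  {ae mu, forall x, real_density P x = real_density Q x}.
Proof.
move=> Pmu Qmu; split=> [PQ|PQ A mA].
  apply: real_density_unique => // [|A mA]; first exact: real_density_L1.
  by rewrite PQ// real_density_integral.
rewrite !real_density_integral//; apply: ae_eq_integral => //.
- apply: measurable_funTS; exact: (measurable_int mu (real_density_L1 Pmu)).
- apply: measurable_funTS; exact: (measurable_int mu (real_density_L1 Qmu)).
- by apply: filterS PQ => x + _ => ->.
Qed.

End measures_with_density.

Section torus_measures.
Variables (R : realType) (d : nat) (L : R).
Hypothesis L0 : 0 < L.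
Local Notation vol := (volume L d).
Local Notation V := (fine (volume L d setT)).

Lemma measurable_cell : measurable (cell L (d := d)).
Proof.
rewrite (_ : cell L (d := d) = \bigcap_(i in [set: 'I_d])
    ((fun x : pt R d => tnth x i) @^-1` `[0, L[%classic)).
  apply: fin_bigcap_measurable => // i _; rewrite -[X in measurable X]setTI.
  by apply: measurable_tnth => //; exact: measurable_itv.
apply/seteqP; split=> x cx i; first by move=> _; rewrite /= in_itv; exact: cx.
by have := cx i Logic.I; rewrite /= in_itv.
Qed.

(** The indicator function of the cell is a product of indicator functions. *)
Lemma volume_cell : vol (cell L (d := d)) = vol setT.
Proof.
pose g (_ : 'I_d) : measurableTypeR R -> R := \1_(`[0, L[%classic).
have mI : @measurable _ (measurableTypeR R) `[0, L[%classic by exact: measurable_itv.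
have g1 i : bounded_by (g i) 1.
  split; first by rewrite /g; exact: measurable_indic.
  by move=> x; rewrite /g indicE; case: (x \in _); rewrite ?normr1 ?normr0.
have cE (x : pt R d) : \1_(cell L (d := d)) x = tensor g x :> R.
  rewrite /tensor /g indicE; have [/set_mem cx|/negP nc] := boolP (x \in _).
    rewrite big1// => i _; rewrite indicE mem_set//=.
    by have := cx i; rewrite in_itv.
  have [i ci] : exists i, ~ (0 <= (tnth x i : R) < L).
    by apply: contrapT => /forallNP H; apply: nc; apply/mem_set => i; apply: contrapT; exact: H.
  rewrite (bigD1 i)//= indicE memNset ?mul0r//=.
rewrite -[LHS]fineK ?fin_num_measure//; last exact: measurable_cell.
rewrite -[RHS]fineK ?fin_num_measure//; congr EFin.
have -> : fine (vol (cell L (d := d))) = \int[vol]_x \1_(cell L (d := d)) x.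
  by rewrite /Rintegral integral_indic ?setIT//; exact: measurable_cell.
rewrite (I_eq _ cE) integral_tensor// volume_mass//.
have -> : L ^+ d = \prod_(i < d) L by rewrite prodr_const card_ord.
apply: eq_bigr => i _; rewrite /Rintegral integral_indic// setIT.
by rewrite /=/mfrestr/mrestr setIid lebesgue_measure_itv/= lte_fin L0 oppr0 addr0.
Qed.

Lemma dominated_on_torus (P : probability (pt R d) R) : P `<< vol -> on_torus L P.
Proof.
move=> Pvol; have mc := measurable_cell.
have v0 : vol (~` cell L (d := d)) = 0%E.
  have e : (vol setT - vol (cell L (d := d)) = 0)%E.
    by rewrite volume_cell subee// fin_num_measure.
  rewrite -setTD measureD//; last by rewrite -ge0_fin_numE ?fin_num_measure.
  by rewrite setTI; exact: e.
have P0 : P (~` cell L (d := d)) = 0%E.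
  have mC : measurable (~` cell L (d := d)) by exact: measurableC.
  exact: (Pvol _ ((measure0_null_setP vol mC).2 v0) _ mC).
rewrite /on_torus -[cell L (d := d)]setCK probability_setC; last exact: measurableC.
by rewrite P0 sube0.
Qed.

Lemma rho_infE : rho_inf d L = V^-1.
Proof. by rewrite /rho_inf volume_mass. Qed.

Lemma uniformE A : uniform d L A = (vol A * (V^-1)%:E)%E.
Proof.
rewrite /=/mnormalize ifF//; apply/negbTE; rewrite negb_or.
have V0 := mass_gt0 d L0.
apply/andP; split.
  by apply/eqP => h; move: V0; rewrite h ltxx.
by apply/eqP => h; move: V0; rewrite h ltxx.
Qed.

Lemma uniform_dominated : uniform d L `<< vol.
Proof.
move=> N N0 A mA AN; rewrite uniformE (N0 A)//; exact: mul0e.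
Qed.

Lemma uniform_real_density :
  {ae vol, forall x, real_density vol (uniform d L) x = V^-1}.
Proof.
apply: real_density_unique; [exact: uniform_dominated|exact: L1_cst|].
by move=> A mA; rewrite uniformE integral_cst// muleC.
Qed.

End torus_measures.

Section energy_of_measures.
Variables (R : realType) (d : nat) (L m : R) (W : 'rV[R]_d -> R).
Hypotheses (L0 : 0 < L) (m1 : 1 < m) (Wper : torus_periodic L W)
  (Weven : even_coordinates W) (Wcont : continuous W) (Wmean : mean_zero L W).
Local Notation vol := (volume L d).
Local Notation V := (fine (volume L d setT)).
Local Notation dens P := (real_density (volume L d) P).
Local Notation density_fun := (density_fun (volume L d) m).
Local Notation excess := (excess (volume L d) (kernel W) m).
Local Notation excess_minimiser := (excess_minimiser (volume L d) (kernel W) m).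
Implicit Types (P Q : probability (pt R d) R) (b : R).

Let V0 : 0 < V. Proof. exact: mass_gt0. Qed.
Let m10 : 0 < m - 1. Proof. by rewrite subr_gt0. Qed.

Lemma power_integralE P : P `<< vol ->
  power_integral L m P = (\int[vol]_x (dens P x `^ m)%:E)%E.
Proof.
move=> Pvol; apply: eq_integral => x _.
by rewrite /density -(real_densityE Pvol).
Qed.

Lemma power_integral_finP P : P `<< vol ->
  reflect (density_fun (dens P)) (power_integral L m P \is a fin_num).
Proof.
move=> Pvol; rewrite power_integralE//.
have Ld := real_density_L1 Pvol.
have mpow : measurable_fun setT (fun x => dens P x `^ m).
  by apply: (measurableT_comp (measurable_powR m)); exact: L1_meas Ld.
apply: (iffP idP) => [fin|[_ _ _ Lm]]; last exact: integrable_fin_num.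
split => //; first by move=> x; exact: real_density_ge0.
  exact: real_density_mass.
apply/integrableP; split; first exact/measurable_EFinP.
under eq_integral do rewrite /= ger0_norm ?powR_ge0//.
by move: fin; rewrite ge0_fin_numE// integral_ge0// => x _; rewrite lee_fin powR_ge0.
Qed.

Lemma interactionE P : P `<< vol ->
  interaction L W P = (bil vol (kernel W) (dens P) (dens P))%:E.
Proof.
move=> Pvol; have Ld := real_density_L1 Pvol.
have [B KB] := kernel_bounded L0 Wper Weven Wcont.
rewrite /bil I_EFin; last exact: (L1M (L1_prod Ld Ld) KB).
apply: eq_integral => z _; rewrite /density -!(real_densityE Pvol) -!EFinM.
by congr EFin; rewrite /kernel; ring.
Qed.

(** The factor is positive and the constant is the same for all measures, so that
    minimising the free energy is minimising the excess over densities. *)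
Lemma free_energyE b P : 0 < b -> free_energy L W m b P =
  if `[< P `<< vol /\ density_fun (dens P) >]
  then (b^-1 * excess b (dens P) + b^-1 / (m - 1) * (V^-1 `^ (m - 1) - 1))%:E
  else +oo%E.
Proof.
move=> b0; rewrite /free_energy.
have [[Pvol Df]|nP] := pselect (P `<< vol /\ density_fun (dens P)); last first.
  rewrite !asboolF// => -[Pvol [fin _]]; apply: nP; split => //.
  exact/power_integral_finP.
have [_ _ _ Lm] := Df.
rewrite !asboolT//; last first.
  split => //; split; first exact/power_integral_finP.
  by rewrite interactionE.
rewrite power_integralE// interactionE// -(I_EFin Lm) -!EFinM -EFinB -EFinD.
congr EFin; rewrite /excess; field.
by rewrite !gt_eqF.
Qed.

(** The density of the measure built from [f] agrees with [f] almost everywhere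
    only. *)
Lemma realise f : density_fun f -> exists P, [/\ on_torus L P, P `<< vol,
  density_fun (dens P), {ae vol, forall x, dens P x = f x} &
  forall b, excess b (dens P) = excess b f].
Proof.
move=> Df; have [f0 Lf f1 fm] := Df.
pose p := ProbabilityDensity f0 Lf f1.
have pv := pdf_probability_dominated p.
have [B KB] := kernel_bounded L0 Wper Weven Wcont.
have pf : {ae vol, forall x, f x = dens (pdf_probability p) x}.
  by apply: filterS (real_density_pdf p) => x ->.
have [Dp Ep] := density_ae KB Df (L1_meas (real_density_L1 pv))
  (real_density_ge0 pv) pf.
exists (pdf_probability p); split=> //; first exact: dominated_on_torus.
exact: real_density_pdf.
Qed.

Lemma uniform_density : density_fun (dens (uniform d L)) /\
  forall b, excess b (dens (uniform d L)) = 0.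
Proof.
have [B KB] := kernel_bounded L0 Wper Weven Wcont.
have uv := uniform_dominated (d := d) L0.
have ue : {ae vol, forall x, V^-1 = dens (uniform d L) x}.
  by apply: filterS (uniform_real_density d L0) => x ->.
have [Du Eu] := density_ae KB (density_rho m V0) (L1_meas (real_density_L1 uv))
  (real_density_ge0 uv) ue.
split=> // b; rewrite Eu; apply: excess_rho => //; first exact: KB.
exact: kernel_annihilates_constants.
Qed.

Lemma minimiserP b P : 0 < b -> minimiser L W m b P <->
  P `<< vol /\ excess_minimiser b (dens P).
Proof.
move=> b0; have bi0 : 0 < b^-1 by rewrite invr_gt0.
have [Du _] := uniform_density; have uv := uniform_dominated (d := d) L0.
split=> [[Pt Pmin]|[Pvol [DP Pmin]]].
  have := Pmin _ (dominated_on_torus L0 uv); rewrite !free_energyE//.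
  rewrite [X in (_ <= X)%E]ifT; last exact/asboolP.
  case: asboolP => // -[Pvol DP] _.
  split=> //; split=> // g /realise[Q [Qt Qvol DQ _ <-]].
  have := Pmin Q Qt; rewrite !free_energyE// !asboolT// lee_fin lerD2r.
  by rewrite ler_pM2l.
split; first exact: dominated_on_torus.
move=> Q Qt; rewrite !free_energyE// asboolT//; case: asboolP => [[Qvol DQ]|_].
  by rewrite lee_fin lerD2r ler_pM2l// Pmin.
exact: leey.
Qed.

End energy_of_measures.

(** * Fourier coefficients and the transition point *)

Section fourier_coefficients.
Variables (R : realType) (d : nat) (L m : R) (W : 'rV[R]_d -> R).
Hypotheses (L0 : 0 < L) (m1 : 1 < m) (Wper : torus_periodic L W)
  (Weven : even_coordinates W) (Wcont : continuous W) (Wunst : ~ H_stable L W).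
Local Notation vol := (volume L d).
Local Notation V := (fine (volume L d setT)).
Implicit Types k : 'rV[int]_d.

Definition fourier_scale : R := L `^ (- (d%:R / 2)).

Lemma fourier_scale_gt0 : 0 < fourier_scale.
Proof. exact: powR_gt0. Qed.

Lemma Theta_gt0 k : 0 < Theta R k.
Proof.
apply: prodr_gt0 => i _; rewrite sqrtr_gt0 subr_gt0.
by case: eqP => _; rewrite ltr_nat.
Qed.

Lemma fourier1E (n : int) (t : R) :
  fourier1 L n t = (-1) ^+ (n < 0)%R * trig L (n < 0)%R `|n|%N t.
Proof.
rewrite /fourier1 /trig; case: (ltrgtP n 0) => [n0|n0|->] /=.
- rewrite expr1 mulN1r -sinN; congr sin; rewrite /zangle.
  have -> : n%:~R = - (`|n|%N : int)%:~R :> R.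
    by rewrite -mulrNz; congr (_%:~R); rewrite abszE ltr0_norm// opprK.
  by rewrite mulrN !mulNr.
- by rewrite expr0 mul1r /zangle gez0_abs// ltW.
- by rewrite expr0 mul1r /zangle mulr0 !mul0r cos0.
Qed.

Lemma fourier_coefE k : fourier_coef L W k =
  fourier_scale * Theta R k * \prod_i (-1) ^+ (k 0 i < 0)%R *
  moment L W (fun i => `|k 0%R i|%N) (fun i => (k 0 i < 0)%R).
Proof.
have [B WB] := W_vec_bounded L0 Wper Weven Wcont.
have LW : L1 vol (fun x => W (vec x) *
    mode L (fun i => `|k 0%R i|%N) (fun i => (k 0 i < 0)%R) x).
  exact: (L1M (L1_bounded vol WB) (bounded_mode L _ _)).
rewrite /moment -IZ//; apply: I_eq => x; rewrite /fourier -/fourier_scale /mode /tensor.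
have -> : \prod_(i < d) fourier1 L (k 0 i) (vec x 0 i) =
    \prod_(i < d) (-1) ^+ (k 0 i < 0)%R *
    \prod_(i < d) trig L (k 0 i < 0)%R `|k 0%R i|%N (tnth x i).
  by rewrite -big_split; apply: eq_bigr => i _; rewrite fourier1E mxE.
ring.
Qed.

Lemma fourier_coef_nonneg k : (forall i, 0 <= k 0 i) ->
  fourier_coef L W k / Theta R k = fourier_scale * moment L W (fun i => `|k 0%R i|%N) (fun=> false).
Proof.
move=> k0; rewrite fourier_coefE.
have -> : (fun i => (k 0 i < 0)%R) = fun=> false.
  by apply/funext => i; rewrite ltNge k0.
rewrite big1 ?mulr1; last by move=> i _; rewrite ltNge k0.
by field; rewrite gt_eqF// Theta_gt0.
Qed.

Lemma fourier_coef_neg k i : k 0 i < 0 -> fourier_coef L W k = 0.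
Proof. by move=> ki; rewrite fourier_coefE (moment_sin _ _ _ _ _ (i := i)) ?mulr0. Qed.

Let S := [set fourier_coef L W k / Theta R k | k in
        [set k : 'rV[int]_d | (forall i, 0 <= k 0 i) /\ k != 0]].

(** A negative coefficient has all its indices nonnegative, as the coefficients
    with a sine vanish. *)
Lemma coef_set_has_inf : has_inf S /\ exists2 x, S x & x < 0.
Proof.
have [k k0 ck] : exists2 k, k != 0 & fourier_coef L W k < 0.
  apply: contrapT => /forall2NP H; apply: Wunst => k k0.
  by have [//|/negP] := H k; rewrite -leNgt.
have kpos i : 0 <= k 0 i.
  by rewrite leNgt; apply/negP => /fourier_coef_neg h; move: ck; rewrite h ltxx.
have Sk : S (fourier_coef L W k / Theta R k) by exists k.
split; last by exists (fourier_coef L W k / Theta R k) => //; rewrite pmulr_llt0// invr_gt0 Theta_gt0.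
split; first by exists (fourier_coef L W k / Theta R k).
have [B WB] := W_vec_bounded L0 Wper Weven Wcont.
exists (- (fourier_scale * (B * V))) => _ [l [l0 _] <-].
rewrite fourier_coef_nonneg// lerNl -mulrN ler_pM2l ?fourier_scale_gt0//.
apply: le_trans (ler_norm _) _; rewrite normrN.
have LW : L1 vol (fun x => W (vec x) * mode L (fun i => `|l 0%R i|%N) (fun=> false) x).
  exact: (L1M (L1_bounded vol WB) (bounded_mode L _ _)).
apply: le_trans (I_norm LW) _; rewrite -(Rintegral_cst vol measurableT).
apply: I_le; [exact: L1_norm|exact: L1_cst|move=> x].
rewrite normrM -[leRHS]mulr1 ler_pM//; first by have [_] := WB; apply.
by have [_] := bounded_mode L (fun i => `|l 0%R i|%N) (fun=> false); apply.
Qed.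

(** The infimum of the eigenvalues of the interaction operator on functions of mean
    zero: the factor between coefficients and moments is removed. *)
Definition lambda : R := min_coef L W / fourier_scale.

Lemma min_coef_lt0 : min_coef L W < 0.
Proof.
have [infS [x Sx x0]] := coef_set_has_inf.
by apply: le_lt_trans x0; apply: ge_inf => //; case: infS.
Qed.

Lemma lambda_lt0 : lambda < 0.
Proof. by rewrite pmulr_llt0 ?min_coef_lt0// invr_gt0 fourier_scale_gt0. Qed.

Lemma lambda_le (k : 'I_d -> nat) i : k i != 0%N -> lambda <= moment L W k (fun=> false).
Proof.
move=> ki; have [[_ lbS] _] := coef_set_has_inf.
rewrite ler_pdivrMr ?fourier_scale_gt0// mulrC; apply: ge_inf => //.
exists (\row_i (k i)%:Z); first split.
- by move=> j; rewrite mxE.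
- apply/eqP => /rowP/(_ i); rewrite !mxE => -[] /eqP; exact/negP.
rewrite fourier_coef_nonneg; last by move=> j; rewrite mxE.
by congr (_ * moment _ _ _ _); apply/funext => j; rewrite mxE.
Qed.

Lemma lambda_approached l : lambda < l -> exists k : 'I_d -> nat,
  (exists i, k i != 0%N) /\ moment L W k (fun=> false) <= l.
Proof.
rewrite ltr_pdivrMr ?fourier_scale_gt0// => ll.
have [infS _] := coef_set_has_inf.
have e0 : 0 < l * fourier_scale - min_coef L W by rewrite subr_gt0.
have [_ [k [k0 kn0] <-]] := inf_adherent e0 infS.
rewrite -/(min_coef L W) [_ + (_ - _)]addrC subrK fourier_coef_nonneg// => lt.
exists (fun i => `|k 0%R i|%N); split.
  apply: contrapT => /forallNP H; move/eqP : kn0; apply; apply/rowP => i.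
  by rewrite mxE; apply/eqP; rewrite -absz_eq0; apply/negPn/negP; exact: H.
by move: lt; rewrite mulrC ltr_pM2r ?fourier_scale_gt0// => /ltW.
Qed.

(** With total mass [V = L ^ d] the factor [L ^ (- d / 2)] accounts for the exponent
    [m - 3 / 2] in place of [m - 2]. *)
Lemma beta_sharpE : beta_sharp L W m = m * V^-1 `^ (m - 2) / - lambda.
Proof.
have s0 := fourier_scale_gt0; have mc := min_coef_lt0; have V0 := mass_gt0 d L0.
have rE : V^-1 `^ (2^-1) = fourier_scale.
  rewrite volume_mass// -powR_invn ?(ltW L0)// -powRrM /fourier_scale.
  by congr (_ `^ _); field.
have -> : beta_sharp L W m = - (m * V^-1 `^ (m - 3 / 2) / min_coef L W).
  by rewrite /beta_sharp rho_infE.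
have -> : m - 3 / 2 = m - 2 + 2^-1 by field.
rewrite powRD; last by apply/implyP => _; rewrite gt_eqF// invr_gt0.
rewrite rE /lambda; field.
by rewrite (gt_eqF s0) (lt_eqF mc).
Qed.

End fourier_coefficients.

Section phase_transition.
Variables (R : realType) (d : nat) (L m : R) (W : 'rV[R]_d -> R).
Hypotheses (L0 : 0 < L) (m1 : 1 < m) (Wper : torus_periodic L W)
  (Weven : even_coordinates W) (Wcont : continuous W) (Wmean : mean_zero L W)
  (Wunst : ~ H_stable L W).
Local Notation vol := (volume L d).
Local Notation V := (fine (volume L d setT)).
Local Notation dens P := (real_density (volume L d) P).
Local Notation density_fun := (density_fun (volume L d) m).
Local Notation excess := (excess (volume L d) (kernel W) m).
Local Notation bsharp := (beta_sharp L W m).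
Implicit Types (b eta : R) (P Q : probability (pt R d) R).

Let V0 : 0 < V. Proof. exact: mass_gt0. Qed.
Let KB := projT2 (cid (kernel_bounded L0 Wper Weven Wcont)).
Let ann := kernel_annihilates_constants L0 Wper Weven Wcont Wmean.
Let lam0 := lambda_lt0 L0 Wper Weven Wcont Wunst.
Let fr := kernel_finite_rank L0 Wper Weven Wcont.
Let slb := kernel_lower_bound L0 Wper Weven Wcont (ltW lam0)
  (lambda_le L0 Wper Weven Wcont Wunst).
Let sba := kernel_bound_approached L0 Wper Weven Wcont
  (lambda_approached L0 Wper Weven Wcont Wunst).

Lemma bsharp_pos : 0 < bsharp.
Proof. by rewrite (beta_sharpE m L0 Wper Weven Wcont Wunst) bsharp_gt0. Qed.

Lemma uniform_minimiserP b : 0 < b -> minimiser L W m b (uniform d L) <->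
  forall f, density_fun f -> 0 <= excess b f.
Proof.
move=> b0; rewrite (minimiserP L0 m1 Wper Weven Wcont Wmean)//.
have [Du Eu] := uniform_density L0 m1 Wper Weven Wcont Wmean.
split=> [[_ [_ H]] f Df|H]; first by rewrite -(Eu b) H.
split; first exact: uniform_dominated.
by split=> // g Dg; rewrite Eu H.
Qed.

Lemma same_as_uniform P : P `<< vol ->
  same_measure P (uniform d L) <-> {ae vol, forall x, dens P x = V^-1}.
Proof.
move=> Pvol; have eqd := eq_probability_density Pvol (uniform_dominated (d := d) L0).
have h := uniform_real_density d L0.
split=> [/eqd|] H; last apply/eqd; by apply: filterS2 H h => x -> ->.
Qed.

Lemma uniform_unique_minimiserP b : 0 < b ->
  unique_minimiser L W m b (uniform d L) <->
  (forall f, density_fun f -> 0 <= excess b f) /\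
  (forall f, density_fun f -> excess b f <= 0 -> {ae vol, forall x, f x = V^-1}).
Proof.
move=> b0; rewrite /unique_minimiser uniform_minimiserP//; split=> -[min uniq]; split=> //.
  move=> f Df fle; have [P [Pt Pvol DP Pf EP]] := realise L0 Wper Weven Wcont Df.
  have : same_measure P (uniform d L).
    apply: uniq; apply/(minimiserP L0 m1 Wper Weven Wcont Wmean) => //.
    by split=> //; split=> // g Dg; rewrite EP (le_trans fle)// min.
  by move/(same_as_uniform Pvol); apply: filterS2 Pf => x ->.
move=> P /(minimiserP L0 m1 Wper Weven Wcont Wmean P b0)[Pvol [DP Pmin]].
apply/same_as_uniform => //; apply: uniq => //.
by rewrite -(excess_rho m1 KB V0 ann b); apply: Pmin; exact: density_rho.
Qed.

Lemma unique_below b b' : 0 < b' < b -> minimiser L W m b (uniform d L) ->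
  unique_minimiser L W m b' (uniform d L).
Proof.
move=> /andP[b'0 b'b] /uniform_minimiserP => /(_ (lt_trans b'0 b'b)) H.
have bb : 0 <= b' < b by rewrite ltW.
apply/uniform_unique_minimiserP => //.
by split=> f Df; have [] := excess_below m1 V0 bb H Df.
Qed.

Lemma not_minimiser_above_bsharp b : bsharp < b -> ~ minimiser L W m b (uniform d L).
Proof.
move=> bb; have b0 := lt_trans bsharp_pos bb.
move/uniform_minimiserP => /(_ b0) H.
rewrite (beta_sharpE m L0 Wper Weven Wcont Wunst) in bb.
have [f Df] := rho_unstable m1 KB V0 ann lam0 sba bb.
by rewrite ltNge H.
Qed.

Lemma transition_point_exists : exists bc, transition_point L W m bc.
Proof.
have [bc [bc0 H1 H2]] := critical_parameter m1 KB V0 ann lam0 fr slb sba.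
have mbc : minimiser L W m bc (uniform d L) by apply/uniform_minimiserP.
exists bc; split=> // [b b0 bb|b bb].
  by apply: unique_below mbc; rewrite b0.
have b0 := lt_trans bc0 bb.
have [f [Df fmin] flt] := H2 b bb.
have [P [Pt Pvol DP Pf EP]] := realise L0 Wper Weven Wcont Df.
exists P.
  apply/(minimiserP L0 m1 Wper Weven Wcont Wmean) => //.
  by split=> //; split=> // g Dg; rewrite EP fmin.
move/(same_as_uniform Pvol) => Pr.
have Vi0 : 0 <= V^-1 by rewrite invr_ge0 ltW.
have [_ /(_ b)] := density_ae KB DP (measurable_cst V^-1) (fun=> Vi0) Pr.
rewrite EP (excess_rho m1 KB V0 ann b) => fE.
by move: flt; rewrite -fE ltxx.
Qed.

Lemma dist_to_uniform_le P eta : 0 <= eta -> P `<< vol ->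
  {ae vol, forall x, `|dens P x - V^-1| <= eta} <->
  (dist_to_uniform L P <= eta%:E)%E.
Proof.
move=> eta0 Pvol; rewrite /dist_to_uniform unlock/= ifT; last first.
  by rewrite lt0e measure_ge0 andbT; apply/eqP => h; move: V0; rewrite h ltxx.
have dE x : (abse (density L P x - (rho_inf d L)%:E) = `|dens P x - V^-1|%:E)%E.
  by rewrite /density -(real_densityE Pvol) rho_infE.
split=> [H|/ess_supP H].
  by apply/ess_supP; apply: filterS H => x; rewrite /= dE lee_fin.
by apply: filterS H => x; rewrite /= dE lee_fin.
Qed.

Lemma dist_to_uniform_ge0 P : (0 <= dist_to_uniform L P)%E.
Proof. exact: Lnorm_ge0. Qed.

(** [minimisers_continuous] bounds the limit superior from above by any positive
    number. *)
Lemma continuous_of_unique bc : transition_point L W m bc ->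
  unique_minimiser L W m bc (uniform d L) -> continuous_transition_point L W m bc.
Proof.
move=> tp um; split=> // rho rho_min; have [bc0 _ _ _] := tp.
have /(uniform_unique_minimiserP bc0)[min uniq] := um.
apply/eqP; rewrite eq_le; apply/andP; split; last first.
  apply: le_ereal_inf_tmp => _ [A Abc <-].
  have [b Ab] : exists b, A b.
    exact: (@filter_ex _ (bc^'+)).
  by apply: le_trans (dist_to_uniform_ge0 (rho b)) _; apply: ereal_sup_ubound; exists b.
apply/lee_addgt0Pr => eta eta0; rewrite add0e.
have [dl dl0 Hdl] := minimisers_continuous m1 KB V0 ann fr bc0 eta0 min uniq.
apply: ereal_inf_le; exists (ereal_sup ((fun b => dist_to_uniform L (rho b)) @`
    [set b | bc < b <= bc + dl])).
  exists [set b | bc < b <= bc + dl] => //.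
  near=> b; apply/andP; split; first by near: b; exact: nbhs_right_gt.
  by near: b; apply: nbhs_right_le; rewrite ltrDl.
apply: ge_ereal_sup => _ [b /andP[bb bdl] <-].
have b0 := lt_trans bc0 bb.
have /(minimiserP L0 m1 Wper Weven Wcont Wmean (rho b) b0)[Pvol Pmin] := rho_min b bb.
apply/dist_to_uniform_le => //; first exact: ltW.
by apply: Hdl Pmin; rewrite (ltW bb).
Unshelve. all: by end_near. Qed.

(** If the transition were continuous, a branch of nonuniform minimisers would enter
    the neighbourhood in which the uniform density is a strict local minimiser for
    all parameters up to some [b1 < bsharp]. *)
Lemma discontinuous_below_bsharp bc : transition_point L W m bc -> bc < bsharp ->
  ~ continuous_transition_point L W m bc.
Proof.
move=> [bc0 _ _ ex] bcs [_ _ cont].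
have /choice[rho Hrho] : forall b, exists P, bc < b ->
    minimiser L W m b P /\ ~ same_measure P (uniform d L).
  move=> b; have [bb|bb] := ltP bc b; last by exists (uniform d L).
  by have [P Pmin Pn] := ex b bb; exists P.
have := cont rho (fun b bb => (Hrho b bb).1).
pose b1 := (bc + bsharp) / 2.
have b1s : 0 <= b1 < bsharp by rewrite /b1; apply/andP; split; lra.
have bcb1 : bc < b1 by rewrite /b1; lra.
have b1s' := b1s; rewrite [X in _ < X](beta_sharpE m L0 Wper Weven Wcont Wunst) in b1s'.
have [eta eta0 Heta] := rho_strict_local_minimiser m1 KB V0 ann lam0 slb b1s'.
move=> lim0; have : (limf_esup (fun b => dist_to_uniform L (rho b)) (bc^'+) < eta%:E)%E.
  by rewrite lim0 lte_fin.
move=> /ereal_inf_lt[_ [A Abc <-] supA].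
have [b [Ab /andP[bb bb1]]] : exists b, A b /\ bc < b <= b1.
  apply: (@filter_ex _ (bc^'+)); apply: filterI => //.
  near=> b; apply/andP; split; first by near: b; exact: nbhs_right_gt.
  by near: b; exact: nbhs_right_le.
have [Pmin Pn] := Hrho b bb; apply: Pn.
have b0 := lt_trans bc0 bb.
have [Pvol [DP EP]] := (minimiserP L0 m1 Wper Weven Wcont Wmean (rho b) b0).1 Pmin.
apply/same_as_uniform => //; apply: (Heta b) => //; first by rewrite ltW.
- apply/dist_to_uniform_le => //; first exact: ltW.
  by apply: le_trans (ltW supA); apply: ereal_sup_ubound; exists b.
- by rewrite -(excess_rho m1 KB V0 ann b); apply: EP; exact: density_rho.
Unshelve. all: by end_near. Qed.

End phase_transition.

Theorem proposition5p18 (R : realType) (d : nat) (L m : R) (W : 'rV[R]_d -> R)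
  (d_gt0 : (0 < d)%N) (L_gt0 : 0 < L) (m_gt1 : 1 < m)
  (W_periodic : torus_periodic L W) (W_C2 : C2 W) (W_even : even_coordinates W)
  (W_mean : mean_zero L W) (W_unstable : ~ H_stable L W) :
  (exists betac : R, transition_point L W m betac) /\
  forall betac : R, transition_point L W m betac ->
    (unique_minimiser L W m (beta_sharp L W m) (uniform d L) ->
       betac = beta_sharp L W m /\ continuous_transition_point L W m betac) /\
    (~ minimiser L W m (beta_sharp L W m) (uniform d L) ->
       betac < beta_sharp L W m /\ discontinuous_transition_point L W m betac).
Proof.
have W_cont : continuous W by case: W_C2 => -[].
have bs0 := bsharp_pos L_gt0 m_gt1 W_periodic W_even W_cont W_unstable.
split; first exact: transition_point_exists.
move=> bc tp; have [bc0 below at_bc above] := tp; split=> [um|nm].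
  have bcE : bc = beta_sharp L W m.
    apply/eqP; rewrite eq_le; apply/andP; split; rewrite leNgt; apply/negP => lt.
      pose b := (beta_sharp L W m + bc) / 2.
      have b1 : beta_sharp L W m < b by rewrite /b; lra.
      have b2 : b < bc by rewrite /b; lra.
      have [] := not_minimiser_above_bsharp L_gt0 m_gt1 W_periodic W_even W_cont
        W_mean W_unstable b1.
      by have [] := below b (lt_trans bs0 b1) b2.
    by have [P Pmin] := above _ lt; apply; exact: um.2.
  by split=> //; apply: continuous_of_unique => //; rewrite bcE.
have lt : bc < beta_sharp L W m.
  rewrite ltNge le_eqVlt; apply/negP => /predU1P[e|lt]; first by apply: nm; rewrite e.
  by apply: nm; have [] := below _ bs0 lt.
by split=> //; split=> //; exact: discontinuous_below_bsharp.
Qed.
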